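(* Let $d>1$ be an integer, let $k\ge1$ and $0\le l<k$ be integers, and let $E(\mathbb{T}^d)$ and $F(\mathbb{T}^d)$ be symmetric function spaces on the torus $\mathbb{T}^d$, corresponding to symmetric function spaces $E$ and $F$ on $(0,1)$. If the Cesàro operator $C$ is bounded on $E$ and on $F$, then there is a constant $c>0$, independent of $u$, such that for all $u\in W^{k,1}(\mathbb{T}^d)\cap F(\mathbb{T}^d)$, $$\|\nabla^l u\|_{E(\mathbb{T}^d)^{\frac{l}{k}}F(\mathbb{T}^d)^{1-\frac{l}{k}}}\le c\,\|\nabla^k u\|_{E(\mathbb{T}^d)}^{\frac{l}{k}}\,\|u\|_{F(\mathbb{T}^d)}^{1-\frac{l}{k}}.$$
   Context: $\mathbb{T}^d$ is the $d$-dimensional torus with normalized Haar (Lebesgue) measure. $W^{k,1}(\mathbb{T}^d)$ is the space of distributions $u$ on $\mathbb{T}^d$ with $\nabla^\alpha u\in L_1(\mathbb{T}^d)$ for all multi-indices $\alpha\in\mathbb{Z}_+^d$ with $|\alpha|_1=\alpha_1+\cdots+\alpha_d\le k$, where $\nabla^\alpha=\partial_1^{\alpha_1}\cdots\partial_d^{\alpha_d}$ and $\partial_j$ is normalized by $\partial_j e^{2\pi i\langle n,t\rangle}=2\pi i n_j e^{2\pi i\langle n,t\rangle}$. For a measurable function $f$ on a probability space, $\mu(f)$ denotes the decreasing rearrangement of $|f|$, a function on $(0,1)$. A symmetric function space on $(0,1)$ is a linear subspace $E$ of $L_0(0,1)$ (a.e. finite measurable functions) with a complete norm such that $f\in E$,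 $g\in L_0(0,1)$, $\mu(g)\le\mu(f)$ imply $g\in E$ and $\|g\|_E\le\|f\|_E$. The corresponding space on the torus is $E(\mathbb{T}^d)=\{f\in L_0(\mathbb{T}^d):\mu(f)\in E\}$ with $\|f\|_{E(\mathbb{T}^d)}=\|\mu(f)\|_E$. The Cesàro operator is $(C\varphi)(t)=\frac1t\int_0^t\varphi(s)\,ds$, $t\in(0,1)$; ''bounded on $E$'' means that $C$ maps $E$ into $E$ boundedly. For $0<\epsilon<1$ the Calderón–Lozanovskii space $E(\mathbb{T}^d)^\epsilon F(\mathbb{T}^d)^{1-\epsilon}$ consists of those measurable $h$ on $\mathbb{T}^d$ with $|h|\le f^\epsilon g^{1-\epsilon}$ for some $0\le f\in E(\mathbb{T}^d)$, $0\le g\in F(\mathbb{T}^d)$, with norm the infimum of $\max\{\|f\|_{E(\mathbb{T}^d)},\|g\|_{F(\mathbb{T}^d)}\}$ over all such $f,g$; for $\epsilon=0$ it is $F(\mathbb{T}^d)$. For a space $X$ of functions on $\mathbb{T}^d$, $\|\nabla^m u\|_X=\max_{|\alpha|_1=m}\|\nabla^\alpha u\|_X$. A norm is taken to be $+\infty$ for an element not in the space, and a factor with exponent $0$ is read as $1$. *)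

(* Defs.v *)
From HB Require Import structures.
From mathcomp Require Import all_boot all_order all_algebra.
From mathcomp Require Import all_classical all_reals all_analysis.
From mathcomp Require Import complex.

Set Implicit Arguments.
Unset Strict Implicit.
Unset Printing Implicit Defensive.

Import Order.TTheory GRing.Theory Num.Theory.
Import numFieldNormedType.Exports.

Local Open Scope classical_set_scope.
Local Open Scope ring_scope.

Local Notation normc := Normc.normc.

(* Functions are complex-valued representatives of a.e.-equivalence classes.
   Functions on (0,1) (resp. on the torus) are functions on R (resp. on R^d)
   considered modulo a probability measure concentrated on (0,1) (resp. on the
   open unit cube, a fundamental domain of R^d / Z^d up to a null set); their
   values elsewhere play no role. *)

Section prob_functions.
Context {d : measure_display} {T : measurableType d} {R : realType}.
Variable P : probability T R.
Implicit Types f g : T -> R[i].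

Definition in_L0 : set (T -> R[i]) := [set f |
  measurable_fun setT (fun x => complex.Re (f x)) /\
  measurable_fun setT (fun x => complex.Im (f x))].

Definition in_L1 : set (T -> R[i]) := [set f |
  in_L0 f /\ P.-integrable setT (fun x => (normc (f x))%:E)].

Definition cintegral (D : set T) f : R[i] :=
  Complex (\int[P]_(x in D) complex.Re (f x)) (\int[P]_(x in D) complex.Im (f x)).

(* Decreasing rearrangement of |f|. *)
Definition rearr f (t : R) : R :=
  inf [set s : R | 0 <= s /\ (P [set x | (s < normc (f x))%R] <= t%:E)%E].

End prob_functions.

Section unit_interval.
Context (R : realType).

Definition unit_prob : set (measurableTypeR R) -> \bar R :=
  mrestr (@lebesgue_measure R) (measurable_itv `]0%R, 1%R[).

HB.instance Definition _ := Measure.on unit_prob.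

Let unit_prob_setT : unit_prob setT = 1%:E.
Proof.
by rewrite /unit_prob /mrestr setTI /= lebesgue_measure_itv/= lte_fin ltr01 oppr0 adde0.
Qed.

HB.instance Definition _ :=
  @Measure_isProbability.Build _ _ R unit_prob unit_prob_setT.

End unit_interval.

Arguments unit_prob R : clear implicits.

Section torus.
Context (R : realType).

Definition euclid (n : nat) := n.-tuple (measurableTypeR R).

Definition tcons (n : nat) (x : measurableTypeR R * euclid n) : euclid n.+1 :=
  [the n.+1.-tuple (measurableTypeR R) of x.1 :: x.2].

Lemma measurable_tcons n : measurable_fun setT (@tcons n).
Proof. exact: measurable_cons. Qed.

HB.instance Definition _ n :=
  isMeasurableFun.Build _ _ _ _ (@tcons n) (@measurable_tcons n).

Fixpoint torus_prob (n : nat) : probability (euclid n) R :=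
  match n with
  | 0%N => \d_([tuple] : euclid 0)
  | n'.+1 => distribution (unit_prob R \x torus_prob n')%E (@tcons n')
  end.

End torus.

Arguments torus_prob R n : clear implicits.

Section symmetric_spaces.
Context (R : realType).
Local Notation P := (unit_prob R).

(* Invariance under a.e. equality, and the converse of [snorm_eq0], follow from
   [symm_le], since a.e.-equal functions have the same rearrangement. *)
Record symmetric_space := SymmetricSpace {
  scarrier : set (R -> R[i]);
  snorm : (R -> R[i]) -> R;
  scarrier_L0 : scarrier `<=` in_L0;
  scarrier0 : scarrier (fun=> 0);
  scarrierD : forall f g, scarrier f -> scarrier g -> scarrier (f \+ g);
  scarrierZ : forall (a : R[i]) f, scarrier f -> scarrier (fun t => a * f t);
  snorm_eq0 : forall f, scarrier f -> snorm f = 0 -> {ae P, forall t, f t = 0};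
  snormD : forall f g, scarrier f -> scarrier g ->
    snorm (f \+ g) <= snorm f + snorm g;
  snormZ : forall (a : R[i]) f, scarrier f ->
    snorm (fun t => a * f t) = normc a * snorm f;
  scomplete : forall f : nat -> R -> R[i],
    (forall n, scarrier (f n)) ->
    (forall e, 0 < e -> exists N, forall m n, (N <= m)%N -> (N <= n)%N ->
       snorm (f m \- f n) < e) ->
    exists2 g, scarrier g & (fun n => snorm (f n \- g)) @ \oo --> (0 : R);
  symm_le : forall f g, scarrier f -> in_L0 g ->
    (forall t, 0 < t < 1 -> rearr P g t <= rearr P f t) ->
    scarrier g /\ snorm g <= snorm f
}.

(* Since [unit_prob] vanishes off (0,1), for 0 < t < 1 the integral below is
   the Lebesgue integral over (0,t). *)
Definition cesaro (f : R -> R[i]) (t : R) : R[i] :=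
  (t^-1)%:C%C * cintegral P `]0, t[ f.

(* The integrability clause says that [cesaro f] is well defined. *)
Definition cesaro_bounded (E : symmetric_space) : Prop :=
  exists M : R, forall f, scarrier E f ->
    [/\ forall t, 0 < t < 1 -> P.-integrable `]0, t[ (fun s => (normc (f s))%:E),
        scarrier E (cesaro f) & snorm E (cesaro f) <= M * snorm E f].

End symmetric_spaces.

Section torus_spaces.
Context (R : realType) (d : nat).
Local Notation T := (euclid R d).
Local Notation P := (torus_prob R d).
Implicit Types (E F : symmetric_space R) (u v h : T -> R[i]).

Definition torus_space E : set (T -> R[i]) :=
  [set f | in_L0 f /\ scarrier E (fun t => (rearr P f t)%:C%C)].

Definition torus_norm E (f : T -> R[i]) : \bar R :=
  if `[< torus_space E f >] then (snorm E (fun t => (rearr P f t)%:C%C))%:E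
  else +oo%E.

(* The infimum of the empty set is +oo. *)
Definition cl_norm (e : R) E F h : \bar R :=
  if e == 0 then torus_norm F h else
  ereal_inf [set r | in_L0 h /\ exists f g : T -> R,
    [/\ (forall x, 0 <= f x) /\ (forall x, 0 <= g x),
        torus_space E (fun x => (f x)%:C%C),
        torus_space F (fun x => (g x)%:C%C),
        {ae P, forall x, normc (h x) <= f x `^ e * g x `^ (1 - e)} &
        r = maxe (torus_norm E (fun x => (f x)%:C%C))
                 (torus_norm F (fun x => (g x)%:C%C))]].

(* Smooth functions on the torus are Z^d-periodic smooth functions on R^d. *)
Definition iter_partial (s : seq 'I_d) (phi : 'rV[R]_d -> R) : 'rV[R]_d -> R :=
  foldr (fun j psi => 'D_(delta_mx 0 j) psi) phi s.

Definition test_function (phi : 'rV[R]_d -> R) : Prop :=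
  (forall j x, phi (x + delta_mx 0 j) = phi x) /\
  forall s : seq 'I_d, continuous (iter_partial s phi) /\
    forall j x, derivable (iter_partial s phi) x (delta_mx 0 j).

Definition multi_index := {ffun 'I_d -> nat}.

Definition mi_size (a : multi_index) : nat := (\sum_(j < d) a j)%N.

Definition mpartial (a : multi_index) : ('rV[R]_d -> R) -> 'rV[R]_d -> R :=
  iter_partial (flatten [seq nseq (a j) j | j <- enum 'I_d]).

Definition to_row (x : T) : 'rV[R]_d := \row_j tnth x j.

(* Real test functions suffice, by linearity. *)
Definition weak_derivative (a : multi_index) u v : Prop :=
  forall phi, test_function phi ->
    cintegral P setT (fun x => u x * (mpartial a phi (to_row x))%:C%C) =
    (-1) ^+ mi_size a *
      cintegral P setT (fun x => v x * (phi (to_row x))%:C%C).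

Definition sobolev (k : nat) : set (T -> R[i]) := [set u | in_L1 P u /\
  forall a, (mi_size a <= k)%N -> exists2 v, in_L1 P v & weak_derivative a u v].

(* A representative of the (a.e. unique) integrable function representing the
   distributional derivative, when there is one. *)
Definition nabla (a : multi_index) u : T -> R[i] :=
  xget (fun=> 0) [set v | in_L1 P v /\ weak_derivative a u v].

(* For 0 < d the supremum is over a nonempty finite set, hence a maximum. *)
Definition nabla_norm (m : nat) (N : (T -> R[i]) -> \bar R) u : \bar R :=
  ereal_sup [set N (nabla a u) | a in [set a | mi_size a = m]].

End torus_spaces.

(* Main.v *)
From HB Require Import structures.
From mathcomp Require Import all_boot all_order all_algebra.
From mathcomp Require Import all_classical all_reals all_analysis measurable_realfun.
From mathcomp Require Import complex zify ring lra.
Require Import Defs.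

(* Let R_{h,j} = (1 - h d/dx_j)^-1 be the resolvents of the coordinate translations
   of the torus. They are positive, and their maximal operators
   M_j f = sup_h R_{h,j} |f| over the positive rational scales h are of weak type
   (1,1), by the resolvent equation and a Hopf-type argument. Splitting f at height
   mu(f)(t) yields mu(M_j f) <= C mu(f), so that M_j, and N = 1 + \sum_j M_j, act
   boundedly on E(T^d) and F(T^d) when C does on E and F.

   The scaled derivative h^l \nabla^a, |a| = l < k, is a combination of products of
   resolvents and of terms h^k (product of resolvents) \nabla^b with |b| = k. This
   is an algebraic identity between Fourier multipliers, transferred to functions
   by uniqueness of Fourier coefficients on L_1. Hence, for some p and C and all h,
   h^l |\nabla^a u| <= C (N^p |u| + h^k N^p |\nabla^k u|) almost everywhere, and
   optimizing over h gives
   |\nabla^a u| <= C (N^p |\nabla^k u|)^{l/k} (N^p |u|)^{1 - l/k},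
   a factorization showing that \nabla^a u lies in the Calderon-Lozanovskii space;
   rescaling the two factors gives the multiplicative norm estimate. *)

Set Implicit Arguments.
Unset Strict Implicit.
Unset Printing Implicit Defensive.

Import Order.TTheory GRing.Theory Num.Theory.
Import numFieldNormedType.Exports.

Local Open Scope classical_set_scope.
Local Open Scope ring_scope.

(** * Exchangeability on the torus *)

(** Resolvents suit the task for two reasons. The symbol [1 / (1 + h * symb)] is rational, so a
    scaled derivative of a resolvent is a combination of the resolvent and the identity, and
    derivatives are removed by algebra alone. The resolvent equation also replaces a covering lemma,
    so the weak type constant is 1 in every dimension. No smoothing or density argument occurs: the
    only test functions used are real parts of characters, and identities between L_1 functions are
    checked on Fourier coefficients. The pointwise bound concerns arbitrary L_1 functions, whose
    iterated maximal functions need not be integrable or finite. Hence two levels: L_1 functions, on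
    which multipliers act, and extended nonnegative majorants, on which only positive operators act.
    Boundedness of the Cesàro operator serves three purposes: it bounds maximal operators, makes
    their values finite almost everywhere, and yields a triangle inequality up to a constant on the
    torus. *)

Section torus_measure.
Context (R : realType).
Local Notation U := (unit_prob R).
Local Notation I1 := (measurableTypeR R).
Local Open Scope ereal_scope.

Definition upd n (x : euclid R n) (j : 'I_n) (y : I1) : euclid R n :=
  [tuple (if i == j then y else tnth x i) | i < n].

Lemma tnth_upd n (x : euclid R n) j y i :
  tnth (upd x j y) i = if i == j then y else tnth x i.
Proof. by rewrite tnth_mktuple. Qed.

Lemma upd_cons0 n (x : euclid R n) (a y : I1) :
  upd (tcons (a, x)) ord0 y = tcons (y, x).
Proof.
apply: eq_from_tnth => i; rewrite tnth_upd.
case: (unliftP ord0 i) => [i'|] ->; last by rewrite eqxx.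
by rewrite [_ == _](_ : _ = false)// !tnthS.
Qed.

Lemma upd_consS n (x : euclid R n) (a y : I1) (j : 'I_n) :
  upd (tcons (a, x)) (lift ord0 j) y = tcons (a, upd x j y).
Proof.
apply: eq_from_tnth => i; rewrite tnth_upd.
case: (unliftP ord0 i) => [i'|] -> //=.
by rewrite !tnthS (inj_eq lift_inj) tnth_upd.
Qed.

Lemma measurable_upd n (j : 'I_n) :
  measurable_fun setT (fun p : euclid R n * I1 => upd p.1 j p.2).
Proof.
apply/measurable_fun_tnthP => i.
rewrite (_ : _ \o _ = if i == j then snd else (@tnth n I1 ^~ i) \o fst); last first.
  by apply/funext => p /=; rewrite tnth_upd; case: ifP.
case: ifP => _; first exact: measurable_snd.
by apply: measurableT_comp => //; exact: measurable_tnth.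
Qed.

Lemma integral_torusS n (F : euclid R n.+1 -> \bar R) :
  measurable_fun [set: euclid R n.+1] F -> (forall x, 0 <= F x) ->
  \int[torus_prob R n.+1]_x F x =
  \int[U]_a \int[torus_prob R n]_x F (tcons (a, x)).
Proof.
move=> mF F0 /=; rewrite ge0_integral_distribution//.
rewrite fubini_tonelli1//; last by move=> x; exact: F0.
exact (measurableT_comp mF (@measurable_tcons _ _)).
Qed.

Lemma measurable_integral2 d1 d2 (T1 : measurableType d1) (T2 : measurableType d2)
    (Q : probability T2 R) (F : T1 * T2 -> \bar R) :
  measurable_fun setT F -> (forall x, 0 <= F x) ->
  measurable_fun setT (fun x => \int[Q]_y F (x, y)).
Proof. by move=> mF F0; exact: measurable_fun_fubini_tonelli_F. Qed.

Lemma ge0_exchange d1 d2 (T1 : measurableType d1) (T2 : measurableType d2)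
    (P : probability T1 R) (Q : probability T2 R) (F : T1 * T2 -> \bar R) :
  measurable_fun setT F -> (forall x, 0 <= F x) ->
  \int[P]_x \int[Q]_y F (x, y) = \int[Q]_y \int[P]_x F (x, y).
Proof. by move=> mF F0; rewrite fubini_tonelli. Qed.

(* The pair (x_j, y) is exchangeable under the product of the torus measure
   and the measure of the j-th factor. *)
Lemma torus_exchange n (j : 'I_n) (H : euclid R n * I1 -> \bar R) :
  measurable_fun setT H -> (forall p, 0 <= H p) ->
  \int[torus_prob R n]_x \int[U]_y H (upd x j y, tnth x j) =
  \int[torus_prob R n]_x \int[U]_y H (x, y).
Proof.
elim: n j H => [[]//|n IH j H mH H0].
have mtc : measurable_fun setT (fun p : I1 * euclid R n => tcons p) := @measurable_tcons R n.
have mHupd : measurable_fun setT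
    (fun p : euclid R n.+1 * I1 => H (upd p.1 j p.2, tnth p.1 j)).
  apply: measurableT_comp => //; apply: measurable_fun_pair.
    exact: measurable_upd.
  by apply: (measurableT_comp (measurable_tnth j)).
rewrite integral_torusS//; last 2 first.
- exact (measurable_integral2 U mHupd (fun=> H0 _)).
- by move=> x; exact: integral_ge0.
rewrite (integral_torusS (F := fun x => \int[U]_y H (x, y))); last 2 first.
- exact (measurable_integral2 U mH H0).
- by move=> x; exact: integral_ge0.
(* For the first coordinate Tonelli permutes the three integrations; for a later one the first
   coordinate is frozen and the induction hypothesis applies to the others. *)
case: (unliftP ord0 j) => [j'|] ->{j mHupd}; last first.
  under eq_integral do under eq_integral do under eq_integral do rewrite upd_cons0 tnth0.
  have mc d (S : measurableType d) (f h : S -> I1) (g : S -> euclid R n) :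
      measurable_fun setT f -> measurable_fun setT g -> measurable_fun setT h ->
      measurable_fun setT (fun s => H (tcons (f s, g s), h s)).
    move=> mf mg mh; apply: (measurableT_comp mH); apply: measurable_fun_pair => //.
    by apply: (measurableT_comp mtc); exact: measurable_fun_pair.
  have e1 (a : I1) : \int[torus_prob R n]_x \int[U]_y H (tcons (y, x), a) =
      \int[U]_y \int[torus_prob R n]_x H (tcons (y, x), a).
    apply: (ge0_exchange _ _ (F := fun p => H (tcons (p.2, p.1), a))) => //.
    exact: mc.
  under eq_integral do rewrite e1.
  rewrite (ge0_exchange _ _ (F := fun p => \int[torus_prob R n]_x H (tcons (p.2, x), p.1)))//.
  - apply: eq_integral => y _.
    rewrite (ge0_exchange _ _ (F := fun p => H (tcons (y, p.2), p.1)))//.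
    exact: mc.
  - apply: (measurable_integral2 _ (F := fun p => H (tcons (p.1.2, p.2), p.1.1))) => //.
    by apply: mc => //; exact: measurableT_comp.
  - by move=> x; exact: integral_ge0.
apply: eq_integral => a _.
under eq_integral do under eq_integral do rewrite upd_consS tnthS.
rewrite (IH j' (fun p => H (tcons (a, p.1), p.2)))//.
apply: measurableT_comp => //; apply: measurable_fun_pair => //.
by apply: (measurableT_comp mtc); exact: measurable_fun_pair.
Qed.

End torus_measure.

(** * Resolvents of translations *)

Section unit_integral.
Context (R : realType).
Local Notation U := (unit_prob R).
Local Notation mu := (@lebesgue_measure R).
Local Open Scope ereal_scope.

Lemma ge0_integral_unit (f : R -> \bar R) :
  measurable_fun setT f -> (forall x, 0 <= f x) ->
  \int[U]_x f x = \int[mu]_(x in `]0%R, 1%R[) f x.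
Proof.
move=> mf f0.
have U0 : U (~` `]0%R, 1%R[%classic) = 0 by rewrite -[LHS]/(mu (_ `&` _)) setICl measure0.
rewrite (ge0_negligible_integral _ _ _ _ U0)//; last exact: measurableC.
rewrite setTD setCK; apply: eq_measure_integral => A mA A01.
by rewrite -[LHS]/(mu (_ `&` _)) setIidl.
Qed.

Lemma integral_derive (f F : R -> R) (a b : R) : (a <= b)%R ->
  continuous f -> (forall x : R, is_derive x (1:R)%R F (f x)) ->
  \int[mu]_(x in `[a, b]) (f x)%:E = (F b - F a)%:E.
Proof.
move=> ab cf dF; move: ab; rewrite le_eqVlt => /orP[/eqP ->|ab].
  by rewrite set_itv1 integral_set1 subrr.
have cF : continuous F.
  by move=> x; apply: differentiable_continuous; apply/derivable1_diffP.
rewrite (@continuous_FTC2 _ f F)//.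
- exact: continuous_subspaceT.
- split => //.
  + by apply: cvg_at_right_filter; exact: cF.
  + by apply: cvg_at_left_filter; exact: cF.
- by move=> x _; rewrite derive1E derive_val.
Qed.

End unit_integral.

(** * The periodized exponential kernel *)

Section kernel.
Context (R : realType).
Local Notation U := (unit_prob R).
Local Notation mu := (@lebesgue_measure R).

(* The resolvent (1 - h d/dx)^-1 on the circle is the convolution with the
   periodization of the exponential density s |-> h^-1 exp(- s / h), s > 0. *)
Definition rker (h a y : R) : R :=
  h^-1 / (1 - expR (- h^-1)) * expR (- h^-1 * (y - a + (y < a)%R%:R)).

Lemma rker_ge0 h a y : 0 < h -> 0 <= rker h a y.
Proof.
move=> h0; rewrite mulr_ge0 ?expR_ge0// divr_ge0 ?invr_ge0 ?(ltW h0)//.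
by rewrite subr_ge0 -expR0 ler_expR oppr_le0 invr_ge0 ltW.
Qed.

Lemma measurable_rker h : measurable_fun setT (fun p : R * R => rker h p.1 p.2).
Proof.
apply: measurable_funM => //; apply: measurableT_comp => //.
apply: measurable_funM => //; apply: measurable_funD; first exact: measurable_funB.
rewrite (_ : (fun _ => _) = (fun b : bool => b%:R) \o (fun x : R * R => (x.2 < x.1)%R)); last by [].
apply: measurableT_comp => //.
exact: measurable_fun_ltr.
Qed.

Definition twopi (m : int) : R := 2 * pi * m%:~R.

Lemma cos_period (x : R) (m : int) : cos (x + twopi m) = cos x /\ sin (x + twopi m) = sin x.
Proof.
have N : forall k (y : R), cos (y + twopi k%:Z) = cos y /\ sin (y + twopi k%:Z) = sin y.
  move=> k y; rewrite /twopi; elim: k => [|k [IHc IHs]].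
    by rewrite mulr0 addr0.
  rewrite (_ : y + _ = y + 2 * pi * k%:~R + pi *+ 2); last first.
    by rewrite -natr1 !pmulrn /=; ring.
  by rewrite cosD2pi sinD2pi.
case: m => k; first exact: N.
have := N k.+1 (x + twopi (Negz k)).
by rewrite (_ : x + _ + _ = x) => [[-> ->]//|]; rewrite /twopi NegzE mulrNz; ring.
Qed.

(** The value is 1 plus the real part of e^(i (w b + phi)) / (1 + i h w): the transposed kernel
    multiplies a character by [1 / (1 + i h w)]. The added 1 keeps the integrand nonnegative, so
    that Tonelli applies without integrability, and the free [phi] covers sines. *)
Lemma integral_rker h (m : int) (b phi : R) : 0 < h -> 0 < b < 1 ->
  let l := h^-1 in let w := twopi m in
  (\int[U]_y (rker h y b * (1 + cos (w * y + phi)))%:E)%E =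
  (1 + l / (l ^+ 2 + w ^+ 2) * (l * cos (w * b + phi) + w * sin (w * b + phi)))%:E.
Proof.
move=> h0 /andP[b0 b1] l w.
have l0 : 0 < l by rewrite invr_gt0.
have lw0 : l ^+ 2 + w ^+ 2 != 0.
  by rewrite gt_eqF// ltr_pwDl ?exprn_gt0// sqr_ge0.
have el1 : 1 - expR (- l) != 0.
  by rewrite subr_eq0 eq_sym lt_eqF// -expR0 ltr_expR oppr_lt0.
pose k0 := l / (1 - expR (- l)).
pose g y := expR (l * y) * (1 + cos (w * y + phi)).
(* An antiderivative of [g]. The kernel jumps at [b], so [G] is used on both sides of [b] with
   different factors. *)
pose G y := expR (l * y) * (l^-1 + (l ^+ 2 + w ^+ 2)^-1 *
   (l * cos (w * y + phi) + w * sin (w * y + phi))).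
have dl : forall x : R, is_derive x (1:R) (fun y : R => l * y) l.
  move=> x; apply: is_derive_eq.
  by rewrite /GRing.scale /= mulr1.
have dw : forall x : R, is_derive x (1:R) (fun y : R => w * y + phi) w.
  move=> x; apply: is_derive_eq.
  by rewrite /GRing.scale /= mulr1 addr0.
have dG : forall c x : R, is_derive x (1:R) (fun y => c * G y) (c * g x).
  move=> c x.
  have de := @is_derive1_comp _ (@expR R) (fun y : R => l * y) x _ _ (is_derive_expR _) (dl x).
  have dc := @is_derive1_comp _ (@cos R) (fun y : R => w * y + phi) x _ _ (is_derive_cos _) (dw x).
  have ds := @is_derive1_comp _ (@sin R) (fun y : R => w * y + phi) x _ _ (is_derive_sin _) (dw x).
  have := is_deriveZ c (is_deriveM de (is_deriveD (is_derive_cst (l^-1 : R) x (1:R))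
    (is_deriveZ (l ^+ 2 + w ^+ 2)^-1 (is_deriveD (is_deriveZ l dc) (is_deriveZ w ds))))).
  move=> H; apply: (@is_derive_eq _ _ _ _ _ _ _ _ H).
  rewrite /g !addrfctE /= /GRing.scale /=.
  by field; rewrite lw0 gt_eqF.
have cg : forall c : R, continuous (fun y => c * g y).
  move=> c x; apply: differentiable_continuous; apply/derivable1_diffP.
  have de := @is_derive1_comp _ (@expR R) (fun y : R => l * y) x _ _ (is_derive_expR _) (dl x).
  have dc := @is_derive1_comp _ (@cos R) (fun y : R => w * y + phi) x _ _ (is_derive_cos _) (dw x).
  have H := is_deriveZ c (is_deriveM de (is_deriveD (is_derive_cst (1 : R) x (1:R)) dc)).
  exact: (@ex_derive _ _ _ _ _ _ _ H).
have mf : measurable_fun setT (fun y => (rker h y b * (1 + cos (w * y + phi)))%:E).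
  apply/measurable_EFinP; apply: measurable_funM.
    exact: (measurable_fun_pair1 _ (@measurable_rker h)).
  apply: measurable_funD => //; apply: measurableT_comp.
    by apply: continuous_measurable_fun; exact: continuous_cos.
  by apply: measurable_funD => //; apply: measurable_funM.
rewrite ge0_integral_unit//; last first.
  move=> y; rewrite lee_fin mulr_ge0 ?rker_ge0// -lerBlDl sub0r cos_geN1//.
have -> : `]0, 1[%classic = `]0, b] `|` `]b, 1[ :> set R.
  by rewrite -itv_bndbnd_setU// bnd_simp ltW.
rewrite ge0_integral_setU//=; last 3 first.
- exact: measurable_funTS.
- by move=> y _; rewrite lee_fin mulr_ge0 ?rker_ge0// -lerBlDl sub0r cos_geN1.
- apply/disj_setPRL => y /=; rewrite !in_itv/= => /andP[by1 _].
  by rewrite leNgt by1 andbF.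
rewrite (@integral_itv_bndoo _ 0 b _ false false); last exact: measurable_funTS.
have e1 : (\int[mu]_(y in `]0%R, b[) (rker h y b * (1 + cos (w * y + phi)))%R%:E =
    \int[mu]_(y in `]0%R, b[) ((k0 * expR (- l * b)) * g y)%R%:E)%E.
  apply: eq_integral => y; rewrite inE/= in_itv/= => /andP[_ yb].
  rewrite /rker (lt_gtF yb) addr0 -/l -/k0 /g; congr (_%:E).
  rewrite mulrA -(mulrA k0) -expRD; congr (_ * expR _ * _); ring.
have e2 : (\int[mu]_(y in `]b, 1%R[) (rker h y b * (1 + cos (w * y + phi)))%R%:E =
    \int[mu]_(y in `]b, 1%R[) ((k0 * expR (- l * (b + 1))) * g y)%R%:E)%E.
  apply: eq_integral => y; rewrite inE/= in_itv/= => /andP[yb _].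
  rewrite /rker yb -/l -/k0 /g; congr (_%:E).
  rewrite mulrA -(mulrA k0) -expRD; congr (_ * expR _ * _) => /=; ring.
have mg : forall (c x z : R), measurable_fun `]x, z[%classic (fun y => (c * g y)%:E).
  move=> c x z; apply: measurable_funTS; apply/measurable_EFinP.
  exact: (continuous_measurable_fun (cg c)).
rewrite e1 e2 -(@integral_itv_bndoo _ _ _ _ true false)//.
rewrite -(@integral_itv_bndoo _ b _ _ true false)//.
rewrite (integral_derive (ltW b0) (cg _) (dG _)) (integral_derive (ltW b1) (cg _) (dG _)).
rewrite -EFinD; congr (_%:E).
(* Since [w] is an integer multiple of 2 pi, the boundary terms at 0 and 1 cancel and only those at
   [b] remain. *)
have [c1 s1] := cos_period phi m.
rewrite /G !mulr0 !mulr1 add0r [w + phi]addrC.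
rewrite /w c1 s1 -/w expR0 mul1r.
rewrite [- l * (b + 1)]mulrDr mulr1 expRD mulNr !expRN /k0 expRN.
have : expR (l * b) != 0 by rewrite gt_eqF ?expR_gt0.
have : expR l != 0 by rewrite gt_eqF ?expR_gt0.
move: el1; rewrite expRN.
move: (expR (l * b)) (expR l) (cos (w * b + phi)) (sin (w * b + phi)) (cos phi) (sin phi).
move=> eb e c s c' s' H1 e0 eb0.
have e1n : e - 1 != 0.
  by apply: contra_neq H1 => /eqP; rewrite subr_eq0 => /eqP ->; rewrite invr1 subrr.
by field; rewrite e0 eb0 e1n lw0 gt_eqF.
Qed.

End kernel.

(** * Resolvents acting in one coordinate of the torus *)

Section torus_resolvent.
Context (R : realType) (d : nat).
Local Notation T := (euclid R d).
Local Notation P := (torus_prob R d).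
Local Notation U := (unit_prob R).
Implicit Types (n : 'I_d -> int) (x : T) (j : 'I_d).

Lemma measurable_tnthT j : measurable_fun [set: T] (fun x : T => tnth x j).
Proof. exact: measurable_tnth. Qed.

(** Exchangeability, applied to a function of the fresh variable alone, shows that [tnth x j] has
    the law [unit_prob R], which does not charge the complement of (0, 1). *)
Lemma ae_torus_itv j : {ae P, forall x : T, 0 < tnth x j < 1}.
Proof.
pose A : set R := ~` `]0, 1[%classic.
have mA : measurable A by exact: measurableC.
have mB : measurable [set x : T | A (tnth x j)].
  by rewrite -[X in measurable X]setTI; exact: measurable_tnthT.
exists [set x : T | A (tnth x j)]; split => //.
rewrite -[[set x : T | _]]setIT -integral_indic//.
pose H (p : T * measurableTypeR R) := (\1_A p.2 : R)%:E.
have mH : measurable_fun setT H.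
  apply/measurable_EFinP; apply: (measurableT_comp (f := \1_A : measurableTypeR R -> R) (g := snd)).
    exact: measurable_indic.
  exact: measurable_snd.
transitivity (\int[P]_x \int[U]_y H (upd x j y, tnth x j))%E.
  apply: eq_integral => x _.
  transitivity (\int[U]_y cst (\1_A (tnth x j) : R)%:E y)%E; last by [].
  by rewrite integral_cst// [X in (_ * X)%E](@probability_setT _ _ _ U) mule1 !indicE.
rewrite torus_exchange//; last by move=> p; rewrite /H lee_fin indicE.
apply: integral0_eq => x _; rewrite integral_indic// setIT.
by rewrite -[LHS]/(lebesgue_measure (_ `&` _)) setICl measure0.
Qed.

Definition phase n x : R := \sum_(j < d) twopi R (n j) * tnth x j.

Lemma measurable_phase n : measurable_fun [set: T] (phase n).
Proof.
apply: measurable_sum => j; apply: measurable_funM => //.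
exact: measurable_tnthT.
Qed.

Lemma phase_upd n x j y :
  phase n (upd x j y) = phase n x - twopi R (n j) * tnth x j + twopi R (n j) * y.
Proof.
rewrite /phase (bigD1 j)//= [in RHS](bigD1 j)//= tnth_upd eqxx.
rewrite [X in _ + X](eq_bigr (fun i => twopi R (n i) * tnth x i)); last first.
  by move=> i /negPf ij; rewrite tnth_upd ij.
by ring.
Qed.

(** Extended-valued, so that it is meaningful at every point for every nonnegative measurable [f],
    integrable or not. *)
Definition rop (h : R) j (f : T -> \bar R) x : \bar R :=
  (\int[U]_y ((rker h (tnth x j) y)%:E * f (upd x j y)))%E.

Section rop.
Variables (h : R) (j : 'I_d).
Hypothesis h0 : 0 < h.
Implicit Types f g : T -> \bar R.
Local Open Scope ereal_scope.

Lemma rker_gee0 a y : 0 <= (rker h a y)%:E.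
Proof. by rewrite lee_fin rker_ge0. Qed.

Lemma measurable_rop_integrand f : measurable_fun setT f ->
  measurable_fun setT
    (fun p : T * measurableTypeR R => (rker h (tnth p.1 j) p.2)%:E * f (upd p.1 j p.2)).
Proof.
move=> mf; apply: emeasurable_funM; last exact: (measurableT_comp mf (@measurable_upd R d j)).
apply/measurable_EFinP.
apply: (measurableT_comp (@measurable_rker R h) (g := fun p : T * _ => (tnth p.1 j, p.2))).
apply: measurable_fun_pair; last exact: measurable_snd.
by apply: (measurableT_comp (measurable_tnthT j)).
Qed.

Lemma rop_ge0 f x : (forall x, 0 <= f x) -> 0 <= rop h j f x.
Proof. by move=> f0; apply: integral_ge0 => y _; rewrite mule_ge0 ?rker_gee0. Qed.

Lemma measurable_rop f : measurable_fun setT f -> (forall x, 0 <= f x) ->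
  measurable_fun setT (rop h j f).
Proof.
move=> mf f0; apply: (measurable_integral2 _ (measurable_rop_integrand mf)) => p.
by rewrite mule_ge0 ?rker_gee0.
Qed.

Lemma measurable_rop1 f x : measurable_fun setT f ->
  measurable_fun setT (fun y : measurableTypeR R => (rker h (tnth x j) y)%:E * f (upd x j y)).
Proof. by move=> mf; exact: (measurable_fun_pair2 x (measurable_rop_integrand mf)). Qed.

Lemma le_rop f g x : measurable_fun setT f -> measurable_fun setT g ->
  (forall x, 0 <= f x) -> (forall x, f x <= g x) -> rop h j f x <= rop h j g x.
Proof.
move=> mf mg f0 fg; apply: ge0_le_integral => //.
- by move=> y _; rewrite mule_ge0 ?rker_gee0.
- exact: measurable_rop1.
- exact: measurable_rop1.
- by move=> y _; rewrite lee_pmul ?rker_gee0.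
Qed.

Lemma ropD f g x : measurable_fun setT f -> measurable_fun setT g ->
  (forall x, 0 <= f x) -> (forall x, 0 <= g x) ->
  rop h j (f \+ g) x = rop h j f x + rop h j g x.
Proof.
move=> mf mg f0 g0; rewrite /rop -ge0_integralD//=.
- by apply: eq_integral => y _; rewrite ge0_muleDr.
- by move=> y _; rewrite mule_ge0 ?rker_gee0.
- exact: measurable_rop1.
- by move=> y _; rewrite mule_ge0 ?rker_gee0.
- exact: measurable_rop1.
Qed.

Lemma ropZ (c : R) f x : measurable_fun setT f -> (forall x, 0 <= f x) -> (0 <= c)%R ->
  rop h j (fun x => c%:E * f x) x = c%:E * rop h j f x.
Proof.
move=> mf f0 c0; rewrite /rop -ge0_integralZl//.
- by apply: eq_integral => y _; rewrite muleCA.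
- exact: measurable_rop1.
- by move=> y _; rewrite mule_ge0 ?rker_gee0.
Qed.

(** Exchanging [tnth x j] with the integration variable moves the resolvent onto the cosine, with
    the arguments of the kernel swapped; [integral_rker] then gives the inner integral for almost
    every [x]. *)
Lemma integral_rop_cos n phi f : measurable_fun setT f -> (forall x, 0 <= f x) ->
  let l := h^-1%R in let w := twopi R (n j) in
  \int[P]_x (rop h j f x * (1 + cos (phase n x + phi))%:E) =
  \int[P]_x (f x * (1 + l / (l ^+ 2 + w ^+ 2) *
    (l * cos (phase n x + phi) + w * sin (phase n x + phi)))%:E).
Proof.
move=> mf f0 l w.
have c0 (a : R) : 0 <= (1 + cos a)%:E by rewrite lee_fin -lerBlDl sub0r cos_geN1.
have mcos (a : R) : measurable_fun setT (fun x => (1 + cos (phase n x + a))%:E).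
  apply/measurable_EFinP/measurable_funD => //; apply: measurableT_comp.
    by apply: continuous_measurable_fun; exact: continuous_cos.
  by apply: measurable_funD => //; exact: measurable_phase.
pose G (p : T * measurableTypeR R) :=
  ((rker h p.2 (tnth p.1 j)) * (1 + cos (phase n (upd p.1 j p.2) + phi)))%:E.
have mG : measurable_fun setT G.
  rewrite /G; under eq_fun do rewrite EFinM.
  apply: emeasurable_funM; last exact: (measurableT_comp (mcos phi) (@measurable_upd R d j)).
  apply/measurable_EFinP.
  apply: (measurableT_comp (@measurable_rker R h) (g := fun p : T * _ => (p.2, tnth p.1 j))).
  apply: measurable_fun_pair; first exact: measurable_snd.
  by apply: (measurableT_comp (measurable_tnthT j)).
have G0 p : 0 <= G p by rewrite /G EFinM mule_ge0 ?rker_gee0.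
pose H (p : T * measurableTypeR R) := f p.1 * G p.
have mH : measurable_fun setT H.
  by apply: emeasurable_funM => //; exact: measurableT_comp.
have H0 p : 0 <= H p by rewrite mule_ge0.
transitivity (\int[P]_x \int[U]_y H (x, y)); last first.
  apply: ae_eq_integral => //.
  - exact: (measurable_integral2 _ mH).
  - apply: emeasurable_funM => //; apply/measurable_EFinP/measurable_funD => //.
    apply: measurable_funM => //; apply: measurable_funD; apply: measurable_funM => //.
      apply: measurableT_comp; last by apply: measurable_funD => //; exact: measurable_phase.
      by apply: continuous_measurable_fun; exact: continuous_cos.
    apply: measurableT_comp; last by apply: measurable_funD => //; exact: measurable_phase.
    by apply: continuous_measurable_fun; exact: continuous_sin.
  - apply: filterS (ae_torus_itv j) => x x01 _ /=.
    rewrite /H /= ge0_integralZl//; last exact: (measurable_fun_pair2 x mG).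
    congr (_ * _).
    pose psi := (phase n x - w * tnth x j + phi)%R.
    have -> : (phase n x + phi = w * tnth x j + psi)%R by rewrite /psi; ring.
    rewrite -(integral_rker (n j) psi h0 x01).
    apply: eq_integral => y _; rewrite /G/= phase_upd -/w /psi.
    by congr ((_ * (1 + cos _))%:E); ring.
rewrite -(torus_exchange j)//; apply: eq_integral => x _.
rewrite muleC -ge0_integralZl//; last 2 first.
- exact: measurable_rop1.
- by move=> y _; rewrite mule_ge0 ?rker_gee0.
apply: eq_integral => y _; rewrite /H/= /G/= tnth_upd eqxx muleC -muleA muleCA -EFinM.
by rewrite !phase_upd tnth_upd eqxx; congr (_ * (_ * (1 + cos _))%:E); ring.
Qed.

End rop.
End torus_resolvent.

Section real_L1.
Context (d : measure_display) (T : measurableType d) (R : realType).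
Variable P : probability T R.
Implicit Types f g : T -> R.

Definition L1 f := P.-integrable setT (EFin \o f).

Lemma L1_measurable f : L1 f -> measurable_fun setT f.
Proof. by move=> /measurable_int /measurable_EFinP. Qed.

Lemma L1D f g : L1 f -> L1 g -> L1 (fun x => f x + g x).
Proof. by move=> lf lg; exact (integrableD measurableT lf lg). Qed.

Lemma L1B f g : L1 f -> L1 g -> L1 (fun x => f x - g x).
Proof. by move=> lf lg; exact (integrableB measurableT lf lg). Qed.

Lemma L1Z c f : L1 f -> L1 (fun x => c * f x).
Proof. by move=> lf; exact (integrableZl measurableT c lf). Qed.

Lemma L1_norm f : L1 f -> L1 (fun x => `|f x|).
Proof. by move=> lf; exact: integrable_norm. Qed.

Lemma L1M C f g : L1 f -> measurable_fun setT g -> (forall x, `|g x| <= C) ->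
  L1 (fun x => f x * g x).
Proof.
move=> lf mg gC; have := integrableMl measurableT lf mg; apply.
exists C; split; first by rewrite num_real.
by move=> z Cz x _ /=; exact: le_trans (gC x) (ltW Cz).
Qed.

Lemma L1_cst c : L1 (cst c).
Proof. exact: finite_measure_integrable_cst. Qed.

Lemma L1_le f g : L1 f -> measurable_fun setT g -> (forall x, `|g x| <= `|f x|) -> L1 g.
Proof.
move=> lf mg gf; apply: le_integrable lf => //; first exact/measurable_EFinP.
by move=> x _; rewrite lee_fin.
Qed.

Lemma measurable_gt_set (c : R) f : measurable_fun setT f -> measurable [set x | c < f x].
Proof.
move=> mf; have : measurable_fun setT (fun x => c < f x) by exact: measurable_fun_ltr.
by move=> /(_ measurableT [set true]); rewrite setTI; apply.
Qed.

Lemma L1_fine (f : T -> \bar R) : measurable_fun setT f -> (forall x, (0 <= f x)%E) ->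
  (\int[P]_x f x < +oo)%E ->
  [/\ L1 (fine \o f), {ae P, forall x, (f x) \is a fin_num} &
      (\int[P]_x (fine (f x))%:E = \int[P]_x f x)%E].
Proof.
move=> mf f0 foo.
have fi : P.-integrable setT f.
  by apply/integrableP; split => //; under eq_integral do rewrite gee0_abs//.
have ff : {ae P, forall x, (f x) \is a fin_num}.
  by apply: filterS (integrable_ae measurableT fi) => x; exact.
have mff : measurable_fun setT (fine \o f) by exact: measurableT_comp.
have e : (\int[P]_x (fine (f x))%:E = \int[P]_x f x)%E.
  apply: ae_eq_integral => //; first exact/measurable_EFinP.
  by apply: filterS ff => x fx _; rewrite fineK.
split => //; apply/integrableP; split; first exact/measurable_EFinP.
by under eq_integral do rewrite /= ger0_norm ?fine_ge0//; rewrite e.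
Qed.

End real_L1.

(** * Fourier coefficients and the symbol of a resolvent *)

Section fourier.
Context (R : realType) (d : nat).
Local Notation T := (euclid R d).
Local Notation P := (torus_prob R d).
Implicit Types (n : 'I_d -> int) (x : T) (j : 'I_d) (f g : T -> R).
Local Notation L1 := (L1 P).

(** The integral of [f] against e^(i phase), hence the classical coefficient at [- n]. With this
    sign a derivative in direction [j] acts by [- symb R n j], which explains the signs in [dsymb]
    and [hsymb]. *)
Definition fcoef n f : R[i] := Complex
  (\int[P]_x (f x * cos (phase n x))) (\int[P]_x (f x * sin (phase n x))).

Lemma measurable_cos_phase n phi : measurable_fun [set: T] (fun x => cos (phase n x + phi)).
Proof.
apply: measurableT_comp; first by apply: continuous_measurable_fun; exact: continuous_cos.
by apply: measurable_funD => //; exact: measurable_phase.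
Qed.

Lemma measurable_sin_phase n phi : measurable_fun [set: T] (fun x => sin (phase n x + phi)).
Proof.
apply: measurableT_comp; first by apply: continuous_measurable_fun; exact: continuous_sin.
by apply: measurable_funD => //; exact: measurable_phase.
Qed.

Lemma normr_cos_le1 (a : R) : `|cos a| <= 1.
Proof. by rewrite ler_norml cos_geN1 cos_le1. Qed.

Lemma normr_sin_le1 (a : R) : `|sin a| <= 1.
Proof. by rewrite ler_norml sin_geN1 sin_le1. Qed.

Lemma L1_cos n phi f : L1 f -> L1 (fun x => f x * cos (phase n x + phi)).
Proof.
by move=> lf; apply: (L1M lf (measurable_cos_phase n phi)) => x; exact: normr_cos_le1.
Qed.

Lemma L1_sin n phi f : L1 f -> L1 (fun x => f x * sin (phase n x + phi)).
Proof.
by move=> lf; apply: (L1M lf (measurable_sin_phase n phi)) => x; exact: normr_sin_le1.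
Qed.

Lemma L1_cos0 n f : L1 f -> L1 (fun x => f x * cos (phase n x)).
Proof. by move=> /(L1_cos n 0); under eq_fun do rewrite addr0. Qed.

Lemma L1_sin0 n f : L1 f -> L1 (fun x => f x * sin (phase n x)).
Proof. by move=> /(L1_sin n 0); under eq_fun do rewrite addr0. Qed.

Lemma fcoefD n f g : L1 f -> L1 g ->
  fcoef n (fun x => f x + g x) = fcoef n f + fcoef n g.
Proof.
move=> lf lg; rewrite /fcoef.
under [X in Complex X _]eq_Rintegral do rewrite mulrDl.
under [X in Complex _ X]eq_Rintegral do rewrite mulrDl.
by rewrite !RintegralD//; [exact: L1_sin0|exact: L1_sin0|exact: L1_cos0|exact: L1_cos0].
Qed.

Lemma fcoefB n f g : L1 f -> L1 g ->
  fcoef n (fun x => f x - g x) = fcoef n f - fcoef n g.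
Proof.
move=> lf lg; rewrite /fcoef.
under [X in Complex X _]eq_Rintegral do rewrite mulrBl.
under [X in Complex _ X]eq_Rintegral do rewrite mulrBl.
by rewrite !RintegralB//; [exact: L1_sin0|exact: L1_sin0|exact: L1_cos0|exact: L1_cos0].
Qed.

Lemma fcoefZ n (c : R) f : L1 f -> fcoef n (fun x => c * f x) = c%:C%C * fcoef n f.
Proof.
move=> lf; rewrite /fcoef.
under [X in Complex X _]eq_Rintegral do rewrite -mulrA.
under [X in Complex _ X]eq_Rintegral do rewrite -mulrA.
rewrite !RintegralZl//; [|exact: L1_sin0|exact: L1_cos0].
by apply/eqP; rewrite eq_complex /=; apply/andP; split; apply/eqP; ring.
Qed.

Lemma ae_eq_Rintegral f g : measurable_fun setT f -> measurable_fun setT g ->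
  {ae P, forall x, f x = g x} -> \int[P]_x f x = \int[P]_x g x.
Proof.
move=> mf mg fg; congr fine; apply: ae_eq_integral => //; try exact/measurable_EFinP.
by apply: filterS fg => x -> _.
Qed.

Lemma ae_eq_fcoef n f g : measurable_fun setT f -> measurable_fun setT g ->
  {ae P, forall x, f x = g x} -> fcoef n f = fcoef n g.
Proof.
move=> mf mg fg.
have mc := measurable_cos_phase n 0; have ms := measurable_sin_phase n 0.
move: mc ms; under eq_fun do rewrite addr0; move=> mc; under eq_fun do rewrite addr0.
move=> ms; congr Complex; apply: ae_eq_Rintegral; try exact: measurable_funM.
  by apply: filterS fg => x ->.
by apply: filterS fg => x ->.
Qed.

Definition symb n j : R[i] := Complex 0 (twopi R (n j)).

(** A signed version with a real value at every point. Where a part is infinite [fine] returns 0;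
    for integrable [f] this affects only a null set. *)
Definition res (h : R) j f x : R :=
  fine (rop h j (EFin \o f^\+) x) - fine (rop h j (EFin \o f^\-) x).

Section resolvent.
Variables (h : R) (j : 'I_d).
Hypothesis h0 : 0 < h.

Lemma integral_rop (f : T -> \bar R) : measurable_fun setT f -> (forall x, 0 <= f x)%E ->
  (\int[P]_x rop h j f x = \int[P]_x f x)%E.
Proof.
(* At frequency and phase 0 the factor [1 + cos] is the constant 2, which is divided out at the
   end. *)
move=> mf f0; have := integral_rop_cos j h0 (fun=> 0%Z) 0 mf f0.
have ph x : phase (fun=> 0%Z) x = 0.
  by rewrite /phase big1// => i _; rewrite /twopi mulr0z mulr0 mul0r.
have two0 : (0 <= 2 :> R) by [].
under eq_integral do rewrite ph addr0 cos0 muleC.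
under [X in _ = X -> _]eq_integral do
  rewrite ph addr0 cos0 sin0 /twopi mulr0z !mulr0 addr0 mulr1 expr0n addr0 muleC.
have -> : h^-1 / h^-1 ^+ 2 * h^-1 = 1 :> R by field; rewrite gt_eqF.
rewrite !ge0_integralZl_EFin//; last 2 first.
- by move=> x _; exact: rop_ge0.
- exact: measurable_rop.
have t0 : (1 + 1 : R) != 0 by rewrite gt_eqF// addr_gt0.
move=> /(congr1 (fun z => ((1 + 1)^-1%:E * z)%E)).
by rewrite !muleA -!EFinM mulVf// !mul1e.
Qed.

Lemma integral_rop_ge0 f : L1 f -> (forall x, 0 <= f x) ->
  let g := fine \o rop h j (EFin \o f) in
  [/\ L1 g, {ae P, forall x, rop h j (EFin \o f) x \is a fin_num} &
   forall n phi, let l := h^-1 in let w := twopi R (n j) in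
   \int[P]_x (g x * cos (phase n x + phi)) = l / (l ^+ 2 + w ^+ 2) *
     (l * \int[P]_x (f x * cos (phase n x + phi)) +
      w * \int[P]_x (f x * sin (phase n x + phi)))].
Proof.
move=> lf f0 g.
have mf := measurable_int _ lf.
have mr := measurable_rop j h0 mf.
have r0 : forall x, (0 <= rop h j (EFin \o f) x)%E.
  by move=> x; apply: rop_ge0.
have ie := integral_rop mf f0.
have foo : (\int[P]_x rop h j (EFin \o f) x < +oo)%E.
  by rewrite ie; apply: integrable_lty.
have [lg gfin eg] := L1_fine (mr f0) r0 foo.
split => // n phi l w.
(* Conservation of mass removes the contribution of the 1 in [1 + cos] from [e2] below. *)
have e1 : \int[P]_x g x = \int[P]_x f x by rewrite /Rintegral eg ie.
have e2 : \int[P]_x (g x + g x * cos (phase n x + phi)) =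
   \int[P]_x (f x + l / (l ^+ 2 + w ^+ 2) * (l * (f x * cos (phase n x + phi))
      + w * (f x * sin (phase n x + phi)))).
  congr fine; transitivity (\int[P]_x (rop h j (EFin \o f) x * (1 + cos (phase n x + phi))%:E))%E.
    apply: ae_eq_integral => //.
    - by apply/measurable_EFinP; exact: (L1_measurable (L1D lg (L1_cos n phi lg))).
    - apply: emeasurable_funM; first exact: mr.
      apply/measurable_EFinP; apply: measurable_funD => //; exact: measurable_cos_phase.
    - apply: filterS gfin => x xfin _; rewrite -[in RHS](fineK xfin) -EFinM /g /=.
      by congr (_%:E); ring.
  rewrite integral_rop_cos//; apply: eq_integral => x _ /=.
  by rewrite -EFinM -/l -/w; congr (_%:E); ring.
have lc := L1_cos n phi lf; have ls := L1_sin n phi lf.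
move: e2; rewrite [LHS](RintegralD measurableT lg (L1_cos n phi lg)).
have lcs := L1D (L1Z l lc) (L1Z w ls).
rewrite [RHS](RintegralD measurableT lf (L1Z _ lcs)) e1 => /addrI ->.
rewrite (RintegralZl _ measurableT lcs); congr (_ * _).
rewrite (RintegralD measurableT (L1Z l lc) (L1Z w ls)).
by rewrite (RintegralZl _ measurableT lc) (RintegralZl _ measurableT ls).
Qed.

Lemma L1_res f : L1 f -> L1 (res h j f).
Proof.
move=> lf.
have [lp _ _] := integral_rop_ge0 (integrable_funrpos measurableT lf) (@funrpos_ge0 _ _ _).
have [ln _ _] := integral_rop_ge0 (integrable_funrneg measurableT lf) (@funrneg_ge0 _ _ _).
exact: L1B.
Qed.

Lemma fcoef_res n f : L1 f ->
  (1 + h%:C%C * symb n j) * fcoef n (res h j f) = fcoef n f.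
Proof.
move=> lf.
have lfp := integrable_funrpos measurableT lf.
have lfn := integrable_funrneg measurableT lf.
have [lp _ ep] := integral_rop_ge0 lfp (@funrpos_ge0 _ _ _).
have [ln _ en] := integral_rop_ge0 lfn (@funrneg_ge0 _ _ _).
have -> : fcoef n f = fcoef n (fun x => f^\+ x - f^\- x).
  by congr fcoef; rewrite -[LHS]funrposBneg.
rewrite !fcoefB//.
suff H g (g' := fine \o rop h j (EFin \o g)) : L1 g ->
  (forall n phi, let l := h^-1 in let w := twopi R (n j) in
   \int[P]_x (g' x * cos (phase n x + phi)) = l / (l ^+ 2 + w ^+ 2) *
     (l * \int[P]_x (g x * cos (phase n x + phi)) +
      w * \int[P]_x (g x * sin (phase n x + phi)))) ->
  (1 + h%:C%C * symb n j) * fcoef n g' = fcoef n g by rewrite mulrBr !H.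
(* The phase [- (pi / 2)] turns cosines into sines, so the two real formulas give both parts of the
   complex identity. *)
move=> lg H; have := H n 0; have := H n (- (pi / 2)).
have e1 (u : T -> R) : \int[P]_x (u x * cos (phase n x - pi / 2)) =
    \int[P]_x (u x * sin (phase n x)).
  by apply: eq_Rintegral => x _; rewrite cosBpihalf.
have e2 : \int[P]_x (g x * sin (phase n x - pi / 2)) =
    - \int[P]_x (g x * cos (phase n x)).
  rewrite -[RHS]mulN1r -(RintegralZl _ measurableT (L1_cos0 n lg)).
  by apply: eq_Rintegral => x _; rewrite sinBpihalf; ring.
have e3 (u : T -> R) : \int[P]_x (u x * cos (phase n x + 0)) =
    \int[P]_x (u x * cos (phase n x)).
  by apply: eq_Rintegral => x _; rewrite addr0.
have e4 : \int[P]_x (g x * sin (phase n x + 0)) = \int[P]_x (g x * sin (phase n x)).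
  by apply: eq_Rintegral => x _; rewrite addr0.
rewrite !e1 e2 !e3 e4.
rewrite /fcoef => -> ->.
set A := (\int[P]_x (g x * cos _)); set B := (\int[P]_x (g x * sin _)).
rewrite /symb; set w := twopi R (n j).
have lw' : 1 + (w * h) ^+ 2 != 0 by rewrite gt_eqF// ltr_pwDl// sqr_ge0.
apply/eqP; rewrite eq_complex /=; apply/andP; split; apply/eqP; field; rewrite lw' gt_eqF//.
Qed.

Lemma res_le f x : measurable_fun setT f ->
  ((`|res h j f x|)%:E <= rop h j (fun x => (`|f x|)%:E) x)%E.
Proof.
move=> mf; rewrite /res.
have mp : measurable_fun setT (EFin \o f^\+) by apply/measurable_EFinP; exact: measurable_funrpos.
have mn : measurable_fun setT (EFin \o f^\-) by apply/measurable_EFinP; exact: measurable_funrneg.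
have -> : (fun x => (`|f x|)%:E) = (fun x => (f^\+ x)%:E + (f^\- x)%:E)%E.
  by apply/funext => y; rewrite -EFinD -[LHS]/((Num.norm \o f) y)%:E -funrposDneg.
rewrite (ropD j h0 x mp mn); last 2 first.
- by move=> y; rewrite lee_fin funrpos_ge0.
- by move=> y; rewrite lee_fin funrneg_ge0.
have p0 : (0 <= rop h j (EFin \o (f^\+)%R) x)%E.
  by apply: rop_ge0 => // y; rewrite lee_fin funrpos_ge0.
have n0 : (0 <= rop h j (EFin \o (f^\-)%R) x)%E.
  by apply: rop_ge0 => // y; rewrite lee_fin funrneg_ge0.
(* If one of the two parts is infinite, so is the right-hand side, whatever [fine] returns; the
   triangle inequality is needed only for two finite parts. *)
move: p0 n0; move: (rop h j (EFin \o f^\+) x) (rop h j (EFin \o f^\-) x).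
move=> [a| |] [b| |]//= a0 b0; rewrite ?leey//.
rewrite lee_fin; rewrite !lee_fin in a0 b0.
by rewrite ler_norml; apply/andP; split; lra.
Qed.

End resolvent.
End fourier.

(** * Fourier uniqueness *)

Section step_polynomials.
Context (R : realType).

Lemma bernoulli_add (x : R) (m : nat) : 0 <= x -> 1 + m%:R * x <= (1 + x) ^+ m.
Proof.
move=> x0; elim: m => [|m IH]; first by rewrite mul0r addr0 expr0.
rewrite exprS; apply: le_trans (ler_wpM2l _ IH); last by rewrite addr_ge0.
rewrite -natr1; have : 0 <= m%:R * x * x by rewrite !mulr_ge0.
by nra.
Qed.

Lemma bernoulli_sub (x : R) (m : nat) : 0 <= x <= 1 -> 1 - m%:R * x <= (1 - x) ^+ m.
Proof.
move=> /andP[x0 x1]; elim: m => [|m IH]; first by rewrite mul0r subr0 expr0.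
rewrite exprS; apply: le_trans (ler_wpM2l _ IH); last by rewrite subr_ge0.
rewrite -natr1; have : 0 <= m%:R * x * x by rewrite !mulr_ge0.
by nra.
Qed.

(* The powers (1 - z ^ m) ^ M of the Stone-Weierstrass argument, with exponents
   growing fast enough to converge to the indicator of [0, 1/2[ on [0, 1]. *)
Definition stepp (k : nat) (z : R) : R := (1 - z ^+ (2 * k)) ^+ (4 ^ k * k).

Lemma stepp_itv k z : 0 <= z <= 1 -> 0 <= stepp k z <= 1.
Proof.
move=> /andP[z0 z1]; have a0 : 0 <= 1 - z ^+ (2 * k) by rewrite subr_ge0 exprn_ile1.
by rewrite exprn_ge0//= exprn_ile1// lerBlDr lerDl exprn_ge0.
Qed.

(** For [t = z ^+ (2 * k)], [(1 - t) * (1 + t) <= 1] bounds [(1 - t) ^+ (4 ^ k)] by the inverse of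
    [(1 + t) ^+ (4 ^ k)], which is at least 2 by Bernoulli because [t] is at least [1 / 4 ^ k]. The
    remaining exponent [k] gives the decay. *)
Lemma stepp_high k z : 2^-1 <= z <= 1 -> stepp k z <= 2^-1 ^+ k.
Proof.
move=> /andP[z2 z1]; have z0 : 0 <= z by apply: le_trans z2.
have t0 : 0 <= z ^+ (2 * k) by rewrite exprn_ge0.
have t1 : z ^+ (2 * k) <= 1 by rewrite exprn_ile1.
rewrite /stepp exprM lerXn2r// ?nnegrE ?exprn_ge0 ?subr_ge0//.
rewrite -[leRHS]mul1r ler_pdivlMr//.
have h2 : 2 <= (1 + z ^+ (2 * k)) ^+ (4 ^ k).
  apply: le_trans (bernoulli_add _ t0); rewrite -[2]/(1 + 1) lerD2l.
  rewrite -[leLHS](_ : (4 ^ k)%:R * 2^-1 ^+ (2 * k) = 1); last first.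
    by rewrite natrX exprM -exprMn; rewrite (_ : 4 * _ = 1) ?expr1n//; field.
  by rewrite ler_wpM2l// lerXn2r// nnegrE.
apply: le_trans (ler_wpM2l _ h2) _; first by rewrite exprn_ge0// subr_ge0.
rewrite -exprMn exprn_ile1//; first by rewrite mulr_ge0 ?subr_ge0// addr_ge0.
by nra.
Qed.

Lemma stepp_cvg0 z : 2^-1 <= z <= 1 -> (fun k => stepp k z) @ \oo --> (0 : R).
Proof.
move=> /andP[z2 z1]; apply: (@squeeze_cvgr _ _ _ _ (cst 0) (fun k => 2^-1 ^+ k)).
- apply: nearW => k; rewrite stepp_high ?z2//.
  have z01 : 0 <= z <= 1 by rewrite z1 andbT (le_trans _ z2).
  by have /andP[-> _] := stepp_itv k z01.
- exact: cvg_cst.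
- by apply: cvg_expr; rewrite ger0_norm// invf_lt1// ltr1n.
Qed.

(** With [r = 2 * z < 1] the defect in Bernoulli's inequality is [r ^+ k * (k%:R * r ^+ k)], and
    [geo], a comparison with a geometric sum, keeps [k%:R * r ^+ k] below [1 / (1 - r)]. *)
Lemma stepp_cvg1 z : 0 <= z < 2^-1 -> (fun k => stepp k z) @ \oo --> (1 : R).
Proof.
move=> /andP[z0 z2]; pose r := 2 * z.
have r0 : 0 <= r by rewrite mulr_ge0.
have r1 : r < 1 by rewrite /r; lra.
have z1 : z <= 1 by lra.
have geo (k : nat) : k%:R * r ^+ k * (1 - r) <= 1 - r ^+ k.
  elim: k => [|k IH]; first by rewrite !mul0r subrr.
  rewrite -natr1 exprS.
  have : 0 <= r ^+ k by rewrite exprn_ge0.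
  have : r ^+ k <= 1 by rewrite exprn_ile1 // ltW.
  move: (r ^+ k) IH => t IH t1 t0; have IH' := ler_wpM2l r0 IH.
  have : 0 <= (1 - r) * (1 - r * t) by rewrite mulr_ge0 ?subr_ge0 ?(ltW r1)//; nra.
  by move: IH'; lra.
apply: (@squeeze_cvgr _ _ _ _ (fun k => 1 - r ^+ k * (1 - r)^-1) (cst 1)).
- apply: nearW => k /=.
  have z01 : 0 <= z <= 1 by rewrite z0.
  have /andP[_ ->] := stepp_itv k z01.
  rewrite andbT; apply: le_trans (bernoulli_sub _ _); last first.
    by rewrite exprn_ge0//= exprn_ile1.
  rewrite lerD2l lerN2.
  have -> : (4 ^ k * k)%:R * z ^+ (2 * k) = r ^+ k * (k%:R * r ^+ k) :> R.
    rewrite natrM natrX /r exprMn mulnC exprM expr2.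
    by rewrite (_ : 4 = 2 * 2) ?exprMn//; ring.
  rewrite ler_wpM2l ?exprn_ge0// -[leRHS]mul1r ler_pdivlMr ?subr_gt0//.
  by apply: le_trans (geo k) _; rewrite lerBlDr lerDl exprn_ge0.
- rewrite -[X in _ --> X]subr0 -(mul0r (1 - r)^-1); apply: cvgB; first exact: cvg_cst.
  by apply: cvgM; [apply: cvg_expr; rewrite ger0_norm|exact: cvg_cst].
- exact: cvg_cst.
Qed.
End step_polynomials.

Section fourier_uniqueness.
Context (R : realType) (d : nat).
Local Notation T := (euclid R d).
Local Notation P := (torus_prob R d).
Local Notation L1 := (L1 P).
Implicit Types (n : 'I_d -> int) (j : 'I_d) (q m : T -> R).
Variable f : T -> R.
Hypothesis lf : L1 f.

Definition bmeas q := measurable_fun setT q /\ exists C, forall x, `|q x| <= C.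

Definition orth q :=
  forall n phi, \int[P]_x (f x * (q x * cos (phase n x + phi))) = 0.

(* Multipliers form an algebra, closed under bounded pointwise limits, that
   contains the trigonometric polynomials; hence the sets whose indicator is a
   multiplier form a sigma-algebra containing the boxes. *)
Definition multiplier m := bmeas m /\
  forall q, bmeas q -> orth q -> orth (fun x => m x * q x).

Lemma bmeasM q1 q2 : bmeas q1 -> bmeas q2 -> bmeas (fun x => q1 x * q2 x).
Proof.
move=> [m1 [C1 H1]] [m2 [C2 H2]]; split; first exact: measurable_funM.
by exists (C1 * C2) => x; rewrite normrM ler_pM.
Qed.

Lemma bmeasD q1 q2 : bmeas q1 -> bmeas q2 -> bmeas (fun x => q1 x + q2 x).
Proof.
move=> [m1 [C1 H1]] [m2 [C2 H2]]; split; first exact: measurable_funD.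
by exists (C1 + C2) => x; rewrite (le_trans (ler_normD _ _))// lerD.
Qed.

Lemma bmeas_cst c : bmeas (cst c).
Proof. by split => //; exists `|c|. Qed.

Lemma bmeas_cos n phi : bmeas (fun x => cos (phase n x + phi)).
Proof.
by split; [exact: measurable_cos_phase|exists 1 => x; exact: normr_cos_le1].
Qed.

Lemma L1_bmeas q : bmeas q -> L1 (fun x => f x * q x).
Proof. by move=> [mq [C qC]]; exact: (L1M lf mq qC). Qed.

Lemma multiplier_cst c : multiplier (cst c).
Proof.
split; first exact: bmeas_cst.
move=> q bq oq n phi; rewrite -[RHS](mulr0 c) -(oq n phi).
rewrite -(RintegralZl _ measurableT (L1_bmeas (bmeasM bq (bmeas_cos n phi)))).
by apply: eq_Rintegral => x _ /=; ring.
Qed.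

Lemma multiplierM m1 m2 : multiplier m1 -> multiplier m2 ->
  multiplier (fun x => m1 x * m2 x).
Proof.
move=> [b1 H1] [b2 H2]; split; first exact: bmeasM.
move=> q bq oq; under [X in orth X]eq_fun do rewrite -mulrA.
by apply: H1; [exact: bmeasM|exact: H2].
Qed.

Lemma multiplierD m1 m2 : multiplier m1 -> multiplier m2 ->
  multiplier (fun x => m1 x + m2 x).
Proof.
move=> [b1 H1] [b2 H2]; split; first exact: bmeasD.
move=> q bq oq n phi; rewrite -[RHS]addr0.
rewrite -{1}(H1 q bq oq n phi) -(H2 q bq oq n phi).
rewrite -(RintegralD measurableT (L1_bmeas (bmeasM (bmeasM b1 bq) (bmeas_cos n phi)))
  (L1_bmeas (bmeasM (bmeasM b2 bq) (bmeas_cos n phi)))).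
by apply: eq_Rintegral => x _ /=; ring.
Qed.

Lemma multiplierX m k : multiplier m -> multiplier (fun x => m x ^+ k).
Proof.
move=> Mm; elim: k => [|k IH]; first exact: multiplier_cst.
by under eq_fun do rewrite exprS; exact: multiplierM.
Qed.

(** By the product-to-sum formula this factor shifts the [j]-th frequency by 1 and by -1, and [orth]
    quantifies over all frequencies. *)
Lemma multiplier_cos j theta : multiplier (fun x => cos (twopi R 1 * tnth x j + theta)).
Proof.
pose e n (s : int) i : int := n i + s *+ (i == j).
have phe n (s : int) x : phase (e n s) x = phase n x + s%:~R * (twopi R 1 * tnth x j).
  rewrite /phase (bigD1 j)//= [in RHS](bigD1 j)//= /e eqxx mulr1n.
  rewrite (eq_bigr (fun i => twopi R (n i) * tnth x i)); last first.
    by move=> i /negPf ->; rewrite mulr0n addr0.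
  by rewrite /twopi intrD; ring.
have bc : bmeas (fun x => cos (twopi R 1 * tnth x j + theta)).
  have -> : (fun x => cos (twopi R 1 * tnth x j + theta)) =
      (fun x => cos (phase (e (fun=> 0) 1) x + theta)) :> (T -> R).
    apply/funext => x; rewrite phe mul1r /phase big1 ?add0r// => i _.
    by rewrite /twopi mulr0 mul0r.
  exact: bmeas_cos.
split => // q bq oq n phi.
have b1 := L1_bmeas (bmeasM bq (bmeas_cos (e n 1) (phi + theta))).
have b2 := L1_bmeas (bmeasM bq (bmeas_cos (e n (-1)) (phi - theta))).
transitivity (\int[P]_x (2^-1 * (f x * (q x * cos (phase (e n 1) x + (phi + theta))) +
   f x * (q x * cos (phase (e n (-1)) x + (phi - theta)))))).
  apply: eq_Rintegral => x _; rewrite !phe mul1r mulN1r.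
  set a := twopi R 1 * _.
  have -> : phase n x + a + (phi + theta) = (phase n x + phi) + (a + theta) by ring.
  have -> : phase n x - a + (phi - theta) = (phase n x + phi) - (a + theta) by ring.
  by move: (phase n x + phi) (a + theta) => A B; rewrite cosD cosB; field.
rewrite (RintegralZl _ measurableT (L1D b1 b2)) (RintegralD measurableT b1 b2).
by rewrite !oq addr0 mulr0.
Qed.

Lemma multiplier_ae m m' : multiplier m -> bmeas m' ->
  {ae P, forall x, m x = m' x} -> multiplier m'.
Proof.
move=> [bm Mm] bm' mm'; split => // q bq oq n phi.
rewrite -[RHS](Mm q bq oq n phi); apply: ae_eq_Rintegral.
- exact: (L1_measurable (L1_bmeas (bmeasM (bmeasM bm' bq) (bmeas_cos n phi)))).
- exact: (L1_measurable (L1_bmeas (bmeasM (bmeasM bm bq) (bmeas_cos n phi)))).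
- by apply: filterS mm' => x ->.
Qed.

Lemma multiplier_cvg C (m_ : nat -> T -> R) m : (forall k, multiplier (m_ k)) ->
  (forall k x, `|m_ k x| <= C) -> (forall x, m_ ^~ x @ \oo --> m x) -> multiplier m.
Proof.
move=> Mm mC mm.
have mmeas : measurable_fun setT m.
  apply: (measurable_fun_cvg (h := m_)) => // k; exact: (Mm k).1.1.
have bm : bmeas m.
  split => //; exists C => x.
  have h : `|m_ k x| @[k --> \oo] --> `|m x| by apply: cvg_norm; exact: mm.
  rewrite -(cvg_lim _ h)//; apply: limr_le; first by apply/cvg_ex; exists `|m x|.
  by apply: nearW => k; exact: mC.
split => // q bq oq n phi.
have [mq [Cq qC]] := bq.
have C0 : 0 <= C by exact: le_trans (normr_ge0 _) (mC 0%N point).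
have Lk k := L1_bmeas (bmeasM (bmeasM (Mm k).1 bq) (bmeas_cos n phi)).
have Lm := L1_bmeas (bmeasM (bmeasM bm bq) (bmeas_cos n phi)).
have := @dominated_convergence _ T R P setT measurableT
  (fun k x => (f x * (m_ k x * q x * cos (phase n x + phi)))%:E)
  (fun x => (f x * (m x * q x * cos (phase n x + phi)))%:E)
  (fun x => ((C * Cq) * `|f x|)%:E).
case.
- by move=> k; exact: measurable_int (Lk k).
- exact: measurable_int Lm.
- apply: aeW => x _; apply: cvg_EFin; first by apply: nearW.
  apply: cvgM; first exact: cvg_cst.
  apply: cvgM; last exact: cvg_cst.
  by apply: cvgM; [exact: mm|exact: cvg_cst].
- exact: (L1Z (C * Cq) (L1_norm lf)).
- apply: aeW => x k _; rewrite /= lee_fin !normrM mulrC ler_wpM2r//.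
  rewrite -[leRHS]mulr1 ler_pM// ?normr_cos_le1//.
  by rewrite ler_pM.
move=> _ _ /cvg_lim lim0.
rewrite /Rintegral -lim0//=.
rewrite (_ : (fun k => _) = cst 0%E) ?lim_cst//.
apply/funext => k /=.
have := (Mm k).2 q bq oq n phi.
rewrite /Rintegral => /eqP; rewrite fine_eq0 => [/eqP//|].
exact: integrable_fin_num (Lk k).
Qed.

Lemma multiplier_arc j theta a : -1 <= a <= 1 ->
  multiplier (\1_[set x : T | a < cos (twopi R 1 * tnth x j + theta)] : T -> R).
Proof.
move=> /andP[a1 a2].
pose c (x : T) := cos (twopi R 1 * tnth x j + theta).
(* An affine function of [c x] with values in [0, 1] that is below 1/2 exactly when [a < c x]. Where
   [c x = a] it equals 1/2, and there [stepp] tends to 0, as the strict inequality requires. *)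
pose z (x : T) := 2^-1 * (1 + 2^-1 * (a + -1 * c x)).
have c01 x : -1 <= c x <= 1 by rewrite cos_geN1 cos_le1.
have Mz : multiplier z.
  apply: (multiplierM (multiplier_cst _)); apply: (multiplierD (multiplier_cst _)).
  apply: (multiplierM (multiplier_cst _)); apply: (multiplierD (multiplier_cst _)).
  apply: (multiplierM (multiplier_cst _)); exact: multiplier_cos.
have z01 x : 0 <= z x <= 1 by have := c01 x; rewrite /z; lra.
apply: (@multiplier_cvg 1 (fun k x => stepp k (z x))).
- move=> k; rewrite /stepp; apply: multiplierX.
  under eq_fun do rewrite -mulN1r.
  apply: (multiplierD (multiplier_cst _)); apply: (multiplierM (multiplier_cst _)).
  exact: multiplierX.
- by move=> k x; have /andP[s0 s1] := stepp_itv k (z01 x); rewrite ger0_norm.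
- move=> x; have := z01 x; rewrite indicE; have [ac|ca] := ltP a (c x).
    rewrite mem_set// => /andP[z0 _]; apply: stepp_cvg1; rewrite z0/=.
    by move: ac; rewrite /z; lra.
  rewrite memNset/=; last by apply/negP; rewrite -leNgt.
  by move=> /andP[_ z1]; apply: stepp_cvg0; rewrite z1 andbT; move: ca; rewrite /z; lra.
Qed.

(** On the circle, the interval from 0 to [b] is an arc with centre [b / 2], hence a superlevel set
    of a cosine. The three cases bring the angle into [0, pi], where the cosine decreases, by parity
    or by passing to 2 pi minus the angle. *)
Lemma arc_ray (b y : R) : 0 < b < 1 -> 0 < y < 1 ->
  (cos (pi * b) < cos (twopi R 1 * y - pi * b)) = (y < b).
Proof.
move=> /andP[b0 b1] /andP[y0 y1]; have pi0 := pi_gt0 R.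
have pb : pi * b \in `[0, pi].
  by rewrite in_itv /= mulr_ge0 ?pi_ge0 ?(ltW b0)//= ler_piMr ?pi_ge0// ltW.
have -> : twopi R 1 * y = 2 * pi * y by rewrite /twopi mulr1.
have [t0|t0] := leP (2 * pi * y - pi * b) 0.
  rewrite -[X in _ < X]cosN ltr_cos//; last first.
    rewrite in_itv /= oppr_ge0 t0/=; have := mulr_gt0 pi0 y0.
    have : pi * b <= pi by rewrite ler_piMr ?pi_ge0// ltW.
    lra.
  have yb : pi * (2 * y) <= pi * b by move: t0; lra.
  rewrite ler_pM2l// in yb; rewrite (_ : y < b); last lra.
  by have := mulr_gt0 pi0 y0; lra.
have [t1|t1] := leP (2 * pi * y - pi * b) pi.
  rewrite ltr_cos//; last by rewrite in_itv/= (ltW t0) t1.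
  rewrite (_ : (2 * pi * y - pi * b < pi * b) = (pi * y < pi * b)); last first.
    by apply/idP/idP; lra.
  by rewrite ltr_pM2l.
have -> : cos (2 * pi * y - pi * b) = cos (pi *+ 2 - (2 * pi * y - pi * b)).
  by rewrite -[LHS]cosN -[LHS]cosD2pi; congr cos; ring.
have py : pi * y < pi by rewrite gtr_pMr.
have pb0 := mulr_gt0 pi0 b0.
rewrite ltr_cos//; last by rewrite in_itv/= mulr2n; lra.
have -> : (y < b) = false.
  apply/negbTE; rewrite -leNgt -(ler_pM2l pi0).
  have : pi * b < pi by rewrite gtr_pMr.
  lra.
by apply/negbTE; rewrite -leNgt mulr2n; lra.
Qed.

Lemma bmeas_indic A : measurable A -> bmeas (\1_A : T -> R).
Proof.
move=> mA; split; first exact: measurable_indic.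
by exists 1 => x; rewrite indicE; case: (_ \in _); rewrite ?normr1 ?normr0.
Qed.

Definition good (A : set T) := measurable A /\ multiplier (\1_A : T -> R).

(** For [0 < b < 1] this is an arc by [arc_ray]; for other [b] the indicator is almost everywhere
    constant, since the measure is carried by the open cube. *)
Lemma good_ray j b : good [set x | tnth x j < b].
Proof.
have mA : measurable [set x : T | tnth x j < b].
  rewrite -[X in measurable X]setTI; have := @measurable_tnthT R d j.
  by move=> /(_ measurableT `]-oo, b[%classic); apply.
split => //; have [b0|b0] := leP b 0.
  apply: multiplier_ae (multiplier_cst 0) (bmeas_indic mA) _.
  apply: filterS (ae_torus_itv R j) => x /andP[x0 _].
  rewrite indicE memNset//=; apply/negP; rewrite -leNgt; exact: le_trans (ltW x0).
have [b1|b1] := leP 1 b.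
  apply: multiplier_ae (multiplier_cst 1) (bmeas_indic mA) _.
  apply: filterS (ae_torus_itv R j) => x /andP[_ x1].
  by rewrite indicE mem_set//=; exact: lt_le_trans x1 b1.
have Ma := @multiplier_arc j (- (pi * b)) (cos (pi * b)).
apply: multiplier_ae (Ma _) (bmeas_indic mA) _; first by rewrite cos_geN1 cos_le1.
apply: filterS (ae_torus_itv R j) => x x01.
have b01 : 0 < b < 1 by rewrite b0.
rewrite !indicE; congr (nat_of_bool _)%:R.
apply/idP/idP; rewrite !inE /=; by rewrite arc_ray.
Qed.

Lemma good_setC A : good A -> good (~` A).
Proof.
move=> [mA MA]; split; first exact: measurableC.
apply: multiplier_ae (multiplierD (multiplier_cst 1) (multiplierM (multiplier_cst (-1)) MA))
  (bmeas_indic (measurableC mA)) _.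
apply: aeW => x; rewrite !indicE in_setC; case: (_ \in _) => /=; ring.
Qed.

Lemma good_setI A B : good A -> good B -> good (A `&` B).
Proof.
move=> [mA MA] [mB MB]; split; first exact: measurableI.
by rewrite indicI; exact: multiplierM.
Qed.

Lemma good_bigcup (A : (set T)^nat) : (forall k, good (A k)) -> good (\bigcup_k A k).
Proof.
move=> gA; have mA : measurable (\bigcup_k A k) by apply: bigcupT_measurable => k; exact: (gA k).1.
split => //.
have gB k : good (\big[setU/set0]_(i < k) A i).
  elim: k => [|k IH].
    rewrite big_ord0; split => //.
    apply: multiplier_ae (multiplier_cst 0) (bmeas_indic measurable0) _.
    by apply: aeW => x; rewrite indic0.
  rewrite big_ord_recr/= -[X in good X]setCK setCU; apply: good_setC.
  by apply: good_setI; apply: good_setC.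
apply: (@multiplier_cvg 1 (fun k => \1_(\big[setU/set0]_(i < k) A i))).
- by move=> k; exact: (gB k).2.
- by move=> k x; rewrite indicE; case: (_ \in _); rewrite ?normr1 ?normr0.
- move=> x; have [Ax|Ax] := pselect ((\bigcup_k A k) x).
    case: (Ax) => N _ AN; rewrite indicE mem_set//.
    apply: cvg_near_cst; exists N.+1 => // k /= Nk.
    by rewrite indicE mem_set// -bigcup_mkord; exists N.
  rewrite indicE memNset//; apply: cvg_near_cst; apply: nearW => k.
  rewrite indicE memNset// => Axk; apply: Ax; move: Axk.
  by rewrite -bigcup_mkord => -[i _ Ai]; exists i.
Qed.

Lemma good_sigma_algebra : sigma_algebra setT good.
Proof.
split; last exact: good_bigcup.
  split => //; apply: multiplier_ae (multiplier_cst 0) (bmeas_indic measurable0) _.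
  by apply: aeW => x; rewrite indic0.
by move=> A gA; rewrite setTD; exact: good_setC.
Qed.

Lemma good_measurable A : measurable A -> good A.
Proof.
apply: smallest_sub; first exact: good_sigma_algebra.
move=> B; rewrite -bigcup_seq => -[j _ [C mC <-]]; rewrite setTI.
suff : C \in [set C | good [set x : T | C (tnth x j)]] by rewrite inE.
rewrite inE; move: C mC; rewrite RGenInftyO.measurableE.
apply: smallest_sub; last by move=> _ [b ->] /=; exact: good_ray.
have [G0 GD GU] := good_sigma_algebra; split.
- exact: G0.
- by move=> C /GD; rewrite !setTD.
- by move=> C gC; exact: (GU (fun k => [set x | C k (tnth x j)])).
Qed.

(** The hypothesis is [orth] for the constant 1. As every measurable indicator is a multiplier,
    [orth] passes to indicators, and frequency 0 says that [f] has integral 0 over every measurable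
    set. *)
Lemma fourier_uniqueness : (forall n, fcoef n f = 0) -> {ae P, forall x, f x = 0}.
Proof.
move=> f0.
have o1 : orth (cst 1).
  move=> n phi; have := f0 n => -[fc fs].
  have lc := L1_cos0 n lf; have ls := L1_sin0 n lf.
  transitivity (\int[P]_x (cos phi * (f x * cos (phase n x)) -
      sin phi * (f x * sin (phase n x)))).
    by apply: eq_Rintegral => x _; rewrite cosD /=; ring.
  rewrite (RintegralB measurableT (L1Z _ lc) (L1Z _ ls)).
  by rewrite (RintegralZl _ measurableT lc) (RintegralZl _ measurableT ls) fc fs !mulr0 subr0.
suff : ae_eq P setT (EFin \o f) (cst 0%E).
  by apply: filterS => x /(_ Logic.I) [].
apply: integral_ae_eq => // A _ mA.
rewrite integral0.
have [_ [_ /(_ _ (bmeas_cst 1) o1 (fun=> 0%Z) 0)]] := good_measurable mA.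
rewrite /Rintegral => H.
have lA := L1_bmeas (bmeas_indic mA).
rewrite integral_mkcond.
rewrite (_ : _ \_ A = (fun x => (f x * \1_A x)%:E)); last first.
  apply/funext => x; rewrite patchE indicE; case: (_ \in _) => /=; by rewrite ?mulr1 ?mulr0.
have e : (\int[P]_x (f x * \1_A x)%:E =
    \int[P]_x (f x * (\1_A x * cst 1 x * cos (phase (fun=> 0%Z) x + 0)))%:E)%E.
  apply: eq_integral => x _; rewrite /phase big1 ?addr0 ?cos0 ?mulr1//.
  by move=> i _; rewrite /twopi mulr0 mul0r.
move: H; rewrite -e => /eqP; rewrite fine_eq0 => [/eqP//|].
exact: integrable_fin_num lA.
Qed.

End fourier_uniqueness.

(** * Positivity, mass and constants for resolvents *)

Section resolvent_ae.
Context (R : realType) (d : nat).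
Local Notation T := (euclid R d).
Local Notation P := (torus_prob R d).
Local Notation U := (unit_prob R).
Local Notation L1 := (L1 P).
Implicit Types (n : 'I_d -> int) (j : 'I_d) (f g : T -> R) (h : R).

Lemma fcoef_inj f g : L1 f -> L1 g -> (forall n, fcoef n f = fcoef n g) ->
  {ae P, forall x, f x = g x}.
Proof.
move=> lf lg fg.
have z n : fcoef n (fun x => f x - g x) = 0 by rewrite fcoefB// fg subrr.
by apply: filterS (fourier_uniqueness (L1B lf lg) z) => x /eqP; rewrite subr_eq0 => /eqP.
Qed.

Lemma fcoef0 f : fcoef (fun=> 0%Z) f = Complex (\int[P]_x f x) 0.
Proof.
have ph (x : T) : phase (fun=> 0%Z) x = 0 :> R.
  by rewrite /phase big1// => i _; rewrite /twopi mulr0 mul0r.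
rewrite /fcoef; congr Complex.
  by apply: eq_Rintegral => x _; rewrite ph cos0 mulr1.
transitivity (\int[P]_x cst (0 : R) x); last by rewrite Rintegral_cst// mul0r.
by apply: eq_Rintegral => x _; rewrite ph sin0 mulr0.
Qed.

Lemma symb_neq0 h n j : 1 + h%:C%C * symb R n j != 0.
Proof. by rewrite eq_complex /= mulr0 mul0r subrr addr0 oner_eq0. Qed.

Lemma integral_res h j f : 0 < h -> L1 f -> \int[P]_x res h j f x = \int[P]_x f x.
Proof.
move=> h0 lf; have := fcoef_res j h0 (fun=> 0%Z) lf.
by rewrite /symb /twopi mulr0 mulr0 addr0 mul1r !fcoef0 => -[].
Qed.

Lemma res_ge0 h j f x : 0 < h -> (forall x, 0 <= f x) -> 0 <= res h j f x.
Proof.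
move=> h0 f0; rewrite /res.
have -> : EFin \o f^\- = cst 0%E.
  by apply/funext => y /=; rewrite /funrneg; congr (_%:E); apply/max_idPr; rewrite oppr_le0.
rewrite {2}/rop; under eq_integral do rewrite mule0.
by rewrite integral0 subr0 fine_ge0// rop_ge0// => y; rewrite lee_fin funrpos_ge0.
Qed.

Lemma integral_unit_cos (m : int) (phi : R) : m != 0 ->
  (\int[U]_y (1 + cos (twopi R m * y + phi))%:E = 1)%E.
Proof.
move=> m0; set w := twopi R m.
have w0 : w != 0.
  by rewrite /w /twopi mulf_neq0 ?intr_eq0// gt_eqF// mulr_gt0// pi_gt0.
have dw : forall x : R, is_derive x (1:R) (fun y : R => w * y + phi) w.
  by move=> x; apply: is_derive_eq; rewrite /GRing.scale /= mulr1 addr0.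
pose f (y : R) := 1 + cos (w * y + phi).
pose F (y : R) := y + w^-1 * sin (w * y + phi).
have dF : forall x : R, is_derive x (1:R) F (f x).
  move=> x; have ds := @is_derive1_comp _ (@sin R) (fun y : R => w * y + phi) x _ _ (is_derive_sin _) (dw x).
  have H := is_deriveD (is_derive_id x (1:R)) (is_deriveZ w^-1 ds).
  apply: (@is_derive_eq _ _ _ _ _ _ _ _ H).
  by rewrite /f /GRing.scale /=; field.
have cf : continuous f.
  move=> x; apply: differentiable_continuous; apply/derivable1_diffP.
  have dc := @is_derive1_comp _ (@cos R) (fun y : R => w * y + phi) x _ _ (is_derive_cos _) (dw x).
  have H := is_deriveD (is_derive_cst (1 : R) x (1:R)) dc.
  exact: (@ex_derive _ _ _ _ _ _ _ H).
have mf : measurable_fun setT (EFin \o f).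
  by apply/measurable_EFinP; exact: (continuous_measurable_fun cf).
have f0 x : 0 <= f x by rewrite /f -lerBlDl sub0r cos_geN1.
rewrite ge0_integral_unit//.
rewrite -(@integral_itv_bndoo _ _ _ _ true false); last exact: measurable_funTS.
rewrite (integral_derive (ler01) cf dF) /F !mulr1 mulr0 !add0r.
by have [_ s1] := cos_period phi m; rewrite [w + phi]addrC /w s1 -/w; congr (_%:E); ring.
Qed.

(** The [j]-th coordinate is exchanged with a fresh variable, over which the cosine runs through
    whole periods. The 1 added for nonnegativity is subtracted at the end. *)
Lemma integral_cos_phase n j phi : n j != 0 -> \int[P]_x cos (phase n x + phi) = 0.
Proof.
move=> nj.
have mc := measurable_cos_phase (R := R) n phi.
have c0 (a : R) : (0 <= (1 + cos a)%:E)%E by rewrite lee_fin -lerBlDl sub0r cos_geN1.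
pose H (p : T * measurableTypeR R) := (1 + cos (phase n (upd p.1 j p.2) + phi))%:E.
have mH : measurable_fun setT H.
  apply/measurable_EFinP/measurable_funD => //.
  exact: (measurableT_comp mc (@measurable_upd R d j)).
have := torus_exchange j mH (fun=> c0 _).
have e1 x : (\int[U]_y H (upd x j y, tnth x j) = (1 + cos (phase n x + phi))%:E)%E.
  transitivity (\int[U]_y cst (1 + cos (phase n x + phi))%:E y)%E.
    by apply: eq_integral => y _; rewrite /H /= !phase_upd tnth_upd eqxx; congr (1 + cos _)%:E; ring.
  by rewrite integral_cst// [X in (_ * X)%E](@probability_setT _ _ _ U) mule1.
have e2 x : (\int[U]_y H (x, y) = 1)%E.
  rewrite -(integral_unit_cos (phase n x - twopi R (n j) * tnth x j + phi) nj).
  by apply: eq_integral => y _; rewrite /H /= phase_upd; congr (1 + cos _)%:E; ring.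
under eq_integral do rewrite e1.
under [X in _ = X -> _]eq_integral do rewrite e2.
rewrite integral_cst// [X in (_ * X)%E](@probability_setT _ _ _ P) mule1.
have lc : L1 (fun x => cos (phase n x + phi)).
  have := L1_cos n phi (L1_cst P 1).
  by under eq_fun do rewrite /= mul1r.
move=> /(congr1 fine) /=.
rewrite -[LHS]/(\int[P]_x (1 + cos (phase n x + phi))).
rewrite (RintegralD measurableT (L1_cst P 1) lc) Rintegral_cst// mul1r.
rewrite [X in fine X](@probability_setT _ _ _ P) /= => e.
by apply: (addrI (1 : R)); rewrite e addr0.
Qed.

(** The Fourier form of the vanishing derivative of a constant; through it resolvents fix
    constants. *)
Lemma symb_fcoef_cst n j c : symb R n j * fcoef n (cst c : T -> R) = 0.
Proof.
have [nj|nj] := eqVneq (n j) 0; first by rewrite /symb nj /twopi mulr0 mul0r.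
rewrite (_ : fcoef n _ = 0) ?mulr0//.
have cc := integral_cos_phase 0 nj; have ss := integral_cos_phase (- (pi / 2)) nj.
have lc := L1_cos0 n (L1_cst P 1); have ls := L1_sin0 n (L1_cst P 1).
rewrite /fcoef /=; apply/eqP; rewrite eq_complex /=; apply/andP; split; apply/eqP.
  rewrite -[RHS](mulr0 c) -cc -(RintegralZl _ measurableT); last first.
    by move: lc; under eq_fun do rewrite /= mul1r -[X in cos X]addr0.
  by apply: eq_Rintegral => x _; rewrite addr0.
rewrite -[RHS](mulr0 c) -ss -(RintegralZl _ measurableT); last first.
  by move: ls; under eq_fun do rewrite /= mul1r -cosBpihalf.
by apply: eq_Rintegral => x _; rewrite cosBpihalf.
Qed.

End resolvent_ae.

(** * Maximal functions of the resolvents *)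

Section maximal.
Context (R : realType) (d : nat).
Local Notation T := (euclid R d).
Local Notation P := (torus_prob R d).
Local Notation L1 := (L1 P).
Implicit Types (n : 'I_d -> int) (j : 'I_d) (h : R).

Lemma L1_indic (A : set T) : measurable A -> L1 (\1_A).
Proof.
move=> mA; apply: (@L1_le _ _ _ _ (cst 1)); first exact: L1_cst.
  exact: measurable_indic.
by move=> x; rewrite indicE normr1; case: (_ \in _); rewrite ?normr1 ?normr0.
Qed.

Lemma L1_max f g : L1 f -> L1 g -> L1 (fun x => Num.max (f x) (g x)).
Proof.
move=> lf lg; apply: (@L1_le _ _ _ _ (fun x => `|f x| + `|g x|)).
- exact: (L1D (L1_norm lf) (L1_norm lg)).
- by apply: measurable_maxr; [exact: (L1_measurable lf)|exact: (L1_measurable lg)].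
- move=> x; rewrite [leRHS]ger0_norm ?addr_ge0//.
  by rewrite /Num.max; case: ifP => _; rewrite ?lerDl ?lerDr normr_ge0.
Qed.

(* Write [R_h] for [res h j]. The resolvent equation gives
   h R_h f - h0 R_h0 f = (h - h0) R_h0 R_h f, and [R_h0] is positive and fixes
   constants, so it suffices that g >= (h - h0) (R_h f - c). *)
Lemma res_resolvent_le h0 h j (f g : T -> R) c : 0 < h0 -> h0 <= h -> L1 f -> L1 g ->
  (forall x, 0 <= g x) -> (forall x, h * res h j f x - h * c <= g x) ->
  {ae P, forall x, h * res h j f x - h * c <= h0 * res h0 j f x + res h0 j g x - h0 * c}.
Proof.
move=> h00 h0h lf lg g0 hg; have hp : 0 < h by apply: lt_le_trans h0h.
pose X := res h j f; pose X0 := res h0 j f.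
have lX : L1 X by exact: L1_res.
have lX0 : L1 X0 by exact: L1_res.
pose D x := g x + ((h - h0) * c - (h - h0) * X x).
have lcc (a : R) : L1 (cst a) by exact: L1_cst.
have lD : L1 D by apply: (L1D lg (L1B (lcc _) (L1Z _ lX))).
have D0 x : 0 <= D x.
  rewrite /D; have := hg x; have := g0 x; rewrite -/(X x).
  (* Where [X x <= c] the sign of [g] suffices; elsewhere [hg] does, because [h - h0 <= h]. *)
  have [Xc|cX] := leP (X x) c; first by nra.
  have : h0 * (X x - c) >= 0 by rewrite mulr_ge0 ?(ltW h00)// subr_ge0 ltW.
  by lra.
have lr : L1 (fun x => res h0 j g x + ((h - h0) * c - (h * X x - h0 * X0 x))).
  by apply: (L1D (L1_res j h00 lg) (L1B (lcc _) (L1B (L1Z _ lX) (L1Z _ lX0)))).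
have e : {ae P, forall x, res h0 j D x =
    res h0 j g x + ((h - h0) * c - (h * X x - h0 * X0 x))}.
  apply: fcoef_inj (L1_res j h00 lD) lr _ => n.
  apply: (mulfI (symb_neq0 h0 n j)); rewrite fcoef_res//.
  have l1 := L1Z (h - h0) lX; have l2 := L1Z h lX; have l3 := L1Z h0 lX0.
  have lc := lcc ((h - h0) * c).
  rewrite [LHS](fcoefD n lg (L1B lc l1)) (fcoefB n lc l1).
  rewrite (fcoefD n (L1_res j h00 lg) (L1B lc (L1B l2 l3))) (fcoefB n lc (L1B l2 l3)).
  rewrite (fcoefB n l2 l3) mulrDr fcoef_res//; congr (_ + _).
  rewrite !fcoefZ//; last exact: (lcc c).
  have z0 := symb_fcoef_cst n j c.
  have eX := fcoef_res j hp n lf; have eX0 := fcoef_res j h00 n lf.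
  move: eX eX0 z0; rewrite -/X -/X0 -[fun=> c]/(cst c).
  move: (fcoef n X) (fcoef n X0) (fcoef n f) (symb R n j) (fcoef n (cst c)) => a b F z C eX eX0 z0.
  rewrite rmorphB /=; apply/eqP; rewrite -subr_eq0; apply/eqP.
  transitivity (- (h%:C%C - h0%:C%C) * h0%:C%C * (z * C) +
    h0%:C%C * ((1 + h%:C%C * z) * a - (1 + h0%:C%C * z) * b)); first ring.
  by rewrite z0 eX eX0 subrr !mulr0 addr0.
apply: filterS e => x e.
have := res_ge0 j x h00 D0; rewrite e; rewrite /X /X0; lra.
Qed.

Fixpoint gmax (G : nat -> T -> R) K x : R :=
  if K is k.+1 then Num.max (gmax G k x) (G k x) else 0.

Lemma gmax_ge0 G K x : 0 <= gmax G K x.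
Proof. by elim: K => //= K IH; rewrite le_max IH. Qed.

Lemma le_gmax G K k x : (k < K)%N -> G k x <= gmax G K x.
Proof.
elim: K => //= K IH; rewrite ltnS leq_eqVlt => /orP[/eqP ->|/IH Gk].
  by rewrite le_max lexx orbT.
by rewrite le_max Gk.
Qed.

Lemma gmax_le G K x b : (forall k, (k < K)%N -> G k x <= b) -> gmax G K x <= Num.max 0 b.
Proof.
elim: K => [_|K IH Gb] /=; first by rewrite le_max lexx.
rewrite ge_max IH => [/=|k kK]; last by apply: Gb; rewrite ltnS ltnW.
by rewrite le_max Gb ?orbT.
Qed.

Lemma L1_gmax G K : (forall k, L1 (G k)) -> L1 (gmax G K).
Proof. by move=> lG; elim: K => [|K IH]; [exact: L1_cst|exact: L1_max]. Qed.

Lemma ae_le_Rintegral (f g : T -> R) : L1 f -> L1 g -> (forall x, 0 <= f x) -> (forall x, 0 <= g x) ->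
  {ae P, forall x, f x <= g x} -> \int[P]_x f x <= \int[P]_x g x.
Proof.
move=> lf lg f0 g0 fg; apply: fine_le.
- exact: integrable_fin_num lf.
- exact: integrable_fin_num lg.
- apply: ae_ge0_le_integral => //; try by move=> x _; rewrite lee_fin.
  + exact: measurable_int lf.
  + exact: measurable_int lg.
  + by apply: filterS fg => x fgx _; rewrite lee_fin.
Qed.

(* As in Hopf's maximal ergodic inequality: for the maximum [g] of 0 and the
   functions h R_h f - h c, and [h0] at most all the scales, [res_resolvent_le]
   gives g + h0 c <= h0 R_h0 f + R_h0 g on [g > 0]. Now integrate. *)
Lemma weak_type_finite (hs : nat -> R) j (f : T -> R) (c : R) K : (forall k, 0 < hs k) -> L1 f ->
  (forall x, 0 <= f x) -> 0 <= c ->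
  (c%:E * P [set x | exists2 k, (k < K)%N & (c < res (hs k) j f x)%R] <= (\int[P]_x f x)%:E)%E.
Proof.
move=> hs0 lf f0 c0.
pose G k x := hs k * res (hs k) j f x - hs k * c.
pose g := gmax G K.
have lG k : L1 (G k) by apply: L1B; [apply: L1Z; exact: L1_res|exact: L1_cst].
have lg : L1 g by exact: L1_gmax.
have g0 x : 0 <= g x by exact: gmax_ge0.
have [h0 h00 h0h] : exists2 h0, 0 < h0 & forall k, (k < K)%N -> h0 <= hs k.
  elim: K {g lg g0} => [|K [h0 h00 h0h]]; first by exists 1.
  exists (Num.min h0 (hs K)); first by rewrite lt_min h00 hs0.
  move=> k; rewrite ltnS leq_eqVlt => /orP[/eqP ->|/h0h kh]; first by rewrite ge_min lexx orbT.
  by rewrite ge_min kh.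
have mg := L1_measurable lg.
have mA : measurable [set x | 0 < g x] by exact: measurable_gt_set.
have lA := L1_indic mA.
have aeG : {ae P, forall x, forall k, (k < K)%N ->
    G k x <= h0 * res h0 j f x + res h0 j g x - h0 * c}.
  apply/ae_foralln => k; have [kK|kK] := boolP (k < K)%N; last by apply: aeW.
  apply: filterS (@res_resolvent_le h0 (hs k) j f g c h00 (h0h k kK) lf lg g0 _) => // x.
  exact: (@le_gmax G K k x kK).
have rf0 x : 0 <= res h0 j f x by exact: res_ge0.
have rg0 x : 0 <= res h0 j g x by exact: res_ge0.
have lrf := L1_res j h00 lf; have lrg := L1_res j h00 lg.
have H : \int[P]_x (g x + (h0 * c) * \1_[set x | 0 < g x] x) <=
    \int[P]_x (h0 * res h0 j f x + res h0 j g x).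
  apply: ae_le_Rintegral; first exact: (L1D lg (L1Z _ lA)).
  - exact: (L1D (L1Z _ lrf) lrg).
  - by move=> x; rewrite addr_ge0// !mulr_ge0 ?(ltW h00)// indicE.
  - by move=> x; rewrite addr_ge0// mulr_ge0 ?(ltW h00).
  - apply: filterS aeG => x /gmax_le; rewrite -/g => gx.
    have := rf0 x; have := rg0 x; have := g0 x; rewrite indicE.
    have [gp|gn] := ltP 0 (g x).
      rewrite mem_set//= mulr1 => _ rg rf.
      by move: gx; rewrite le_max leNgt gp /=; lra.
    rewrite memNset/=; last by apply/negP; rewrite -leNgt.
    rewrite mulr0 addr0 => _ rg rf; apply: le_trans gn _.
    by rewrite addr_ge0// mulr_ge0// ltW.
move: H; rewrite (RintegralD measurableT lg (L1Z _ lA)) (RintegralD measurableT (L1Z _ lrf) lrg).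
(* Resolvents preserve integrals, so the integral of [g] cancels and then the factor [h0] does,
   which leaves a bound independent of the scales and of their number. *)
rewrite (RintegralZl _ measurableT lrf) (RintegralZl _ measurableT lA) !integral_res//.
rewrite addrC lerD2r -mulrA ler_pM2l// => H.
apply: (@le_trans _ _ (c%:E * P [set x | (0 < g x)%R])%E).
  apply: lee_wpmul2l; first by rewrite lee_fin.
  have mS : measurable [set x | exists2 k, (k < K)%N & c < res (hs k) j f x].
    rewrite [X in measurable X](_ : _ = \bigcup_k [set x | (k < K)%N /\ c < res (hs k) j f x]).
      apply: bigcupT_measurable => k; have [kK|kK] := boolP (k < K)%N; last first.
        by rewrite [X in measurable X](_ : _ = set0)//; apply/seteqP; split => x // [].
      rewrite [X in measurable X](_ : _ = [set x | c < res (hs k) j f x]).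
        exact: (measurable_gt_set c (L1_measurable (L1_res j (hs0 k) lf))).
      by apply/seteqP; split => x //= [].
    by apply/seteqP; split => x /= [k]; [move=> kK ck; exists k|move=> _ [kK ck]; exists k].
  apply: le_measure; rewrite ?inE// => x /= [k kK ck].
  apply: lt_le_trans (@le_gmax G K k x kK).
  by rewrite /G -mulrBr mulr_gt0// subr_gt0.
move: H; rewrite -lee_fin EFinM; apply: le_trans; rewrite lee_wpmul2l ?lee_fin//.
rewrite /Rintegral fineK; last exact: integrable_fin_num lA.
by rewrite integral_indic// setIT.
Qed.

End maximal.

Section ae_measure.
Context (d : measure_display) (T : measurableType d) (R : realType).
Variable P : probability T R.
Local Open Scope ereal_scope.

Lemma ae_le_measure (A B : set T) : measurable A -> measurable B ->
  {ae P, forall x, A x -> B x} -> P A <= P B.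
Proof.
move=> mA mB [N [mN N0 sN]].
apply: (@le_trans _ _ (P (B `|` N))).
  apply: le_measure; rewrite ?inE//; first exact: measurableU.
  move=> x Ax; have [Bx|Bx] := pselect (B x); first by left.
  by right; apply: sN => /= /(_ Ax).
by apply: le_trans (measureU2 _ _ _) _ => //; rewrite [X in _ + X]N0 adde0.
Qed.

End ae_measure.

Section maximal_operator.
Context (R : realType) (d : nat).
Local Notation T := (euclid R d).
Local Notation P := (torus_prob R d).
Local Notation L1 := (L1 P).
Implicit Types (j : 'I_d) (f g : T -> \bar R).
Local Open Scope ereal_scope.

Section one_scale.
Variables (h : R) (j : 'I_d).
Hypothesis h0 : (0 < h)%R.

Lemma ae_ropE (f : T -> R) : L1 f -> (forall x, 0 <= f x)%R ->
  {ae P, forall x, rop h j (EFin \o f) x = (res h j f x)%:E}.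
Proof.
move=> lf f0; have [_ fin _] := integral_rop_ge0 j h0 lf f0.
apply: filterS fin => x fx; rewrite /res.
have -> : EFin \o (f^\-)%R = cst 0.
  apply/funext => y /=; rewrite /funrneg; congr (_%:E).
  by apply/max_idPr; rewrite oppr_le0.
have -> : EFin \o (f^\+)%R = EFin \o f.
  apply/funext => y /=; rewrite /funrpos; congr (_%:E); exact/max_idPl.
rewrite {3}/rop; under eq_integral do rewrite mule0.
by rewrite integral0 subr0 fineK.
Qed.

Lemma ae_rop0 f : measurable_fun setT f -> (forall x, 0 <= f x) ->
  {ae P, forall x, f x = 0} -> {ae P, forall x, rop h j f x = 0}.
Proof.
move=> mf f0 fz.
have i0 : \int[P]_x f x = 0.
  transitivity (\int[P]_x cst 0 x); last by rewrite integral0.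
  by apply: ae_eq_integral => //; apply: filterS fz => x ->.
have [+ _] := ae_eq_integral_abs P measurableT (measurable_rop j h0 mf f0).
move=> H; have : ae_eq P setT (rop h j f) (cst 0).
  apply: H; rewrite -[RHS]i0 -(integral_rop j h0 mf f0).
  by apply: eq_integral => x _; rewrite gee0_abs// rop_ge0.
by apply: filterS => x; apply.
Qed.

(** On a single line in direction [j] the exceptional null set may have positive length, so [le_rop]
    does not apply directly. An error term infinite on that set restores an inequality at every
    point, and [ae_rop0] removes its image almost everywhere. *)
Lemma ae_le_rop f g : measurable_fun setT f -> measurable_fun setT g ->
  (forall x, 0 <= f x) -> (forall x, 0 <= g x) ->
  {ae P, forall x, f x <= g x} -> {ae P, forall x, rop h j f x <= rop h j g x}.
Proof.
move=> mf mg f0 g0 [N [mN N0 sN]].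
(* f <= g + e everywhere *)
pose e x : \bar R := +oo * (\1_N x : R)%:E.
have eE x : e x = if x \in N then +oo else 0.
  by rewrite /e indicE; case: (x \in N); rewrite ?mule1 ?mule0.
have me : measurable_fun setT e.
  apply: emeasurable_funM => //; apply/measurable_EFinP; exact: measurable_indic.
have e0 x : 0 <= e x by rewrite eE; case: ifP.
have ez : {ae P, forall x, e x = 0}.
  exists N; split => // x /=; rewrite eE; case: ifPn => //; by rewrite inE.
apply: filterS (ae_rop0 me e0 ez) => x ex.
rewrite -[leRHS]adde0 -ex -ropD//.
apply: le_rop => //; first exact: emeasurable_funD.
move=> y; rewrite eE; case: ifPn => yN; first by rewrite addey ?leey// gt_eqF// (lt_le_trans _ (g0 y)).
rewrite adde0; apply: contrapT => fg; move/negP: yN; apply; rewrite inE; exact: sN.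
Qed.

Lemma ae_rop_cst (c : R) : (0 <= c)%R -> {ae P, forall x, rop h j (cst c%:E) x = c%:E}.
Proof.
move=> c0; have lc : L1 (cst c) by exact: L1_cst.
have e : {ae P, forall x, res h j (cst c) x = c}.
  apply: (fcoef_inj (L1_res j h0 lc) lc) => n.
  apply: (mulfI (symb_neq0 h n j)); rewrite fcoef_res//.
  by rewrite mulrDl mul1r -mulrA symb_fcoef_cst mulr0 addr0.
apply: filterS2 (ae_ropE lc (fun=> c0)) e => x.
by move=> -> ->.
Qed.

End one_scale.

Variable hs : nat -> R.
Hypothesis hs0 : forall k, (0 < hs k)%R.

Definition maxop j f x := ereal_sup (range (fun k => rop (hs k) j f x)).

Lemma rop_le_maxop j f x k : rop (hs k) j f x <= maxop j f x.
Proof. by apply: ereal_sup_ubound; exists k. Qed.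

Lemma maxop_ge0 j f x : (forall x, 0 <= f x) -> 0 <= maxop j f x.
Proof. by move=> f0; apply: le_trans (rop_le_maxop j f x 0); exact: rop_ge0. Qed.

Lemma maxop_le j f x b : (forall k, rop (hs k) j f x <= b) -> maxop j f x <= b.
Proof. by move=> fb; apply: ge_ereal_sup => _ [k _ <-]. Qed.

Lemma measurable_maxop j f : measurable_fun setT f -> (forall x, 0 <= f x) ->
  measurable_fun setT (maxop j f).
Proof.
move=> mf f0.
have := @measurable_fun_esups _ _ R setT (fun k => rop (hs k) j f).
move=> /(_ (fun k => measurable_rop j (hs0 k) mf f0) 0%N).
rewrite (_ : (fun x => esups _ 0%N) = maxop j f)//.
apply/funext => x; rewrite /esups /maxop /=; congr ereal_sup.
by apply/seteqP; split => y /= [k _ <-]; exists k.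
Qed.

Lemma ae_le_maxop j f g : measurable_fun setT f -> measurable_fun setT g ->
  (forall x, 0 <= f x) -> (forall x, 0 <= g x) ->
  {ae P, forall x, f x <= g x} -> {ae P, forall x, maxop j f x <= maxop j g x}.
Proof.
move=> mf mg f0 g0 fg.
have : {ae P, forall x, forall k, rop (hs k) j f x <= rop (hs k) j g x}.
  by apply/ae_foralln => k; exact: ae_le_rop.
apply: filterS => x H; apply: maxop_le => k.
exact: le_trans (H k) (rop_le_maxop j g x k).
Qed.

Lemma maxopD j f g x : measurable_fun setT f -> measurable_fun setT g ->
  (forall x, 0 <= f x) -> (forall x, 0 <= g x) ->
  maxop j (f \+ g) x <= maxop j f x + maxop j g x.
Proof.
move=> mf mg f0 g0; apply: maxop_le => k.
by rewrite ropD// leeD// rop_le_maxop.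
Qed.

Lemma measurable_gt_eset (c : \bar R) f : measurable_fun setT f -> measurable [set x | c < f x].
Proof.
by move=> mf; rewrite -[X in measurable X]setTI; apply: emeasurable_fun_o_infty.
Qed.

(** When the integral is finite, [weak_type_finite] applies to [fine \o f] with a bound independent
    of the number of scales, and continuity of the measure from below reaches all scales. *)
Lemma maxop_weak_type j f (c : R) : measurable_fun setT f -> (forall x, 0 <= f x) ->
  (0 < c)%R -> c%:E * P [set x | c%:E < maxop j f x] <= \int[P]_x f x.
Proof.
move=> mf f0 c0.
have [foo|] := ltP (\int[P]_x f x) +oo; last by rewrite leye_eq => /eqP ->; rewrite leey.
have [lf ff fe] := L1_fine mf f0 foo.
pose r := fine \o f.
have r0 x : (0 <= r x)%R by rewrite /r /= fine_ge0.
pose A K := [set x | exists2 k, (k < K)%N & (c < res (hs k) j r x)%R].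
have mA K : measurable (A K).
  rewrite [A K](_ : _ = \bigcup_(k in [set k | (k < K)%N]) [set x | (c < res (hs k) j r x)%R]).
    apply: bigcup_measurable => k _; apply: measurable_gt_set.
    exact: (L1_measurable (L1_res j (hs0 k) lf)).
  by apply/seteqP; split => x /= [k kK ck]; exists k.
have cA K : P (A K) <= c^-1%:E * \int[P]_x f x.
  have := weak_type_finite j K hs0 lf r0 (ltW c0).
  rewrite /Rintegral fe fineK; last by rewrite ge0_fin_numE ?integral_ge0.
  move=> H; have : c^-1%:E * (c%:E * P (A K)) <= c^-1%:E * \int[P]_x f x.
    by rewrite lee_wpmul2l// lee_fin invr_ge0 ltW.
  by rewrite muleA -EFinM mulVf ?gt_eqF// mul1e.
have mAU : measurable (\bigcup_K A K) by exact: bigcupT_measurable.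
have PA : P (\bigcup_K A K) <= c^-1%:E * \int[P]_x f x.
  have cv : P \o A @ \oo --> P (\bigcup_K A K).
    apply: nondecreasing_cvg_mu => // m n mn; apply/subsetPset => x [k km ck].
    by exists k => //; exact: leq_trans mn.
  rewrite -(cvg_lim _ cv)//; apply: lime_le; first by apply/cvg_ex; eexists; exact: cv.
  exact: nearW.
have sub : {ae P, forall x, [set x | c%:E < maxop j f x] x -> (\bigcup_K A K) x}.
  have e1 : {ae P, forall x, forall k, rop (hs k) j f x <= rop (hs k) j (EFin \o r) x}.
    apply/ae_foralln => k; apply: ae_le_rop => //.
      by apply/measurable_EFinP; exact: (L1_measurable lf).
    by apply: filterS ff => x xf /=; rewrite fineK.
  have e2 : {ae P, forall x, forall k, rop (hs k) j (EFin \o r) x = (res (hs k) j r x)%:E}.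
    by apply/ae_foralln => k; exact: ae_ropE.
  apply: filterS2 e1 e2 => x e1 e2 /= /ereal_sup_gt[_ [k _ <-]] ck.
  exists k.+1 => //; exists k => //.
  by rewrite -lte_fin -e2; exact: lt_le_trans (e1 k).
have := ae_le_measure (measurable_gt_eset c%:E (measurable_maxop j mf f0)) mAU sub.
move=> /le_trans => /(_ _ PA) H.
have : c%:E * P [set x | c%:E < maxop j f x] <= c%:E * (c^-1%:E * \int[P]_x f x).
  by rewrite lee_wpmul2l// lee_fin ltW.
by rewrite muleA -EFinM mulfV ?gt_eqF// mul1e.
Qed.

End maximal_operator.

(** * Rearrangements and the Cesaro operator *)

Section rearrangement.
Context (d : measure_display) (T : measurableType d) (R : realType).
Variable P : probability T R.
Implicit Types f g : T -> R.
Local Notation mu := (@lebesgue_measure R).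

Definition rr f (t : R) : R :=
  inf [set s : R | 0 <= s /\ (P [set x | (s < f x)%R] <= t%:E)%E].

Lemma rearrE (f : T -> R[i]) t : rearr P f t = rr (fun x => Normc.normc (f x)) t.
Proof. by []. Qed.

Lemma integral_layer_cake f : measurable_fun setT f -> (forall x, 0 <= f x) ->
  (\int[P]_x (f x)%:E = \int[mu]_(r in `[0%R, +oo[) P [set x | (r < f x)%R])%E.
Proof.
move=> mf f0.
pose X : {RV P >-> R} := HB.pack f (isMeasurableFun.Build _ _ _ _ f mf).
have := @ge0_expectation_ccdf _ _ _ P X f0.
rewrite expectation_def => ->; apply: eq_integral => r _; rewrite /ccdf /distribution /pushforward.
by congr (P _); apply/seteqP; split => x /=; rewrite in_itv/= andbT.
Qed.

Section rr.
Variable f : T -> R.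
Hypotheses (mf : measurable_fun setT f) (f0 : forall x, 0 <= f x).
Let S t := [set s : R | 0 <= s /\ (P [set x | (s < f x)%R] <= t%:E)%E].

Let S_lb t : has_lbound (S t).
Proof. by exists 0 => s []. Qed.

Lemma rr_ge0 t : 0 <= rr f t.
Proof.
have [S0|/set0P/negP/negPn/eqP S0] := pselect (S t !=set0).
  by apply: lb_le_inf => // s [].
by rewrite /rr -/(S t) S0 inf0.
Qed.

Lemma le_P_gt s s' : s <= s' -> (P [set x | (s' < f x)%R] <= P [set x | (s < f x)%R])%E.
Proof.
move=> ss'; apply: le_measure; rewrite ?inE; try exact: measurable_gt_set.
by move=> x /=; exact: le_lt_trans.
Qed.

Let S_nonempty t : 0 < t -> S t !=set0.
Proof.
move=> t0; pose A k := [set x | k%:R < f x].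
have mA k : measurable (A k) by exact: measurable_gt_set.
have cv : P \o A @ \oo --> P (\bigcap_k A k).
  apply: nonincreasing_cvg_mu => //.
  - by rewrite (le_lt_trans (probability_le1 _ _))// ltry.
  - exact: bigcapT_measurable.
  - by move=> m n mn; apply/subsetPset => x /=; apply: le_lt_trans; rewrite ler_nat.
have e : \bigcap_k A k = set0.
  apply/seteqP; split => x // Ax.
  have := Ax (Num.truncn (f x)).+1 Logic.I; rewrite /A /= => /lt_trans H.
  by have := H _ (truncnS_gt (f x)); rewrite ltxx.
rewrite e measure0 in cv.
have /fine_cvgP[fin cv'] := cv.
have [N _ HN] : \forall k \near \oo, (fine \o (P \o A)) k < t.
  by apply: (cvgr_lt 0) => //; exact: cv'.
exists N%:R; split => //.
have := HN N (leqnn N) => /= H.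
have : P (A N) \is a fin_num by rewrite fin_num_measure.
by move=> /fineK <-; rewrite lee_fin ltW.
Qed.

(** The infimum defining [rr] is attained: the set is the increasing union of the sets where [f]
    exceeds [rr f t] by more than [1 / (k + 1)]. *)
Lemma P_gt_rr t : 0 < t -> (P [set x | (rr f t < f x)%R] <= t%:E)%E.
Proof.
move=> t0; pose A k := [set x | rr f t + k.+1%:R^-1 < f x].
have mA k : measurable (A k) by exact: measurable_gt_set.
have e : \bigcup_k A k = [set x | rr f t < f x].
  apply/seteqP; split => x /=.
    by move=> [k _]; apply: lt_trans; rewrite ltrDl.
  move=> rf; have /ltr_add_invr[k kx] := rf.
  by exists k.
have cv : P \o A @ \oo --> P (\bigcup_k A k).
  apply: nondecreasing_cvg_mu => //; first exact: bigcupT_measurable.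
  move=> m n mn; apply/subsetPset => x /=; apply: le_lt_trans.
  by rewrite lerD2l lef_pV2 ?posrE// ler_nat ltnS.
rewrite -e -(cvg_lim _ cv)//; apply: lime_le; first by apply/cvg_ex; eexists; exact: cv.
apply: nearW => k /=.
have k0 : 0 < k.+1%:R^-1 :> R by [].
have [s [s0 Ps] sr] := inf_adherent k0 (conj (S_nonempty t0) (S_lb t)).
by apply: le_trans (le_P_gt (ltW sr)) Ps.
Qed.

Lemma rr_le t s : 0 < t -> 0 <= s -> (rr f t <= s) = (P [set x | (s < f x)%R] <= t%:E)%E.
Proof.
move=> t0 s0; apply/idP/idP => H.
  by apply: le_trans (le_P_gt H) (P_gt_rr t0).
by apply: (ge_inf (S_lb t)).
Qed.

Lemma rr_nonincreasing t t' : 0 < t -> t <= t' -> rr f t' <= rr f t.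
Proof.
move=> t0 tt'; rewrite rr_le ?rr_ge0 ?(lt_le_trans t0)//.
by apply: le_trans (P_gt_rr t0) _; rewrite lee_fin.
Qed.

Lemma rr_lt0 t : t < 0 -> rr f t = 0.
Proof.
move=> t0; rewrite /rr (_ : [set s | _] = set0) ?inf0//.
apply/seteqP; split => s //= [_]; rewrite leNgt => /negP; apply.
by apply: lt_le_trans (measure_ge0 _ _); rewrite lte_fin.
Qed.

Lemma measurable_rr : measurable_fun setT (rr f : measurableTypeR R -> R).
Proof.
apply: (measurability _ (RGenOInfty.measurableE R)) => //.
move=> _ [_ [a ->] <-]; rewrite setTI.
have [a0|a0] := ltP a 0.
  rewrite (_ : _ @^-1` _ = setT)//; apply/seteqP; split => t //= _.
  by rewrite in_itv/= andbT; exact: lt_le_trans (rr_ge0 t).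
have fin : P [set x | a < f x] \is a fin_num by rewrite fin_num_measure//; exact: measurable_gt_set.
(* The point 0 is split off because [rr_le] requires [0 < t]: for essentially unbounded [f] the
   infimum at 0 runs over the empty set and is 0 by convention. *)
rewrite (_ : _ @^-1` _ = ([set 0] `&` [set t | a < rr f t]) `|` `]0, fine (P [set x | a < f x])[%classic).
  apply: measurableU => //.
  have [a1|a1] := boolP (a < rr f 0).
    rewrite setIidl// => t /= ->; exact: a1.
  rewrite (_ : _ `&` _ = set0)//; apply/seteqP; split => t //= [-> ]; by move/negP: a1.
apply/seteqP; split => t /=; rewrite !in_itv/= ?andbT.
  move=> at'; have [t0|t0|t0] := ltgtP t 0.
  - by move: at'; rewrite rr_lt0// ltNge a0.
  - by right; rewrite /= -lte_fin fineK// ltNge -rr_le// -ltNge.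
  - by left; split => //; move: at'; rewrite t0.
case => [[-> //]|/andP[t0 tP]].
by rewrite ltNge rr_le// -ltNge -(fineK fin) lte_fin.
Qed.

Lemma rr_equimeasurable a : 0 <= a -> unit_prob R [set t | a < rr f t] = P [set x | a < f x].
Proof.
move=> a0.
have fin : P [set x | a < f x] \is a fin_num by rewrite fin_num_measure//; exact: measurable_gt_set.
have p0 : 0 <= fine (P [set x | a < f x]) by rewrite fine_ge0.
have p1 : fine (P [set x | a < f x]) <= 1.
  by rewrite -lee_fin fineK// probability_le1//; exact: measurable_gt_set.
rewrite -[LHS]/(mu (_ `&` _)).
rewrite (_ : _ `&` _ = `]0, fine (P [set x | a < f x])[%classic).
  rewrite lebesgue_measure_itv/= lte_fin; case: ltP => [_|p0'].
    by rewrite -EFinD subr0 fineK.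
  by rewrite -(fineK fin); congr (_%:E); apply/eqP; rewrite eq_le p0 p0'.
apply/seteqP; split => t /=; rewrite !in_itv/=.
  move=> [at' /andP[t0 t1]]; rewrite t0/=.
  by rewrite -lte_fin fineK// ltNge -rr_le// -ltNge.
move=> /andP[t0 tP]; rewrite t0/= (lt_le_trans tP)//; split => //.
by rewrite ltNge rr_le// -ltNge -(fineK fin) lte_fin.
Qed.

End rr.
End rearrangement.

Section rearrangement_averages.
Context (d : measure_display) (T : measurableType d) (R : realType).
Variable P : probability T R.
Local Notation U := (unit_prob R).
Variable f : T -> R.
Hypotheses (mf : measurable_fun setT f) (f0 : forall x, 0 <= f x).

Lemma integral_rr_excess a : 0 <= a ->
  (\int[P]_x (Num.max (f x - a) 0)%:E = \int[U]_t (Num.max (rr P f t - a) 0)%:E)%E.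
Proof.
move=> a0.
have mr := measurable_rr P mf.
rewrite !integral_layer_cake; last 4 first.
- apply: measurable_maxr => //; exact: measurable_funB.
- by move=> t; rewrite le_max lexx orbT.
- apply: measurable_maxr => //; exact: measurable_funB.
- by move=> x; rewrite le_max lexx orbT.
apply: eq_integral => r; rewrite inE/= in_itv/= andbT => r0.
have e (X : Type) (g : X -> R) : [set x | r < Num.max (g x - a) 0] = [set x | a + r < g x].
  apply/seteqP; split => x /=; rewrite lt_max ltrBrDl (ltNge r 0) r0/= orbF//.
by rewrite !e -(rr_equimeasurable P mf)// addr_ge0.
Qed.

Definition avg (g : R -> R) (t : R) : R := t^-1 * \int[U]_(s in `]0, t[) g s.

Lemma unit_itv (t : R) : 0 < t < 1 -> U `]0, t[ = t%:E.
Proof.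
move=> /andP[t0 t1]; rewrite -[LHS]/(lebesgue_measure (_ `&` _)).
rewrite setIidl; first by rewrite lebesgue_measure_itv/= lte_fin t0 -EFinD subr0.
by move=> s /=; rewrite !in_itv/= => /andP[-> st]; exact: lt_trans t1.
Qed.

Lemma ae_unit : {ae U, forall s : R, 0 < s < 1}.
Proof.
exists (~` `]0, 1[%classic); split; first exact: measurableC.
  by rewrite -[LHS]/(lebesgue_measure (_ `&` _)) setICl measure0.
by move=> s /=; rewrite in_itv.
Qed.

Variable t : R.
Hypothesis t01 : 0 < t < 1.
Hypothesis int_rr : U.-integrable `]0, t[ (EFin \o rr P f).

Let t0 : 0 < t. Proof. by case/andP: t01. Qed.

(** A rearrangement is nonincreasing, so its excess over the value at [t] is the plain difference on
    (0, t) and vanishes afterwards. *)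
Lemma integral_rr_excess_avg :
  (\int[U]_s (Num.max (rr P f s - rr P f t) 0)%:E = (t * (avg (rr P f) t - rr P f t))%:E)%E.
Proof.
have mr := measurable_rr P mf.
have mE : measurable_fun setT (fun s => (Num.max (rr P f s - rr P f t) 0)%:E).
  by apply/measurable_EFinP; apply: measurable_maxr => //; exact: measurable_funB.
have icst : U.-integrable `]0, t[ (EFin \o cst (rr P f t)).
  by apply: finite_measure_integrable_cst.
have e1 : (\int[U]_(s in `]0%R, t[) (rr P f s - rr P f t)%:E =
    (t * (avg (rr P f) t - rr P f t))%:E)%E.
  under eq_integral do rewrite EFinB.
  rewrite (integralB_EFin _ int_rr icst)//= integral_cst//= unit_itv//.
  have fin : (\int[U]_(s in `]0%R, t[) (rr P f s)%:E \is a fin_num)%E.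
    exact: integrable_fin_num int_rr.
  rewrite -(fineK fin) -EFinM -EFinB /avg /Rintegral; congr (_%:E).
  by field; rewrite gt_eqF.
rewrite -e1 [RHS]integral_mkcond; apply: ae_eq_integral => //.
  apply: (measurable_restrictT _ _).1 => //; apply: measurable_funTS.
  by apply/measurable_EFinP; exact: measurable_funB.
apply: (@filterS _ _ (ae_filter_ringOfSetsType (unit_prob R)) _ _ _ ae_unit) => s /andP[s0 s1] _.
rewrite patchE.
have [st|ts] := ltP s t.
  rewrite mem_set/=; last by rewrite in_itv/= s0.
  by congr (_%:E); apply/max_idPl; rewrite subr_ge0 rr_nonincreasing// ltW.
rewrite memNset/=; last by rewrite in_itv/= s0 ltNge ts.
by congr (_%:E); apply/max_idPr; rewrite subr_le0 rr_nonincreasing.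
Qed.

Lemma rr_le_avg : rr P f t <= avg (rr P f) t.
Proof.
rewrite -subr_ge0 -(pmulr_rge0 _ t0) -lee_fin -integral_rr_excess_avg.
by apply: integral_ge0 => s _; rewrite lee_fin le_max lexx orbT.
Qed.

End rearrangement_averages.

(** * Symmetric spaces and the Cesàro operator *)

Section symmetric.
Context (R : realType).
Local Notation U := (unit_prob R).
Local Notation normc := Normc.normc.

Lemma normc_real (a : R) : normc (a%:C%C) = `|a|.
Proof. by rewrite /normc /= expr0n addr0 sqrtr_sqr. Qed.

Lemma normc_ge0 (z : R[i]) : 0 <= normc z.
Proof. by case: z => a b; exact: sqrtr_ge0. Qed.

Lemma in_L0_real (d : measure_display) (T : measurableType d) (f : T -> R) :
  measurable_fun setT f -> in_L0 (fun x => (f x)%:C%C).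
Proof. by move=> mf; split => //=; exact: measurable_cst. Qed.

Lemma measurable_normc (d : measure_display) (T : measurableType d) (f : T -> R[i]) :
  in_L0 f -> measurable_fun setT (fun x => normc (f x)).
Proof.
move=> [mr mi].
rewrite (_ : (fun _ => _) = Num.sqrt \o (fun x => complex.Re (f x) ^+ 2 + complex.Im (f x) ^+ 2)).
  apply: measurableT_comp; first exact: (continuous_measurable_fun (@sqrt_continuous R)).
  by apply: measurable_funD; apply: measurable_funX.
by apply/funext => x /=; case: (f x).
Qed.

Lemma rr_mono_ae (d : measure_display) (T : measurableType d) (P : probability T R)
    (f g : T -> R) t : measurable_fun setT f -> measurable_fun setT g ->
  {ae P, forall x, f x <= g x} -> 0 < t -> rr P f t <= rr P g t.
Proof.
move=> mf mg fg t0; rewrite rr_le ?rr_ge0//.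
apply: le_trans (P_gt_rr P mg t0).
apply: ae_le_measure; try exact: measurable_gt_set.
by apply: filterS fg => x fgx /=; move/lt_le_trans; apply.
Qed.

Lemma symm_solid (E : symmetric_space R) (f g : R -> R[i]) : scarrier E f -> in_L0 g ->
  (forall t : R, 0 < t < 1 -> normc (g t) <= normc (f t)) ->
  scarrier E g /\ snorm E g <= snorm E f.
Proof.
move=> Ef Lg gf; apply: (symm_le Ef Lg) => t /andP[t0 t1].
apply: (@rr_mono_ae _ _ U (fun x => normc (g x)) (fun x => normc (f x))) => //.
- exact: measurable_normc.
- by apply: measurable_normc; exact: (@scarrier_L0 _ E).
- by apply: (@filterS _ _ (ae_filter_ringOfSetsType (unit_prob R)) _ _ _ (@ae_unit R)).
Qed.

Lemma snorm0 (E : symmetric_space R) : snorm E (fun=> 0) = 0.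
Proof.
have := @snormZ _ E 0 _ (scarrier0 E).
rewrite (_ : (fun t : R => 0 * 0) = (fun=> 0)); last by apply/funext => ?; rewrite mul0r.
by rewrite (normc_real 0) normr0 mul0r.
Qed.

Lemma snorm_ge0 (E : symmetric_space R) f : scarrier E f -> 0 <= snorm E f.
Proof.
move=> Ef; have H (t : R) : 0 < t < 1 -> normc (0 : R[i]) <= normc (f t).
  by move=> _; rewrite (normc_real 0) normr0; exact: normc_ge0.
have [_ fn] := symm_solid (g := fun=> 0) Ef (scarrier_L0 (scarrier0 E)) H.
by rewrite -(snorm0 E).
Qed.

Variable E : symmetric_space R.
Hypothesis hE : cesaro_bounded E.
Local Notation rc g := (fun t : R => (g t)%:C%C).

Lemma cesaro_avg (g : R -> R) : (forall t, 0 <= g t) -> scarrier E (rc g) ->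
  forall t, 0 < t < 1 -> U.-integrable `]0, t[ (EFin \o g) /\
    normc (cesaro (rc g) t) = avg g t.
Proof.
move=> g0 Eg t t01; have [M HM] := hE; have [Hint _ _] := HM _ Eg.
split.
  have := Hint t t01; congr (integrable _ _ _).
  by apply/funext => s; rewrite -[RHS]/(g s)%:E -{2}(ger0_norm (g0 s)) -normc_real.
have t0 : 0 <= t by case/andP: t01 => /ltW.
have -> : cesaro (rc g) t = (avg g t)%:C%C.
  rewrite /cesaro /avg rmorphM; congr (_ * _).
  by rewrite /cintegral /= Rintegral_cst// mul0r.
rewrite normc_real ger0_norm//.
by rewrite mulr_ge0 ?invr_ge0// Rintegral_ge0.
Qed.

Lemma cesaro_constant : exists2 M, 0 <= M & forall f, scarrier E f ->
  scarrier E (cesaro f) /\ snorm E (cesaro f) <= M * snorm E f.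
Proof.
have [M HM] := hE; exists (Num.max M 0); first by rewrite le_max lexx orbT.
move=> f Ef; have [_ Ecf cf] := HM _ Ef; split => //; apply: le_trans cf _.
by rewrite ler_wpM2r ?snorm_ge0// le_max lexx.
Qed.

End symmetric.

Section dominated.
Context (R : realType) (d : measure_display) (T : measurableType d).
Variables (P : probability T R) (E : symmetric_space R).
Hypothesis hE : cesaro_bounded E.
Local Notation U := (unit_prob R).
Local Notation normc := Normc.normc.
Local Notation rc g := (fun t : R => (g t)%:C%C).
Implicit Types f g : T -> R.

(** Membership together with a real bound stands in for the extended norm [torus_norm], so that
    estimates compose without cases for infinite norms. *)
Definition bnd_in f b := [/\ measurable_fun setT f, forall x, 0 <= f x,
  scarrier E (rc (rr P f)) & snorm E (rc (rr P f)) <= b].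

Lemma bnd_in_le f b b' : b <= b' -> bnd_in f b -> bnd_in f b'.
Proof. by move=> bb' [? ? ? fb]; split => //; exact: le_trans bb'. Qed.

Lemma rr_solid f g : measurable_fun setT g -> scarrier E (rc (rr P f)) ->
  (forall t, 0 < t < 1 -> rr P g t <= rr P f t) ->
  scarrier E (rc (rr P g)) /\ snorm E (rc (rr P g)) <= snorm E (rc (rr P f)).
Proof.
move=> mg Ef gf; apply: (symm_solid Ef).
  by apply: in_L0_real; exact: measurable_rr.
by move=> t t01; rewrite !normc_real !ger0_norm ?rr_ge0// gf.
Qed.

Lemma bnd_in_mono f g b : bnd_in f b -> measurable_fun setT g -> (forall x, 0 <= g x) ->
  {ae P, forall x, g x <= f x} -> bnd_in g b.
Proof.
move=> [mf f0 Ef fb] mg g0 gf.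
have [Eg gn] : scarrier E (rc (rr P g)) /\ snorm E (rc (rr P g)) <= snorm E (rc (rr P f)).
  by apply: rr_solid => // t /andP[t0 _]; exact: rr_mono_ae.
by split => //; exact: le_trans fb.
Qed.

Lemma bnd_in_integrable f b t : bnd_in f b -> 0 < t < 1 ->
  U.-integrable `]0, t[ (EFin \o rr P f).
Proof. by move=> [_ _ Ef _] t01; have [] := cesaro_avg hE (rr_ge0 P f) Ef t01. Qed.

Lemma rr_scale f c t : measurable_fun setT f -> 0 <= c -> 0 < t ->
  rr P (fun x => c * f x) t <= c * rr P f t.
Proof.
move=> mf c0 t0; have mcf : measurable_fun setT (fun x => c * f x) by exact: measurable_funM.
rewrite rr_le ?mulr_ge0 ?rr_ge0//; apply: le_trans (P_gt_rr P mf t0).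
apply: le_measure; rewrite ?inE; try exact: measurable_gt_set.
move=> x /=; move: c0; rewrite le_eqVlt => /orP[/eqP <-|c0]; first by rewrite !mul0r ltxx.
by rewrite ltr_pM2l.
Qed.

Lemma bnd_in_scale f b c : bnd_in f b -> 0 <= c -> bnd_in (fun x => c * f x) (c * b).
Proof.
move=> [mf f0 Ef fb] c0.
have mcf : measurable_fun setT (fun x => c * f x) by exact: measurable_funM.
have [Eg gn] : scarrier E (rc (rr P (fun x => c * f x))) /\
    snorm E (rc (rr P (fun x => c * f x))) <= snorm E (fun t => c%:C%C * (rr P f t)%:C%C).
  apply: (symm_solid (scarrierZ c%:C%C Ef)).
    by apply: in_L0_real; exact: measurable_rr.
  move=> t /andP[t0 _]; rewrite -rmorphM !normc_real !ger0_norm ?mulr_ge0 ?rr_ge0//.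
  exact: rr_scale.
split => //; first by move=> x; rewrite mulr_ge0.
apply: le_trans gn _; rewrite (snormZ c%:C%C Ef) normc_real ger0_norm//.
exact: ler_wpM2l.
Qed.

Variable M : R.
Hypothesis M0 : 0 <= M.
Hypothesis HM : forall u, scarrier E u ->
  scarrier E (cesaro u) /\ snorm E (cesaro u) <= M * snorm E u.

Lemma bnd_in_avg f g b : bnd_in f b -> measurable_fun setT g -> (forall x, 0 <= g x) ->
  (forall t, 0 < t < 1 -> rr P g t <= avg (rr P f) t) -> bnd_in g (M * b).
Proof.
move=> [mf f0 Ef fb] mg g0 gf; have [Ec cn] := HM Ef.
have [Eg gn] : scarrier E (rc (rr P g)) /\
    snorm E (rc (rr P g)) <= snorm E (cesaro (rc (rr P f))).
  apply: (symm_solid Ec); first by apply: in_L0_real; exact: measurable_rr.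
  move=> t t01; have [_ ->] := cesaro_avg hE (rr_ge0 P f) Ef t01.
  by rewrite normc_real ger0_norm ?rr_ge0// gf.
split => //; apply: le_trans gn _; apply: le_trans cn _; exact: ler_wpM2l.
Qed.

(** The value at [t / 2] is at most the mean over (0, t / 2), and halving the interval at most
    doubles the mean of a nonnegative function. This is how the Cesàro operator controls
    dilations. *)
Lemma rr_half_le f t : measurable_fun setT f -> 0 < t < 1 ->
  U.-integrable `]0, t[ (EFin \o rr P f) -> rr P f (t / 2) <= 2 * avg (rr P f) t.
Proof.
move=> mf t01 it; have /andP[t0 t1] := t01.
have h01 : 0 < t / 2 < 1 by lra.
have ih : U.-integrable `]0, (t / 2)[ (EFin \o rr P f).
  apply: integrableS it => // s /=; rewrite !in_itv/=; lra.
apply: le_trans (rr_le_avg mf h01 ih) _.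
rewrite /avg mulrA invfM invrK [t^-1 * 2]mulrC; apply: ler_wpM2l.
  by rewrite mulr_ge0// invr_ge0 ltW.
apply: fine_le; [exact: integrable_fin_num ih|exact: integrable_fin_num it|].
apply: ge0_subset_integral => //.
- apply: measurable_funTS; apply/measurable_EFinP; exact: measurable_rr.
- by move=> s _; rewrite lee_fin rr_ge0.
- by move=> s /=; rewrite !in_itv/=; lra.
Qed.

(** Where the sum exceeds the right-hand side, [f] or [g] exceeds its own term, and each does so
    with probability at most [t / 2]. *)
Lemma rrD f g t : measurable_fun setT f -> measurable_fun setT g -> 0 < t ->
  rr P (fun x => f x + g x) t <= rr P f (t / 2) + rr P g (t / 2).
Proof.
move=> mf mg t0; have t20 : 0 < t / 2 by rewrite divr_gt0.
have mfg : measurable_fun setT (fun x => f x + g x) by exact: measurable_funD.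
rewrite rr_le ?addr_ge0 ?rr_ge0//.
apply: (@le_trans _ _ (P ([set x | rr P f (t / 2) < f x] `|` [set x | rr P g (t / 2) < g x]))).
  apply: le_measure; rewrite ?inE; try exact: measurable_gt_set.
    by apply: measurableU; exact: measurable_gt_set.
  move=> x /= H; have [fx|fx] := ltP (rr P f (t / 2)) (f x); first by left.
  by right; move: H fx; lra.
apply: le_trans (measureU2 _ _ _) _; try exact: measurable_gt_set.
by rewrite [t in leRHS]splitr EFinD leeD// P_gt_rr.
Qed.

(** [snormD] concerns functions on (0, 1), and rearrangement is not subadditive. By [rrD] and
    [rr_half_le] the rearrangement of the sum is at most twice the sum of two Cesàro means, whence
    [2 * M]. *)
Lemma bnd_inD f g a b : bnd_in f a -> bnd_in g b ->
  bnd_in (fun x => f x + g x) (2 * M * (a + b)).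
Proof.
move=> Hf Hg; have [mf f0 Ef fa] := Hf; have [mg g0 Eg gb] := Hg.
have mfg : measurable_fun setT (fun x => f x + g x) by exact: measurable_funD.
have [Ecf cf] := HM Ef; have [Ecg cg] := HM Eg.
pose c2 : R[i] := 2%:C%C.
pose F t := c2 * cesaro (rc (rr P f)) t; pose G t := c2 * cesaro (rc (rr P g)) t.
have EF : scarrier E F by exact: scarrierZ.
have EG : scarrier E G by exact: scarrierZ.
have cE h t : cesaro (rc (rr P h)) t = (avg (rr P h) t)%:C%C.
  by rewrite /cesaro /avg rmorphM; congr (_ * _); rewrite /cintegral /= Rintegral_cst// mul0r.
have a0 h t : 0 < t -> 0 <= avg (rr P h) t.
  by move=> t0; rewrite mulr_ge0 ?invr_ge0 ?(ltW t0)// Rintegral_ge0// => s _; exact: rr_ge0.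
have [EfG nfG] : scarrier E (rc (rr P (fun x => f x + g x))) /\
    snorm E (rc (rr P (fun x => f x + g x))) <= snorm E (F \+ G).
  apply: (symm_solid (scarrierD EF EG)); first by apply: in_L0_real; exact: measurable_rr.
  move=> t t01; have /andP[t0 _] := t01.
  change (normc ((rr P (fun x => f x + g x) t)%:C%C) <=
    normc (c2 * cesaro (rc (rr P f)) t + c2 * cesaro (rc (rr P g)) t)).
  rewrite !cE /c2 -!rmorphM -rmorphD !normc_real !ger0_norm ?rr_ge0//; last first.
    by rewrite addr_ge0// mulr_ge0// a0.
  apply: le_trans (rrD mf mg t0) _.
  by apply: lerD; apply: rr_half_le => //; [exact: (bnd_in_integrable Hf)|exact: (bnd_in_integrable Hg)].
split => //; first by move=> x; rewrite addr_ge0.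
apply: le_trans nfG _; apply: le_trans (snormD EF EG) _.
rewrite !(snormZ c2)// normc_real ger0_norm// -mulrDr -mulrA ler_wpM2l//.
rewrite mulrDr lerD//.
  by apply: le_trans cf _; exact: ler_wpM2l.
by apply: le_trans cg _; exact: ler_wpM2l.
Qed.

End dominated.

(** * Boundedness of the maximal operators on symmetric spaces *)

Section maximal_symmetric.
Context (R : realType) (d : nat).
Local Notation T := (euclid R d).
Local Notation P := (torus_prob R d).
Local Notation U := (unit_prob R).
Implicit Types (j : 'I_d) (v w : T -> \bar R).
Variable hs : nat -> R.
Hypothesis hs0 : forall k, 0 < hs k.
Local Notation maxop := (maxop hs).

(* Weak type, applied to the excess of [v] over its rearrangement at [t]. *)
Lemma maxop_excess j v t s : measurable_fun setT v -> (forall x, 0 <= v x)%E ->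
  {ae P, forall x, v x \is a fin_num} -> 0 < t < 1 ->
  U.-integrable `]0, t[ (EFin \o rr P (fine \o v)) -> 0 < s ->
  (s%:E * P [set x | ((rr P (fine \o v) t + s)%:E < maxop j v x)%E] <=
   (t * (avg (rr P (fine \o v)) t - rr P (fine \o v) t))%:E)%E.
Proof.
move=> mv v0 vfin t01 it s0; pose f := fine \o v; pose l := rr P f t.
rewrite -/f -/l.
have mf : measurable_fun setT f by exact: measurableT_comp.
have l0 : 0 <= l by exact: rr_ge0.
pose e x : R := Num.max (f x - l) 0.
have me : measurable_fun setT (EFin \o e).
  by apply/measurable_EFinP; apply: measurable_maxr => //; exact: measurable_funB.
have e0 x : (0 <= (EFin \o e) x)%E by rewrite lee_fin le_max lexx orbT.
have c0 (x : T) : (0 <= cst l%:E x)%E by rewrite lee_fin.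
have le1 : {ae P, forall x, (maxop j v x <= maxop j ((EFin \o e) \+ cst l%:E)%E x)%E}.
  apply: ae_le_maxop => //; first exact: emeasurable_funD.
    by move=> x; rewrite adde_ge0.
  apply: filterS vfin => x /fineK <-; rewrite /e /f /= -EFinD lee_fin -lerBlDr.
  by rewrite le_max lexx.
have le2 : {ae P, forall x, forall k, rop (hs k) j (cst l%:E) x = l%:E}.
  by apply/ae_foralln => k; exact: ae_rop_cst.
rewrite -integral_rr_excess_avg// -(integral_rr_excess P mf)//.
apply: le_trans (maxop_weak_type hs0 j me e0 s0).
apply: lee_wpmul2l; first by rewrite lee_fin ltW.
apply: ae_le_measure; try by apply: measurable_gt_eset; exact: measurable_maxop.
apply: filterS2 le1 le2 => x h1 h2 /= /lt_le_trans H.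
have := H _ h1 => /lt_le_trans /(_ (maxopD hs0 j x me (measurable_cst _) e0 c0)) H2.
have H3 : (maxop j (cst l%:E) x <= l%:E)%E by apply: maxop_le => k; rewrite h2.
have := lt_le_trans H2 (leeD2l _ H3).
by rewrite EFinD addeC lteD2rE.
Qed.

Lemma rr_maxop_le j v t : measurable_fun setT v -> (forall x, 0 <= v x)%E ->
  {ae P, forall x, v x \is a fin_num} -> 0 < t < 1 ->
  U.-integrable `]0, t[ (EFin \o rr P (fine \o v)) ->
  rr P (fine \o maxop j v) t <= avg (rr P (fine \o v)) t.
Proof.
move=> mv v0 vfin t01 it; have /andP[t0 _] := t01.
have mf : measurable_fun setT (fine \o v) by exact: measurableT_comp.
have mm := measurable_maxop hs0 j mv v0.
have m0 x := maxop_ge0 hs0 j x v0.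
have l0 := rr_ge0 P (fine \o v) t.
have dl := rr_le_avg mf t01 it.
apply/ler_addgt0Pr => e e0.
(* The integral of the excess is at most [t * s], so [maxop_excess] gives a probability of at most
   [t]; [e] keeps [s] positive when the mean equals the value at [t]. *)
pose s := avg (rr P (fine \o v)) t - rr P (fine \o v) t + e.
have s0 : 0 < s by rewrite /s; lra.
rewrite (_ : _ + e = rr P (fine \o v) t + s); last by rewrite /s; ring.
rewrite rr_le//; [|exact: measurableT_comp|by rewrite addr_ge0// ltW].
apply: (@le_trans _ _ (P [set x | ((rr P (fine \o v) t + s)%:E < maxop j v x)%E])).
  apply: le_measure; rewrite ?inE.
  - by apply: measurable_gt_set; exact: measurableT_comp.
  - exact: measurable_gt_eset.
  - move=> x /=; case: (maxop j v x) (m0 x) => [r| |]//= _; rewrite ?ltry//.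
have H := maxop_excess j mv v0 vfin t01 it s0.
have pf : P [set x | ((rr P (fine \o v) t + s)%:E < maxop j v x)%E] \is a fin_num.
  by rewrite fin_num_measure//; exact: measurable_gt_eset.
move: H; rewrite -(fineK pf) -EFinM !lee_fin => H.
rewrite -(ler_pM2l s0); apply: le_trans H _.
by rewrite mulrC ler_wpM2r ?(ltW t0)// /s lerDl ltW.
Qed.

(** The infinity set lies in every superlevel set, so by [maxop_excess] its probability times any
    [s > 0] stays below a fixed number. *)
Lemma ae_maxop_fin j v t : measurable_fun setT v -> (forall x, 0 <= v x)%E ->
  {ae P, forall x, v x \is a fin_num} -> 0 < t < 1 ->
  U.-integrable `]0, t[ (EFin \o rr P (fine \o v)) ->
  {ae P, forall x, maxop j v x \is a fin_num}.
Proof.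
move=> mv v0 vfin t01 it; have /andP[t0 _] := t01.
have mm := measurable_maxop hs0 j mv v0.
have m0 x := maxop_ge0 hs0 j x v0.
have l0 := rr_ge0 P (fine \o v) t.
pose A := [set x | ~ (maxop j v x \is a fin_num)].
have mA : measurable A.
  rewrite (_ : A = ~` [set x | maxop j v x \is a fin_num])//; apply: measurableC.
  by rewrite -[X in measurable X]setTI; exact: emeasurable_fin_num.
exists A; split => //.
have pf : P A \is a fin_num by rewrite fin_num_measure.
have dl := rr_le_avg (measurableT_comp (fine_measurable measurableT) mv) t01 it.
set dlt := t * (avg (rr P (fine \o v)) t - rr P (fine \o v) t).
have dlt0 : 0 <= dlt by rewrite mulr_ge0 ?(ltW t0)// subr_ge0.
have H s : 0 < s -> s * fine (P A) <= dlt.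
  move=> s0; rewrite -lee_fin EFinM fineK//.
  apply: le_trans (maxop_excess j mv v0 vfin t01 it s0).
  apply: lee_wpmul2l; first by rewrite lee_fin ltW.
  apply: le_measure; rewrite ?inE//; first exact: measurable_gt_eset.
  by move=> x; rewrite /A /=; case: (maxop j v x) (m0 x) => [r| |]//= _ _; rewrite ltry.
rewrite -[LHS](fineK pf); congr (_%:E); apply/eqP; rewrite eq_le fine_ge0// andbT leNgt.
apply/negP => p0; have := H ((dlt + 1) / fine (P A)).
rewrite divr_gt0 ?ltr_wpDl// divfK ?gt_eqF// => /(_ isT); lra.
Qed.

Variable E : symmetric_space R.
Hypothesis hE : cesaro_bounded E.

Definition ebnd_in v b := [/\ measurable_fun setT v, forall x, (0 <= v x)%E,
  {ae P, forall x, v x \is a fin_num} & bnd_in P E (fine \o v) b].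

(** The summand [v x] makes the iterates nondecreasing, so that bounds with different numbers of
    iterations can be added. *)
Definition nop v x : \bar R := (v x + \sum_(j < d) maxop j v x)%E.

Lemma ebnd_in_nop : exists2 C, 0 <= C & forall v b, ebnd_in v b -> ebnd_in (nop v) (C * b).
Proof.
have [M M0 HM] := cesaro_constant hE.
suff [C C0 HC] : exists2 C, 0 <= C & forall v b, ebnd_in v b ->
    ebnd_in (fun x => v x + \sum_(j <- index_enum 'I_d) maxop j v x)%E (C * b).
  by exists C.
elim: (index_enum 'I_d) => [|j s [C C0 HC]].
  by exists 1 => // v b vb; under eq_fun do rewrite big_nil adde0; rewrite mul1r.
exists (2 * M * (C + M)); first by rewrite !mulr_ge0// addr_ge0.
move=> v b vb; have [ms s0 sfin sb] := HC v b vb.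
have [mv v0 vfin fvb] := vb.
have mm := measurable_maxop hs0 j mv v0.
have m0 x := maxop_ge0 hs0 j x v0.
have h01 : 0 < (2^-1 : R) < 1 by lra.
have mfin := ae_maxop_fin j mv v0 vfin h01 (bnd_in_integrable hE fvb h01).
have mb : bnd_in P E (fine \o maxop j v) (M * b).
  apply: (bnd_in_avg hE M0 HM fvb) => [|x|t t01]; first exact: measurableT_comp.
    exact: fine_ge0.
  by apply: rr_maxop_le => //; exact: (bnd_in_integrable hE fvb).
have e : (fun x => v x + \sum_(j0 <- j :: s) maxop j0 v x)%E =
    (fun x => (v x + \sum_(j0 <- s) maxop j0 v x) + maxop j v x)%E.
  by apply/funext => x; rewrite big_cons -addeA; congr (_ + _)%E; rewrite addeC.
rewrite e; have ge0 x := adde_ge0 (s0 x) (m0 x).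
have me : measurable_fun setT (fun x => (v x + \sum_(j0 <- s) maxop j0 v x) + maxop j v x)%E.
  exact: emeasurable_funD.
split => //.
  by apply: filterS2 sfin mfin => x sx mx; rewrite fin_numD sx.
have := bnd_inD hE M0 HM sb mb.
rewrite -mulrDl mulrA => H; apply: (bnd_in_mono H).
- exact: measurableT_comp.
- by move=> x; exact: fine_ge0.
- by apply: filterS2 sfin mfin => x sx mx /=; rewrite fineD.
Qed.

Lemma ebnd_in_iter p : exists2 C, 0 <= C &
  forall v b, ebnd_in v b -> ebnd_in (iter p nop v) (C * b).
Proof.
elim: p => [|p [C C0 HC]]; first by exists 1 => // v b; rewrite mul1r.
have [D D0 HD] := ebnd_in_nop.
exists (D * C); first exact: mulr_ge0.
by move=> v b /HC /HD; rewrite mulrA.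
Qed.

End maximal_symmetric.

(** * Weak derivatives as Fourier multipliers *)

Section trigonometric_test_functions.
Context (R : realType) (d : nat).
Local Notation T := (euclid R d).
Local Notation P := (torus_prob R d).
Implicit Types (n : 'I_d -> int) (j : 'I_d) (zeta : R[i]) (x : 'rV[R]_d) (s : seq 'I_d).

Definition rowphase n x : R := \sum_(j < d) twopi R (n j) * x ord0 j.

(** The real part of [zeta] times e^(i rowphase). The parameter [zeta] makes the family stable under
    differentiation, which multiplies it by a symbol. *)
Definition trig n zeta x : R :=
  complex.Re zeta * cos (rowphase n x) - complex.Im zeta * sin (rowphase n x).

Lemma rowphaseD n x y : rowphase n (x + y) = rowphase n x + rowphase n y.
Proof. by rewrite -big_split; apply: eq_bigr => j _; rewrite mxE mulrDr. Qed.

Lemma rowphaseZ n (t : R) x : rowphase n (t *: x) = t * rowphase n x.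
Proof. by rewrite /rowphase mulr_sumr; apply: eq_bigr => j _; rewrite mxE; ring. Qed.

Lemma rowphase_delta n j : rowphase n (delta_mx ord0 j) = twopi R (n j).
Proof.
rewrite /rowphase (bigD1 j)//= big1 ?addr0 => [|i /negPf ij].
  by rewrite mxE !eqxx mulr1.
by rewrite mxE eqxx ij mulr0.
Qed.

Lemma continuous_rowphase n : continuous (rowphase n).
Proof.
suff H (r : seq 'I_d) : continuous (fun x : 'rV[R]_d => \sum_(j <- r) twopi R (n j) * x ord0 j).
  exact: H.
elim: r => [|j r IH].
  by under eq_fun do rewrite big_nil; exact: cst_continuous.
under eq_fun do rewrite big_cons.
move=> x; have FF : Filter (nbhs x) by exact: nbhs_filter.
have cc := @coord_continuous R 1 d ord0 j x.
exact (cvgD (cvgM (@cvg_cst _ (twopi R (n j)) _ _ FF) cc) (IH x)).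
Qed.

Lemma continuous_trig n zeta : continuous (trig n zeta).
Proof.
move=> x; have cp := @continuous_rowphase n x.
have FF : Filter (nbhs x) by exact: nbhs_filter.
have c1 := continuous_comp cp (@continuous_cos R (rowphase n x)).
have c2 := continuous_comp cp (@continuous_sin R (rowphase n x)).
exact (cvgB (cvgM (@cvg_cst _ (complex.Re zeta) _ _ FF) c1)
  (cvgM (@cvg_cst _ (complex.Im zeta) _ _ FF) c2)).
Qed.

Lemma is_derive_trig n zeta j x :
  is_derive x (delta_mx ord0 j) (trig n zeta) (trig n (symb R n j * zeta) x).
Proof.
set w := twopi R (n j); set p := rowphase n x.
pose a := complex.Re zeta; pose b := complex.Im zeta.
pose G (t : R) : R := a * cos (w * t + p) - b * sin (w * t + p).
have dw : is_derive (0:R) (1:R) (fun t : R => w * t + p) w.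
  by apply: is_derive_eq; rewrite /GRing.scale /= mulr1 addr0.
have dc := @is_derive1_comp _ (@cos R) (fun t : R => w * t + p) 0 _ _ (is_derive_cos _) dw.
have ds := @is_derive1_comp _ (@sin R) (fun t : R => w * t + p) 0 _ _ (is_derive_sin _) dw.
have dG := is_deriveB (is_deriveZ a dc) (is_deriveZ b ds).
have e : (fun h : R => h^-1 *: ((trig n zeta \o shift x) (h *: delta_mx ord0 j) - trig n zeta x)) =
    (fun h : R => h^-1 *: ((G \o shift 0) (h *: 1) - G 0)).
  apply/funext => h; congr (_ *: _); rewrite /trig /G /= rowphaseD rowphaseZ rowphase_delta.
  by rewrite -/w -/p mulr0 !add0r addr0 -/a -/b /GRing.scale /= mulr1 [h * w]mulrC.
have eG : G = (a \*: (cos \o (fun t : R => w * t + p))) - (b \*: (sin \o (fun t : R => w * t + p))).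
  by [].
rewrite -eG in dG; case: dG => dG vG.
apply: DeriveDef; first by rewrite /derivable e.
rewrite /derive e -[LHS]/('D_1 G 0) vG /trig /GRing.scale /= mulr0 add0r -/p.
by rewrite /a /b; case: (zeta) => a' b' /=; rewrite -/w; ring.
Qed.

Lemma iter_partial_trig n s zeta :
  iter_partial s (trig n zeta) = trig n ((\prod_(j <- s) symb R n j) * zeta).
Proof.
elim: s => [|j s IH] /=; first by rewrite big_nil mul1r.
rewrite IH big_cons -mulrA; apply/funext => x.
by have [_] := is_derive_trig n ((\prod_(j0 <- s) symb R n j0) * zeta) j x.
Qed.

Lemma test_function_trig n zeta : test_function (trig n zeta).
Proof.
split=> [j x|s].
  have [c e] := cos_period (rowphase n x) (n j).
  by rewrite /trig rowphaseD rowphase_delta c e.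
rewrite iter_partial_trig; split; first exact: continuous_trig.
by move=> j x; have [] := is_derive_trig n ((\prod_(j0 <- s) symb R n j0) * zeta) j x.
Qed.

Lemma rowphase_to_row n (x : T) : rowphase n (to_row x) = phase n x.
Proof. by apply: eq_bigr => j _; rewrite mxE. Qed.

Definition mi_seq (a : multi_index d) : seq 'I_d :=
  flatten [seq nseq (a j) j | j <- enum 'I_d].

Lemma size_mi_seq a : size (mi_seq a) = mi_size a.
Proof.
rewrite /mi_seq size_flatten /shape -map_comp sumnE big_map.
by rewrite big_enum /=; apply: eq_bigr => j _; rewrite size_nseq.
Qed.

Definition real_weak_derivative (a : multi_index d) (f g : T -> R) :=
  forall phi, test_function phi ->
  \int[P]_x (f x * mpartial a phi (to_row x)) =
  (-1) ^+ mi_size a * \int[P]_x (g x * phi (to_row x)).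

Lemma fcoef_weak_derivative n a (f g : T -> R) :
  L1 P f -> L1 P g -> real_weak_derivative a f g ->
  fcoef n g = (\prod_(j <- mi_seq a) (- symb R n j)) * fcoef n f.
Proof.
move=> lf lg fg.
have trigE (u : T -> R) zeta : L1 P u ->
    \int[P]_x (u x * trig n zeta (to_row x)) = complex.Re (zeta * fcoef n u).
  move=> lu; have lc := L1_cos0 n lu; have ls := L1_sin0 n lu.
  transitivity (\int[P]_x (complex.Re zeta * (u x * cos (phase n x)) -
      complex.Im zeta * (u x * sin (phase n x)))).
    by apply: eq_Rintegral => x _; rewrite /trig rowphase_to_row; ring.
  rewrite (RintegralB measurableT (L1Z _ lc) (L1Z _ ls)).
  rewrite (RintegralZl _ measurableT lc) (RintegralZl _ measurableT ls) /fcoef.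
  by case: zeta.
set p := \prod_(j <- mi_seq a) symb R n j.
have H zeta : complex.Re (p * zeta * fcoef n f) = (-1) ^+ mi_size a * complex.Re (zeta * fcoef n g).
  rewrite -!trigE// -(fg _ (test_function_trig n zeta)).
  by rewrite /mpartial iter_partial_trig.
have e : p * fcoef n f = (-1) ^+ mi_size a * fcoef n g.
  (* The values 1 and -i of [zeta] recover both parts of a complex identity from identities of real
     parts. *)
  have H1 := H 1; have H2 := H (Complex 0 (-1)).
  have s : ((-1) ^+ mi_size a : R[i]) = ((-1) ^+ mi_size a : R)%:C%C.
    by rewrite rmorphXn rmorphN rmorph1.
  rewrite s; move: H1 H2; rewrite mulr1 mul1r.
  move: (p) (fcoef n f) (fcoef n g) ((-1) ^+ mi_size a : R) => [p1 p2] [f1 f2] [g1 g2] m /= H1 H2.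
  apply/eqP; rewrite eq_complex /=; apply/andP; split; apply/eqP.
    by rewrite mul0r subr0 -H1.
  rewrite mul0r addr0.
  have -> : m * g2 = m * (0 * g1 - -1 * g2) by ring.
  by rewrite -H2; ring.
have -> : \prod_(j <- mi_seq a) (- symb R n j) = (-1) ^+ mi_size a * p.
  rewrite -size_mi_seq /p; elim: (mi_seq a) => [|j s IH]; first by rewrite !big_nil mulr1.
  by rewrite !big_cons IH /= exprS; ring.
by rewrite -mulrA e mulrA -exprMn mulrNN mulr1 expr1n mul1r.
Qed.

Lemma weak_derivative_ReIm (a : multi_index d) (u v : T -> R[i]) : weak_derivative a u v ->
  real_weak_derivative a (fun x : T => complex.Re (u x)) (fun x : T => complex.Re (v x)) /\
  real_weak_derivative a (fun x : T => complex.Im (u x)) (fun x : T => complex.Im (v x)).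
Proof.
move=> uv.
have s : ((-1) ^+ mi_size a : R[i]) = ((-1) ^+ mi_size a : R)%:C%C.
  by rewrite rmorphXn rmorphN rmorph1.
have eR (w : T -> R[i]) (g : T -> R) : \int[P]_x complex.Re (w x * (g x)%:C%C) =
    \int[P]_x (complex.Re (w x) * g x).
  by apply: eq_Rintegral => x _; case: (w x) => a' b' /=; ring.
have eI (w : T -> R[i]) (g : T -> R) : \int[P]_x complex.Im (w x * (g x)%:C%C) =
    \int[P]_x (complex.Im (w x) * g x).
  by apply: eq_Rintegral => x _; case: (w x) => a' b' /=; ring.
split => phi tphi; have := uv phi tphi; rewrite /cintegral !eR !eI s => -[].
  by move=> -> _; rewrite mul0r subr0.
by move=> _ ->; rewrite mul0r addr0.
Qed.

End trigonometric_test_functions.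

(** * Multipliers controlled by iterated maximal functions *)

Section multiplier_domination.
Context (R : realType) (d k : nat).
Local Notation T := (euclid R d).
Local Notation P := (torus_prob R d).
Local Notation L1 := (L1 P).
Variable hs : nat -> R.
Hypothesis hs0 : forall i, 0 < hs i.
Local Notation nop := (nop hs).
Local Notation freq := ('I_d -> int).
Implicit Types (n : freq) (j : 'I_d) (s : seq 'I_d) (F : T -> \bar R).

Section nop.
Variable F : T -> \bar R.
Hypotheses (mF : measurable_fun setT F) (F0 : forall x, (0 <= F x)%E).

Lemma nop_ge0 x : (0 <= nop F x)%E.
Proof. by rewrite adde_ge0// sume_ge0// => j _; exact: maxop_ge0. Qed.

Lemma measurable_nop : measurable_fun setT (nop F).
Proof.
apply: emeasurable_funD => //; apply: emeasurable_sum => j.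
exact: measurable_maxop.
Qed.

Lemma le_nop x : (F x <= nop F x)%E.
Proof. by rewrite leeDl// sume_ge0// => j _; exact: maxop_ge0. Qed.

Lemma rop_le_nop i j x : (rop (hs i) j F x <= nop F x)%E.
Proof.
apply: le_trans (rop_le_maxop hs j F x i) _.
rewrite /nop (bigD1 j)//= addeCA leeDl// adde_ge0// sume_ge0// => j' _.
exact: maxop_ge0.
Qed.

End nop.

Lemma iter_nop p F : measurable_fun setT F -> (forall x, (0 <= F x)%E) ->
  measurable_fun setT (iter p nop F) /\ forall x, (0 <= iter p nop F x)%E.
Proof.
move=> mF F0; elim: p => //= p [mp p0].
by split; [exact: measurable_nop|exact: nop_ge0].
Qed.

Lemma le_iter_nop p q F x : measurable_fun setT F -> (forall x, (0 <= F x)%E) ->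
  (iter p nop F x <= iter (q + p) nop F x)%E.
Proof.
move=> mF F0; elim: q => //= q IH; apply: le_trans IH _.
by have [_ p0] := iter_nop (q + p) mF F0; exact: le_nop.
Qed.

Definition dsymb s n : R[i] := \prod_(j <- s) (- symb R n j).

(* The multiplier [v h] maps L1 functions [f] to functions controlled, at each
   scale [h], by maximal functions of [f] and of [h ^ k] times its [k]-th
   derivatives, with constants independent of [f] and [h]. *)
Definition dominated_by c p (v : R -> freq -> R[i]) := forall i (f : T -> R) F0 F, L1 f ->
  measurable_fun setT F0 -> measurable_fun setT F ->
  (forall x, 0 <= F0 x)%E -> (forall x, 0 <= F x)%E ->
  {ae P, forall x, (`|f x|%:E <= F0 x)%E} ->
  (forall s, size s = k -> exists D : T -> R, [/\ L1 D,
    forall n, fcoef n D = dsymb s n * fcoef n f &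
    {ae P, forall x, (`|D x|%:E <= F x)%E}]) ->
  exists g : T -> R, [/\ L1 g, forall n, fcoef n g = v (hs i) n * fcoef n f &
    {ae P, forall x, (`|g x|%:E <=
      c%:E * (iter p nop F0 x + (hs i ^+ k)%:E * iter p nop F x))%E}].

Definition dominated v := exists c p, 0 <= c /\ dominated_by c p v.

Lemma dominated_by_le c c' p q v : 0 <= c -> c <= c' -> dominated_by c p v ->
  dominated_by c' (q + p) v.
Proof.
move=> c0 cc' H i f F0 F lf mF0 mF F00 Fp fF0 HD.
have [g [lg eg ge]] := H i f F0 F lf mF0 mF F00 Fp fF0 HD.
exists g; split => //; apply: filterS ge => x gx; apply: le_trans gx _.
have hk : (0 <= (hs i ^+ k)%:E)%E by rewrite lee_fin exprn_ge0// ltW.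
have [_ a0] := iter_nop p mF0 F00; have [_ b0] := iter_nop p mF Fp.
apply: lee_pmul; rewrite ?lee_fin//; first by rewrite adde_ge0// mule_ge0.
by apply: leeD; [exact: le_iter_nop|rewrite lee_wpmul2l//; exact: le_iter_nop].
Qed.

Lemma dominated_eq v v' : (forall h n, 0 < h -> v h n = v' h n) -> dominated v -> dominated v'.
Proof.
move=> vv' [c [p [c0 H]]]; exists c, p; split => // i f F0 F lf mF0 mF F00 Fp fF0 HD.
have [g [lg eg ge]] := H i f F0 F lf mF0 mF F00 Fp fF0 HD.
by exists g; split => // n; rewrite -vv'.
Qed.

Lemma dominated1 : dominated (fun _ _ => 1).
Proof.
exists 1, 0%N; split => // i f F0 F lf mF0 mF F00 Fp fF0 HD.
exists f; split => //; first by move=> n; rewrite mul1r.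
apply: filterS fF0 => x fx; rewrite mul1e/=; apply: le_trans fx _.
by rewrite leeDl// mule_ge0// lee_fin exprn_ge0// ltW.
Qed.

Lemma dominated_top s : size s = k -> dominated (fun h n => (h ^+ k)%:C%C * dsymb s n).
Proof.
move=> sk; exists 1, 0%N; split => // i f F0 F lf mF0 mF F00 Fp fF0 HD.
have [D [lD eD DF]] := HD s sk.
have hk : 0 <= hs i ^+ k by rewrite exprn_ge0// ltW.
exists (fun x => hs i ^+ k * D x); split; first exact: L1Z.
  by move=> n; rewrite fcoefZ// eD mulrA.
apply: filterS DF => x Dx; rewrite mul1e/= normrM ger0_norm// EFinM.
by apply: le_trans (lee_wpmul2l _ Dx) _; rewrite ?lee_fin// leeDr.
Qed.

Lemma dominatedD v v' : dominated v -> dominated v' -> dominated (fun h n => v h n + v' h n).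
Proof.
move=> [c [p [c0 H]]] [c' [p' [c0' H']]].
exists (c + c'), (p' + p)%N; split; first exact: addr_ge0.
move=> i f F0 F lf mF0 mF F00 Fp fF0 HD.
have H1 : dominated_by c (p' + p) v := dominated_by_le p' c0 (lexx c) H.
have H2 : dominated_by c' (p + p') v' := dominated_by_le p c0' (lexx c') H'.
have [g [lg eg ge]] := H1 i f F0 F lf mF0 mF F00 Fp fF0 HD.
have [g' [lg' eg' ge']] := H2 i f F0 F lf mF0 mF F00 Fp fF0 HD.
exists (fun x => g x + g' x); split; first exact: L1D.
  by move=> n; rewrite fcoefD// eg eg' mulrDl.
have hk : (0 <= (hs i ^+ k)%:E)%E by rewrite lee_fin exprn_ge0// ltW.
have [_ a0] := iter_nop (p' + p) mF0 F00; have [_ b0] := iter_nop (p' + p) mF Fp.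
rewrite addnC in ge'; apply: filterS2 ge ge' => x gx gx'.
apply: (@le_trans _ _ (`|g x|%:E + `|g' x|%:E)%E); first by rewrite -EFinD lee_fin ler_normD.
rewrite EFinD ge0_muleDl ?lee_fin//; exact: leeD.
Qed.

Lemma dominatedN v : dominated v -> dominated (fun h n => - v h n).
Proof.
move=> [c [p [c0 H]]]; exists c, p; split => // i f F0 F lf mF0 mF F00 Fp fF0 HD.
have [g [lg eg ge]] := H i f F0 F lf mF0 mF F00 Fp fF0 HD.
exists (fun x => -1 * g x); split; first exact: L1Z.
  by move=> n; rewrite fcoefZ// eg rmorphN1 mulN1r mulNr.
by apply: filterS ge => x; rewrite normrM normrN1 mul1r.
Qed.

Definition rho j (h : R) n : R[i] := (1 + h%:C%C * symb R n j)^-1.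

(** The resolvent is positive and lies below [nop] at every scale, so it costs one more iteration
    and leaves the constant unchanged. The majorant holds only almost everywhere, hence the appeal
    to [ae_le_rop]. *)
Lemma dominated_rho j v : dominated v -> dominated (fun h n => rho j h n * v h n).
Proof.
move=> [c [p [c0 H]]]; exists c, p.+1; split => // i f F0 F lf mF0 mF F00 Fp fF0 HD.
have [g [lg eg ge]] := H i f F0 F lf mF0 mF F00 Fp fF0 HD.
have hk : 0 <= hs i ^+ k by rewrite exprn_ge0// ltW.
have [ma a0] := iter_nop p mF0 F00; have [mb b0] := iter_nop p mF Fp.
exists (res (hs i) j g); split; first exact: L1_res.
  move=> n; have := fcoef_res j (hs0 i) n lg; rewrite eg => e.
  by rewrite /rho -mulrA -e mulrA mulVf ?mul1r// symb_neq0.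
have mg := L1_measurable lg.
pose A x := iter p nop F0 x; pose B x := iter p nop F x.
pose hB x := ((hs i ^+ k)%:E * B x)%E.
have mhB : measurable_fun setT hB by apply: emeasurable_funM.
have hB0 x : (0 <= hB x)%E by rewrite mule_ge0// lee_fin.
have mAB : measurable_fun setT (A \+ hB)%E by exact: emeasurable_funD.
have AB0 x : (0 <= A x + hB x)%E by rewrite adde_ge0.
have le1 : {ae P, forall x, (rop (hs i) j (fun x => `|g x|%:E) x <=
    rop (hs i) j (fun x => c%:E * (A x + hB x)) x)%E}.
  apply: ae_le_rop => //.
  - by apply/measurable_EFinP; exact: measurableT_comp.
  - exact: emeasurable_funM.
  - by move=> x; rewrite mule_ge0// lee_fin.
apply: filterS le1 => x H1; apply: le_trans (res_le j (hs0 i) x mg) _.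
apply: le_trans H1 _; rewrite ropZ// lee_wpmul2l ?lee_fin// ropD//.
by apply: leeD; [exact: rop_le_nop|rewrite /hB ropZ// lee_wpmul2l ?lee_fin//; exact: rop_le_nop].
Qed.

Definition hsymb s (h : R) n : R[i] := \prod_(j <- s) (- (h%:C%C * symb R n j)).

Lemma rho_symb j h n : rho j h n * (h%:C%C * symb R n j) = 1 - rho j h n.
Proof.
have := symb_neq0 h n j; rewrite /rho; set z := h%:C%C * _ => z0.
by rewrite -{2}[1](mulVf z0) -[X in _ = _ - X]mulr1 -mulrBr; congr (_ * _); ring.
Qed.

(* Write m_s for [hsymb s]. Since m_(j :: s) = - h symb_j m_s and rho_j h symb_j =
   1 - rho_j, m_s - rho_j m_s = - rho_j m_(j :: s), which is dominated by descending
   induction on the size of [s]. Iterating, m_s differs by a dominated multiplier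
   from (\prod_(j <- s) rho_j) m_s = \prod_(j <- s) (rho_j - 1). *)
Lemma dominated_hsymb s : (size s <= k)%N -> dominated (hsymb s).
Proof.
move: {2}(k - size s)%N (erefl (k - size s)%N) => m.
elim: m s => [|m IH] s sm sk.
  have {sm sk} sk : size s = k by apply/eqP; rewrite eqn_leq sk -subn_eq0 sm.
  apply: dominated_eq (dominated_top sk) => h n _.
  rewrite -sk /hsymb /dsymb; elim: s {sk} => [|j s IHs]; first by rewrite !big_nil mulr1.
  by rewrite !big_cons -IHs /= exprS rmorphM; ring.
have step j : dominated (fun h n => hsymb s h n - rho j h n * hsymb s h n).
  have /dominated_rho-/(_ j)/dominatedN : dominated (hsymb (j :: s)).
    by apply: IH => /=; lia.
  apply: dominated_eq => h n _; rewrite /hsymb big_cons.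
  rewrite mulNr mulrN opprK mulrA rho_symb; ring.
have zero : dominated (fun _ _ => 0).
  apply: dominated_eq (dominatedD dominated1 (dominatedN dominated1)) => h n _.
  by rewrite subrr.
have diff s' : dominated (fun h n => hsymb s h n - (\prod_(j <- s') rho j h n) * hsymb s h n).
  elim: s' => [|j s' IHs'].
    by apply: dominated_eq zero => h n _; rewrite big_nil mul1r subrr.
  apply: dominated_eq (dominatedD (step j) (dominated_rho j IHs')) => h n _.
  by rewrite big_cons; ring.
have low s' : dominated (fun h n => (\prod_(j <- s') rho j h n) * hsymb s' h n).
  elim: s' => [|j s' IHs'].
    by apply: dominated_eq dominated1 => h n _; rewrite /hsymb !big_nil mul1r.
  apply: dominated_eq (dominatedD (dominated_rho j IHs') (dominatedN IHs')) => h n _.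
  rewrite /hsymb !big_cons; set a := \prod_(_ <- _) _; set b := \prod_(_ <- _) _.
  have -> : rho j h n * a * (- (h%:C%C * symb R n j) * b) =
    - (rho j h n * (h%:C%C * symb R n j)) * (a * b) by ring.
  by rewrite rho_symb; ring.
apply: dominated_eq (dominatedD (diff s) (low s)) => h n _; ring.
Qed.

(** Constants and numbers of iterations may be enlarged by [dominated_by_le], so their sums over a
    finite list serve all its members. *)
Lemma dominated_uniform (I : eqType) (L : seq I) (v : I -> R -> freq -> R[i]) :
  (forall i, i \in L -> dominated (v i)) ->
  exists c p, 0 <= c /\ forall i, i \in L -> dominated_by c p (v i).
Proof.
elim: L => [|a L IH] H; first by exists 0, 0%N.
have [|c [p [c0 Hc]]] := IH; first by move=> i iL; apply: H; rewrite inE iL orbT.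
have [c' [p' [c0' Hc']]] := H a (mem_head _ _).
exists (c + c'), (p' + p)%N; split; first exact: addr_ge0.
move=> i; rewrite inE => /orP[/eqP ->|iL].
  by rewrite addnC; apply: (dominated_by_le p c0' _ Hc'); rewrite lerDr.
by apply: (dominated_by_le p' c0 _ (Hc i iL)); rewrite lerDl.
Qed.

Lemma derivative_domination l : (l <= k)%N -> exists c p, 0 <= c /\
  forall s, size s = l -> dominated_by c p (hsymb s).
Proof.
move=> lk; have [|c [p [c0 H]]] :=
  @dominated_uniform _ (enum {: l.-tuple 'I_d}) (fun t : l.-tuple 'I_d => hsymb t).
  by move=> s _; apply: dominated_hsymb; rewrite size_tuple.
exists c, p; split => // s sl; have st : size s == l by apply/eqP.
exact: (H (Tuple st) (mem_enum _ _)).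
Qed.

End multiplier_domination.

(** * The pointwise inequality *)

Section scales.
Context (R : realType).

(** An enumeration of the positive rationals, with 1 for the other codes. Countability lets the
    inequalities at all scales hold outside one null set, and density suffices for the
    optimization. *)
Definition scale (i : nat) : R :=
  if unpickle i is Some q then if 0 < (q : rat) then ratr q else 1 else 1.

Lemma scale_gt0 i : 0 < scale i.
Proof. by rewrite /scale; case: unpickle => // q; case: ifP => //; rewrite ltr0q. Qed.

Lemma scale_dense (r r' : R) : 0 <= r -> r < r' -> exists i, r < scale i < r'.
Proof.
move=> r0 rr'; have [q] := rat_in_itvoo rr'.
rewrite in_itv/= => /andP[rq qr'].
exists (pickle q); rewrite /scale pickleK.
have -> : 0 < q by rewrite -(ltr0q R); exact: le_lt_trans rq.
by rewrite rq.
Qed.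

(* Take the scale between (G / F) ^ (1 / k) and twice that. *)
Lemma multiplicative_bound (k l : nat) (a c G F : R) : (0 < l)%N -> (l < k)%N ->
  0 <= c -> 0 <= a -> 0 <= G -> 0 <= F ->
  (forall i, scale i ^+ l * a <= c * (G + scale i ^+ k * F)) ->
  a <= c * (1 + 2 ^+ k) * (F `^ (l%:R / k%:R) * G `^ (1 - l%:R / k%:R)).
Proof.
move=> l0 lk c0 a0 G0 F0 H.
have k0 : k%:R != 0 :> R by rewrite pnatr_eq0; lia.
have t0 : l%:R / k%:R != 0 :> R by rewrite mulf_neq0 ?invr_neq0// pnatr_eq0; lia.
have t1 : 1 - l%:R / k%:R != 0 :> R.
  rewrite subr_eq0 eq_sym; apply/eqP => /(congr1 (fun z => z * k%:R)).
  by rewrite divfK// mul1r => /eqP; rewrite eqr_nat; lia.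
have [F00|F00] := eqVneq F 0.
  rewrite F00 powR0// mul0r mulr0.
  move: H; rewrite F00 => H; rewrite leNgt; apply/negP => ap.
  (* When [F = 0] the claim is [a = 0]; for [a > 0] a scale this large violates the hypothesis. *)
  have [i /andP[hi _]] : exists i, c * G / a + 1 < scale i < c * G / a + 2.
    by apply: scale_dense; [rewrite addr_ge0// divr_ge0// mulr_ge0|lra].
  have := H i; rewrite mulr0 addr0 leNgt => /negP; apply.
  have cG : 0 <= c * G / a by rewrite divr_ge0// mulr_ge0.
  have s1 : 1 <= scale i by lra.
  have : scale i * a <= scale i ^+ l * a by rewrite ler_pM2r// ler_eXnr.
  have : (c * G / a + 1) * a < scale i * a by rewrite ltr_pM2r.
  by rewrite mulrDl divfK ?gt_eqF// mul1r; lra.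
have [G00|G00] := eqVneq G 0.
  rewrite G00 powR0// mulr0 mulr0.
  move: H; rewrite G00 => H; rewrite leNgt; apply/negP => ap.
  have cF : 0 <= c * F by rewrite mulr_ge0.
  (* When [G = 0] a small scale contradicts [a > 0]; being below 1, it bounds its own power of
     exponent [k - l >= 1]. *)
  have m0 : 0 < Num.min 1 (a / (c * F + 1)) by rewrite lt_min ltr01 divr_gt0// ltr_wpDl.
  have [i /andP[hi]] := scale_dense (lexx 0) m0.
  rewrite lt_min => /andP[h1 ha].
  have := H i; rewrite add0r leNgt => /negP; apply.
  have -> : scale i ^+ k = scale i ^+ l * scale i ^+ (k - l) by rewrite -exprD subnKC// ltnW.
  rewrite -mulrA mulrCA ltr_pM2l ?exprn_gt0//.
  have : scale i ^+ (k - l) <= scale i by rewrite ler_iXnr ?subn_gt0 ?(ltW hi) ?(ltW h1).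
  rewrite ltr_pdivlMr ?ltr_wpDl// in ha.
  move=> s1; have : c * (scale i ^+ (k - l) * F) <= c * F * scale i.
    by rewrite -mulrA ler_wpM2l// mulrC ler_wpM2l.
  by lra.
have Gp : 0 < G by rewrite lt_def G00.
have Fp : 0 < F by rewrite lt_def F00.
pose x := G `^ k%:R^-1; pose y := F `^ k%:R^-1.
have xp : 0 < x by exact: powR_gt0.
have yp : 0 < y by exact: powR_gt0.
have xk : x ^+ k = G by rewrite -powR_mulrn ?(ltW xp)// -powRrM mulVf// powRr1.
have yk : y ^+ k = F by rewrite -powR_mulrn ?(ltW yp)// -powRrM mulVf// powRr1.
have -> : F `^ (l%:R / k%:R) = y ^+ l.
  by rewrite -powR_mulrn ?(ltW yp)// -powRrM mulrC.
have -> : G `^ (1 - l%:R / k%:R) = x ^+ (k - l).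
  rewrite -powR_mulrn ?(ltW xp)// -powRrM natrB ?(ltnW lk)//; congr (_ `^ _).
  by field.
have [i /andP[h1 h2]] : exists i, x / y < scale i < 2 * (x / y).
  by apply: scale_dense; [rewrite divr_ge0// ltW|have := divr_gt0 xp yp; lra].
have := H i; rewrite -xk -yk => Hi.
have sk : scale i ^+ k * y ^+ k <= 2 ^+ k * x ^+ k.
  have xE : x = (x / y) * y by rewrite divfK// gt_eqF.
  rewrite {1}xE [(x / y * y) ^+ k]exprMn mulrA ler_pM2r ?exprn_gt0// -exprMn.
  apply: lerXn2r; rewrite ?nnegrE ?(ltW (scale_gt0 i)) ?(ltW h2)//.
  by rewrite ltW// mulr_gt0// divr_gt0.
have sl : (x / y) ^+ l * a <= scale i ^+ l * a.
  apply: ler_wpM2r => //; apply: lerXn2r; rewrite ?nnegrE ?(ltW (scale_gt0 i)) ?(ltW h1)//.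
  by rewrite ltW// divr_gt0.
have fin : (x / y) ^+ l * a <= c * (1 + 2 ^+ k) * x ^+ k.
  apply: le_trans sl _; apply: le_trans Hi _.
  by rewrite -mulrA ler_wpM2l// mulrDl mul1r lerD2l.
have q0 : 0 < (x / y) ^+ l by rewrite exprn_gt0// divr_gt0.
rewrite -(ler_pM2l q0); apply: le_trans fin _.
rewrite le_eqVlt; apply/orP; left; apply/eqP.
have -> : x ^+ k = x ^+ l * x ^+ (k - l) by rewrite -exprD subnKC// ltnW.
rewrite exprMn exprVn; field.
by rewrite gt_eqF// exprn_gt0.
Qed.

End scales.

Section pointwise.
Context (R : realType) (d : nat).
Local Notation T := (euclid R d).
Local Notation P := (torus_prob R d).
Local Notation normc := Normc.normc.
Local Notation nop := (nop (@scale R)).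
Implicit Types (n : 'I_d -> int) (u v : T -> R[i]) (s : seq 'I_d) (a : multi_index d).

Lemma normr_Re_le (z : R[i]) : `|complex.Re z| <= normc z.
Proof.
by case: z => a b /=; rewrite -sqrtr_sqr ler_wsqrtr// lerDl sqr_ge0.
Qed.

Lemma normr_Im_le (z : R[i]) : `|complex.Im z| <= normc z.
Proof.
by case: z => a b /=; rewrite -[leLHS]sqrtr_sqr ler_wsqrtr// lerDr sqr_ge0.
Qed.

Lemma normc_le_ReIm (z : R[i]) : normc z <= `|complex.Re z| + `|complex.Im z|.
Proof.
case: z => a b /=; rewrite -[leRHS]ger0_norm ?addr_ge0// -sqrtr_sqr ler_wsqrtr//.
by rewrite sqrrD !real_normK ?num_real// lerD2r lerDl mulrn_wge0// mulr_ge0.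
Qed.

Lemma in_L1_normc v : in_L1 P v -> L1 P (fun x => normc (v x)).
Proof. by case. Qed.

Lemma in_L1_Re v : in_L1 P v -> L1 P (fun x => complex.Re (v x)).
Proof.
move=> lv; apply: L1_le (in_L1_normc lv) (lv.1.1) _ => x.
by rewrite [leRHS]ger0_norm ?normc_ge0// normr_Re_le.
Qed.

Lemma in_L1_Im v : in_L1 P v -> L1 P (fun x => complex.Im (v x)).
Proof.
move=> lv; apply: L1_le (in_L1_normc lv) (lv.1.2) _ => x.
by rewrite [leRHS]ger0_norm ?normc_ge0// normr_Im_le.
Qed.

Lemma nabla_spec k u a : sobolev k u -> (mi_size a <= k)%N ->
  in_L1 P (nabla a u) /\ weak_derivative a u (nabla a u).
Proof.
move=> [_ H] ak; have [v lv uv] := H a ak.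
by apply: (@xgetPex _ (fun=> 0) [set v | in_L1 P v /\ weak_derivative a u v]); exists v.
Qed.

Lemma fcoef_nabla k u a n : sobolev k u -> (mi_size a <= k)%N ->
  fcoef n (fun x => complex.Re (nabla a u x)) =
    dsymb R (mi_seq a) n * fcoef n (fun x => complex.Re (u x)) /\
  fcoef n (fun x => complex.Im (nabla a u x)) =
    dsymb R (mi_seq a) n * fcoef n (fun x => complex.Im (u x)).
Proof.
move=> su ak; have [lv wv] := nabla_spec su ak; have lu := su.1.
have [wr wi] := weak_derivative_ReIm wv.
split; apply: fcoef_weak_derivative => //.
- exact: in_L1_Re.
- exact: in_L1_Re.
- exact: in_L1_Im.
- exact: in_L1_Im.
Qed.

Definition mi_of_seq s : multi_index d := [ffun j => count_mem j s].

Lemma size_mi_of_seq s : mi_size (mi_of_seq s) = size s.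
Proof.
rewrite /mi_size; under eq_bigr do rewrite ffunE.
elim: s => [|i s IH] /=; first by rewrite big1.
by rewrite big_split/= IH (bigD1 i)//= eqxx big1 ?addn0// => j /negPf; rewrite eq_sym => ->.
Qed.

Lemma dsymb_mi_seq a n : dsymb R (mi_seq a) n = \prod_(j < d) (- symb R n j) ^+ a j.
Proof.
rewrite /dsymb /mi_seq big_flatten big_map big_enum /=.
by apply: eq_bigr => j _; rewrite big_nseq; elim: (a j) => [|m /= ->] //; rewrite exprS.
Qed.

Lemma dsymb_mi_of_seq s n : dsymb R (mi_seq (mi_of_seq s)) n = dsymb R s n.
Proof.
rewrite dsymb_mi_seq; under eq_bigr do rewrite ffunE.
elim: s => [|i s IH]; first by rewrite /dsymb big_nil big1.
rewrite /dsymb big_cons -/(dsymb R s n) -IH.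
rewrite /=; under eq_bigr do rewrite exprD.
rewrite big_split/=; congr (_ * _).
rewrite (bigD1 i)//= eqxx expr1 big1 ?mulr1// => j /negPf.
by rewrite eq_sym => ->.
Qed.

(** Indexed by words, as in [dominated_by]: a derivative occurs once for each ordering of its
    directions, which affects only constants. *)
Definition top_sum (k : nat) u (x : T) : R :=
  \sum_(t <- enum {: k.-tuple 'I_d}) normc (nabla (mi_of_seq t) u x).

Definition normE u (x : T) : \bar R := (normc (u x))%:E.

Lemma pointwise_bound (k l : nat) : (0 < l)%N -> (l < k)%N ->
  exists C p, 0 <= C /\ forall u a, sobolev k u -> mi_size a = l ->
    {ae P, forall x, iter p nop (normE u) x \is a fin_num ->
      iter p nop (EFin \o top_sum k u) x \is a fin_num ->
      normc (nabla a u x) <= C * (fine (iter p nop (EFin \o top_sum k u) x) `^ (l%:R / k%:R) *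
        fine (iter p nop (normE u) x) `^ (1 - l%:R / k%:R))}.
Proof.
move=> l0 lk.
have [c [p [c0 H]]] := derivative_domination d (@scale_gt0 R) (ltnW lk).
(* The factor 2 comes from adding the bounds for real and imaginary parts; the rest is the constant
   of [multiplicative_bound]. *)
exists (2 * c * (1 + 2 ^+ k)), p; split; first by rewrite !mulr_ge0// addr_ge0// exprn_ge0.
move=> u a su al; have lu := su.1.
have al' : (mi_size a <= k)%N by rewrite al ltnW.
have [la wa] := nabla_spec su al'.
have m0 : measurable_fun setT (normE u).
  by apply/measurable_EFinP; exact: measurable_normc lu.1.
have Lk (t : k.-tuple 'I_d) : in_L1 P (nabla (mi_of_seq t) u).
  by have [] := nabla_spec (a := mi_of_seq t) su; rewrite ?size_mi_of_seq ?size_tuple.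
have mk : measurable_fun setT (EFin \o top_sum k u).
  apply/measurable_EFinP; apply: measurable_sum => t.
  by apply: measurable_normc; exact: (Lk t).1.
have p0 x : (0 <= normE u x)%E by rewrite lee_fin normc_ge0.
have pk x : (0 <= (EFin \o top_sum k u) x)%E.
  by rewrite lee_fin sumr_ge0// => t _; exact: normc_ge0.
have top_le s x : size s = k -> normc (nabla (mi_of_seq s) u x) <= top_sum k u x.
  move=> sk; have st : size s == k by apply/eqP.
  rewrite /top_sum (bigD1_seq (Tuple st)) ?mem_enum ?enum_uniq//= lerDl.
  by rewrite sumr_ge0// => t _; exact: normc_ge0.
have sz : size (mi_seq a) = l by rewrite size_mi_seq.
have part (pr : R[i] -> R) : (forall z, `|pr z| <= normc z) ->
    L1 P (fun x => pr (u x)) ->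
    (forall b, (mi_size b <= k)%N -> L1 P (fun x => pr (nabla b u x)) /\
      forall n, fcoef n (fun x => pr (nabla b u x)) =
        dsymb R (mi_seq b) n * fcoef n (fun x => pr (u x))) ->
    {ae P, forall x, forall i, ((scale R i ^+ l * `|pr (nabla a u x)|)%:E <=
      c%:E * (iter p nop (normE u) x + (scale R i ^+ k)%:E * iter p nop (EFin \o top_sum k u) x))%E}.
  move=> prn lpu Hb; apply/ae_foralln => i.
  have := H _ sz i (fun x => pr (u x)) (normE u) (EFin \o top_sum k u) lpu m0 mk p0 pk.
  case.
  - by apply: aeW => x; rewrite lee_fin prn.
  - move=> s sk; have [|lD eD] := Hb (mi_of_seq s); first by rewrite size_mi_of_seq sk.
    exists (fun x => pr (nabla (mi_of_seq s) u x)); split => //.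
      by move=> n; rewrite eD dsymb_mi_of_seq.
    by apply: aeW => x; rewrite lee_fin; apply: le_trans (prn _) (top_le _ _ sk).
  - move=> g [lg eg ge].
    have [lD eD] := Hb a al'.
    have sl0 : 0 <= scale R i ^+ l by rewrite exprn_ge0// ltW// scale_gt0.
    (* [g] is known only through its Fourier coefficients, which are those of the scaled derivative;
       uniqueness identifies the two. *)
    have e : {ae P, forall x, g x = scale R i ^+ l * pr (nabla a u x)}.
      apply: (fcoef_inj lg (L1Z _ lD)) => n; rewrite fcoefZ// eg eD mulrA; congr (_ * _).
      rewrite -sz /hsymb /dsymb; elim: (mi_seq a) => [|j s IH]; first by rewrite !big_nil mulr1.
      by rewrite !big_cons IH /= exprS rmorphM; ring.
    by apply: filterS2 ge e => x gx ex; move: gx; rewrite ex normrM ger0_norm.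
have pR := part (@complex.Re R) normr_Re_le (in_L1_Re lu).
have pI := part (@complex.Im R) normr_Im_le (in_L1_Im lu).
have {}pR : {ae P, forall x, forall i, ((scale R i ^+ l * `|complex.Re (nabla a u x)|)%:E <=
      c%:E * (iter p nop (normE u) x + (scale R i ^+ k)%:E * iter p nop (EFin \o top_sum k u) x))%E}.
  apply: pR => b bk; split; first by apply: in_L1_Re; exact: (nabla_spec su bk).1.
  by move=> n; exact: (fcoef_nabla n su bk).1.
have {}pI : {ae P, forall x, forall i, ((scale R i ^+ l * `|complex.Im (nabla a u x)|)%:E <=
      c%:E * (iter p nop (normE u) x + (scale R i ^+ k)%:E * iter p nop (EFin \o top_sum k u) x))%E}.
  apply: pI => b bk; split; first by apply: in_L1_Im; exact: (nabla_spec su bk).1.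
  by move=> n; exact: (fcoef_nabla n su bk).2.
have [_ P0] := iter_nop (@scale_gt0 R) p m0 p0.
have [_ PK] := iter_nop (@scale_gt0 R) p mk pk.
apply: filterS2 pR pI => x hR hI f0 fk.
apply: multiplicative_bound; rewrite ?mulr_ge0 ?normc_ge0 ?fine_ge0// => i.
have := hR i; have := hI i.
rewrite -(fineK f0) -(fineK fk) -EFinM !lee_fin /= => h1 h2.
have s0 : 0 <= scale R i ^+ l by rewrite exprn_ge0// ltW// scale_gt0.
apply: le_trans (ler_wpM2l s0 (normc_le_ReIm _)) _.
by rewrite mulrDr; lra.
Qed.

End pointwise.

(** * Norms on the torus *)

Section torus_norms.
Context (R : realType) (d : nat).
Local Notation T := (euclid R d).
Local Notation P := (torus_prob R d).
Local Notation normc := Normc.normc.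
Local Notation rc g := (fun t : R => (g t)%:C%C).
Implicit Types (E F : symmetric_space R).

Lemma bnd_in0 E : bnd_in P E (cst 0) 0.
Proof.
have [Ez zn] : scarrier E (rc (rr P (cst 0))) /\ snorm E (rc (rr P (cst 0))) <= snorm E (fun=> 0).
  apply: (symm_solid (scarrier0 E)); first by apply: in_L0_real; exact: measurable_rr.
  move=> t /andP[t0 _]; rewrite normc_real (normc_real 0) normr0 ger0_norm ?rr_ge0//.
  rewrite rr_le// (_ : [set x | _] = set0) ?measure0 ?lee_fin ?ltW//.
  by apply/seteqP; split => x //=; rewrite ltxx.
by rewrite snorm0 in zn; split.
Qed.

(** The rearrangement vanishes almost everywhere by [snorm_eq0], and equimeasurability at level 0
    carries this back to [f]. *)
Lemma bnd_in_eq0 E f : bnd_in P E f 0 -> {ae P, forall x, f x = 0}.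
Proof.
move=> [mf f0 Ef fn].
have n0 : snorm E (rc (rr P f)) = 0 by apply/eqP; rewrite eq_le fn snorm_ge0.
have [N [mN N0 sN]] := snorm_eq0 Ef n0.
have P0 : P [set x | 0 < f x] = 0%E.
  rewrite -(rr_equimeasurable P mf (lexx 0)).
  apply: (subset_measure0 _ mN) => //.
    by apply: measurable_gt_set; exact: measurable_rr.
  move=> t /= r0; apply: sN => /= /(congr1 (@complex.Re R)) /= rt.
  by move: r0; rewrite rt ltxx.
exists [set x | 0 < f x]; split => //; first exact: measurable_gt_set.
by move=> x /= /eqP fx; rewrite lt_def fx f0.
Qed.

Lemma torus_space_bnd E (f : T -> R[i]) : torus_space E f ->
  bnd_in P E (fun x => normc (f x)) (snorm E (rc (rearr P f))).
Proof.
move=> [Lf Ef]; split => //; first exact: measurable_normc.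
by move=> x; exact: normc_ge0.
Qed.

Lemma bnd_torus_space E (f : T -> R) b : bnd_in P E f b ->
  torus_space E (fun x => (f x)%:C%C) /\ (torus_norm E (fun x => (f x)%:C%C) <= b%:E)%E.
Proof.
move=> [mf f0 Ef fb].
have e : rearr P (fun x => (f x)%:C%C) = rr P f.
  apply/funext => t; rewrite rearrE; congr (rr P _ t).
  by apply/funext => x; rewrite normc_real ger0_norm.
have S : torus_space E (fun x => (f x)%:C%C) by split; [exact: in_L0_real|rewrite e].
by split => //; rewrite /torus_norm asboolT// e lee_fin.
Qed.

Lemma torus_norm_ge0 E (f : T -> R[i]) : (0 <= torus_norm E f)%E.
Proof.
rewrite /torus_norm; case: asboolP => [[_ Ef]|_]; last by rewrite leey.
by rewrite lee_fin snorm_ge0.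
Qed.

Lemma torus_norm_fin E (f : T -> R[i]) (b : R) : in_L0 f -> (torus_norm E f <= b%:E)%E ->
  bnd_in P E (fun x => normc (f x)) b.
Proof.
rewrite /torus_norm; case: asboolP => // Sf Lf; rewrite lee_fin => fb.
exact: bnd_in_le fb (torus_space_bnd Sf).
Qed.

Lemma bnd_in_sum E (I : Type) (L : seq I) : cesaro_bounded E -> exists2 C, 0 <= C &
  forall (f : I -> T -> R) b, (forall i, bnd_in P E (f i) b) ->
    bnd_in P E (fun x => \sum_(i <- L) f i x) (C * b).
Proof.
move=> hE; have [M M0 HM] := cesaro_constant hE.
elim: L => [|i L [C C0 HC]].
  by exists 0 => // f b _; under eq_fun do rewrite big_nil; rewrite mul0r; exact: bnd_in0.
exists (2 * M * (1 + C)); first by rewrite !mulr_ge0// addr_ge0.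
move=> f b fb; under eq_fun do rewrite big_cons.
rewrite (_ : 2 * M * (1 + C) * b = 2 * M * (b + C * b)); last by ring.
by have := bnd_inD hE M0 HM (fb i) (HC f b fb).
Qed.

Lemma cl_norm_le (e : R) E F (h : T -> R[i]) (f g : T -> R) a b :
  e != 0 -> in_L0 h -> bnd_in P E f a -> bnd_in P F g b ->
  {ae P, forall x, normc (h x) <= f x `^ e * g x `^ (1 - e)} ->
  (cl_norm e E F h <= (Num.max a b)%:E)%E.
Proof.
move=> e0 Lh fa gb H.
have [Sf nf] := bnd_torus_space fa; have [Sg ng] := bnd_torus_space gb.
rewrite /cl_norm (negPf e0); apply: ge_ereal_inf.
exists (maxe (torus_norm E (fun x => (f x)%:C%C)) (torus_norm F (fun x => (g x)%:C%C))).
  split => //; exists f, g; split => //.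
  by case: fa => _ f0 _ _; case: gb => _ g0 _ _.
rewrite EFin_max ge_max; apply/andP; split.
  by rewrite le_max nf.
by rewrite le_max ng orbT.
Qed.

Lemma cl_norm_eq0 (e : R) E F (h : T -> R[i]) :
  e != 0 -> in_L0 h -> {ae P, forall x, h x = 0} ->
  (cl_norm e E F h <= 0)%E.
Proof.
move=> e0 Lh h0; have := cl_norm_le e0 Lh (bnd_in0 E) (bnd_in0 F).
rewrite maxxx; apply; apply: filterS h0 => x ->.
by rewrite (normc_real 0) normr0 mulr_ge0// powR_ge0.
Qed.

Lemma torus_norm_ae E (f g : T -> R[i]) : in_L0 f -> in_L0 g -> {ae P, forall x, f x = g x} ->
  torus_space E g -> (torus_norm E f <= torus_norm E g)%E.
Proof.
move=> Lf Lg fg Sg; rewrite [leRHS]/torus_norm asboolT//.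
have [Ef nf] : scarrier E (rc (rearr P f)) /\
    snorm E (rc (rearr P f)) <= snorm E (rc (rearr P g)).
  apply: (@rr_solid _ _ _ P E (fun x => normc (g x)) (fun x => normc (f x))).
  - exact: measurable_normc.
  - exact: Sg.2.
  - move=> t /andP[t0 _]; apply: rr_mono_ae => //; try exact: measurable_normc.
    by apply: filterS fg => x ->.
by rewrite /torus_norm asboolT// lee_fin.
Qed.

Lemma ae_complex_eq0 (f : T -> R[i]) : {ae P, forall x, complex.Re (f x) = 0} ->
  {ae P, forall x, complex.Im (f x) = 0} -> {ae P, forall x : T, f x = 0 :> R[i]}.
Proof.
by apply: filterS2 => x; case: (f x) => a b /= -> ->.
Qed.

Lemma nabla_eq0 k (u : T -> R[i]) (a : multi_index d) : sobolev k u -> (mi_size a <= k)%N ->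
  {ae P, forall x : T, u x = 0} -> {ae P, forall x, nabla a u x = 0}.
Proof.
move=> su ak u0; have lu := su.1; have [la _] := nabla_spec su ak.
have z (f : T -> R) : L1 P f -> {ae P, forall x, f x = 0} -> forall n, fcoef n f = 0.
  move=> lf f0 n; rewrite (ae_eq_fcoef (g := cst 0) n (L1_measurable lf))//.
  have := fcoefZ n 0 (L1_cst P (0 : R)); rewrite mul0r => <-.
  by congr fcoef; apply/funext => x; rewrite mul0r.
apply: ae_complex_eq0.
  apply: fourier_uniqueness (in_L1_Re la) _ => n; rewrite (fcoef_nabla n su ak).1 z ?mulr0//.
    exact: in_L1_Re.
  by apply: filterS u0 => x ->.
apply: fourier_uniqueness (in_L1_Im la) _ => n; rewrite (fcoef_nabla n su ak).2 z ?mulr0//.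
  exact: in_L1_Im.
by apply: filterS u0 => x ->.
Qed.

(** [nabla] chooses a representative, so even at order 0 it returns [u] only up to a null set. *)
Lemma nabla0_ae k (u : T -> R[i]) (a : multi_index d) :
  sobolev k u -> mi_size a = 0%N -> {ae P, forall x : T, nabla a u x = u x}.
Proof.
move=> su a0; have ak : (mi_size a <= k)%N by rewrite a0.
have lu := su.1; have [la _] := nabla_spec su ak.
have s1 n : dsymb R (mi_seq a) n = 1.
  by have /size0nil -> : size (mi_seq a) = 0%N; rewrite ?size_mi_seq// /dsymb big_nil.
have eR := fcoef_inj (in_L1_Re la) (in_L1_Re lu).
have eI := fcoef_inj (in_L1_Im la) (in_L1_Im lu).
apply: filterS2 (eR _) (eI _) => [x|n|n].
- by case: (nabla a u x) (u x) => [a1 b1] [a2 b2] /= -> ->.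
- by rewrite (fcoef_nabla n su ak).1 s1 mul1r.
- by rewrite (fcoef_nabla n su ak).2 s1 mul1r.
Qed.

End torus_norms.

Theorem corollary1p3 (R : realType) (d k l : nat) (E F : symmetric_space R)
    (hd : (1 < d)%N) (hk : (1 <= k)%N) (hl : (l < k)%N)
    (hE : cesaro_bounded E) (hF : cesaro_bounded F) :
  exists2 c : R, 0 < c &
    forall u : euclid R d -> R[i], sobolev k u -> torus_space F u ->
      (nabla_norm l (cl_norm (l%:R / k%:R) E F) u <=
       c%:E * nabla_norm k (torus_norm E) u `^ (l%:R / k%:R)
            * torus_norm F u `^ (1 - l%:R / k%:R))%E.
Proof.
(* For [l = 0] the space on the left is [F] by definition, and the constant 1 works. *)
have [->|l0] := posnP l.
  exists 1 => // u su Fu; rewrite mul0r subr0 poweRe0 mule1 mul1e poweRe1 ?torus_norm_ge0//.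
  apply: ge_ereal_sup => _ [a a0 <-]; rewrite /cl_norm eqxx.
  have ak : (mi_size a <= k)%N by rewrite a0.
  apply: torus_norm_ae => //; last exact: nabla0_ae su a0.
    exact: (nabla_spec su ak).1.1.
  exact: su.1.1.
pose e : R := l%:R / k%:R; rewrite -/e.
have e0 : 0 < e by rewrite divr_gt0// ltr0n; lia.
have e1 : 0 < 1 - e by rewrite subr_gt0 ltr_pdivrMr ?ltr0n ?mul1r ?ltr_nat//; lia.
have [C [p [C0 HC]]] := pointwise_bound R d l0 hl.
have [CE CE0 HCE] := ebnd_in_iter d (@scale_gt0 R) hE p.
have [CF CF0 HCF] := ebnd_in_iter d (@scale_gt0 R) hF p.
have [CS CS0 HCS] := bnd_in_sum d (enum {: k.-tuple 'I_d}) hE.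
(* [C] comes from the pointwise inequality, [CE] and [CF] from the iterated maximal operators, [CS]
   from summing the top derivatives; the final 1 ensures positivity. *)
exists (C * (CE * CS + CF) + 1); first by rewrite ltr_wpDl// mulr_ge0// addr_ge0// mulr_ge0.
move=> u su Fu; set A := nabla_norm k _ u; set B := torus_norm F u.
pose cc := C * (CE * CS + CF).
have cc0 : 0 <= cc by rewrite mulr_ge0// addr_ge0// mulr_ge0.
(* A coordinate exists, so the supremum is over a nonempty set and is not [-oo]. *)
have A0 : (0 <= A)%E.
  pose j : 'I_d := Ordinal (ltnW hd).
  apply: le_trans (torus_norm_ge0 E (nabla (mi_of_seq (nseq k j)) u)) _.
  by apply: ereal_sup_ubound; exists (mi_of_seq (nseq k j)) => //=; rewrite size_mi_of_seq size_nseq.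
pose b := snorm F (fun t => (rearr (torus_prob R d) u t)%:C%C).
have Bb : B = b%:E by rewrite /B /torus_norm asboolT.
have ub : bnd_in (torus_prob R d) F (fun x => Normc.normc (u x)) b := torus_space_bnd Fu.
have b0 : 0 <= b by rewrite -lee_fin -Bb torus_norm_ge0.
have RHS0 : (0 <= (cc + 1)%:E * A `^ e * B `^ (1 - e))%E.
  by rewrite !mule_ge0 ?poweR_ge0// lee_fin addr_ge0.
apply: ge_ereal_sup => _ [a al <-].
have ak : (mi_size a <= k)%N by rewrite al ltnW.
have [La Wa] := nabla_spec su ak.
have en : e != 0 by rewrite gt_eqF.
(* The rescaling below divides by [b]. If [b = 0] then [u], and with it the derivative, vanishes
   almost everywhere. *)
have [bz|bz] := eqVneq b 0.
  rewrite bz in ub.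
  apply: (le_trans _ RHS0); apply: cl_norm_eq0 => //; first exact: La.1.
  apply: (nabla_eq0 su ak); apply: filterS (bnd_in_eq0 ub) => x ux.
  have := normr_Re_le (u x); have := normr_Im_le (u x); rewrite ux !normr_le0.
  by case: (u x) => a1 a2 /= /eqP -> /eqP ->.
have bp : 0 < b by rewrite lt_def bz.
(* For [A = +oo] the right-hand side is infinite, because [b] and [e] are positive. *)
case eA : A A0 => [r| |] A0 //; last first.
  rewrite poweRyr// Bb poweR_EFin gt0_muley ?lte_fin ?ltr_wpDl// gt0_mulye ?leey//.
  by rewrite lte_fin powR_gt0.
rewrite lee_fin in A0.
have Lk (t : k.-tuple 'I_d) : in_L1 (torus_prob R d) (nabla (mi_of_seq t) u).
  by have [] := nabla_spec (a := mi_of_seq t) su; rewrite ?size_mi_of_seq ?size_tuple.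
have topr : bnd_in (torus_prob R d) E (top_sum k u) (CS * r).
  apply: (HCS (fun t x => Normc.normc (nabla (mi_of_seq t) u x))) => t.
  apply: torus_norm_fin; first exact: (Lk t).1.
  rewrite -eA; apply: ereal_sup_ubound; exists (mi_of_seq t) => //=.
  by rewrite size_mi_of_seq size_tuple.
have ebT : ebnd_in E (EFin \o top_sum k u) (CS * r).
  split => //; first by apply/measurable_EFinP; case: topr.
    by move=> x; rewrite lee_fin; case: topr.
  by apply: aeW.
have ebU : ebnd_in F (normE u) b.
  split => //; first by apply/measurable_EFinP; case: ub.
    by move=> x; rewrite lee_fin; case: ub.
  by apply: aeW.
have [mT T0 Tfin Tb] := HCE _ _ ebT; have [mG G0 Gfin Gb] := HCF _ _ ebU.
have pw := HC u a su al.
set f := fine \o _ in Tb; set g := fine \o _ in Gb.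
have f0 x : 0 <= f x by exact: fine_ge0.
have g0 x : 0 <= g x by exact: fine_ge0.
have fg : {ae torus_prob R d, forall x,
    Normc.normc (nabla a u x) <= C * (f x `^ e * g x `^ (1 - e))}.
  by apply: filterS3 pw Gfin Tfin => x H h1 h2; exact: H.
(* If [r = 0], the factor [f] vanishes almost everywhere, and since [e > 0] the derivative does
   too. *)
have [rz|rz] := eqVneq r 0.
  rewrite eA in RHS0; apply: le_trans RHS0; apply: cl_norm_eq0 => //; first exact: La.1.
  rewrite rz !mulr0 in Tb.
  apply: filterS2 fg (bnd_in_eq0 Tb) => x + fx; rewrite fx powR0// mul0r mulr0 => nx.
  have := le_trans (normr_Re_le _) nx; have := le_trans (normr_Im_le _) nx.
  by rewrite !normr_le0; case: (nabla a u x) => a1 a2 /= /eqP -> /eqP ->.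
have rp : 0 < r by rewrite lt_def rz.
(* Multiplying [f] by [C * w / r] and [g] by [C * w / b] makes both norm bounds constant multiples
   of [w], while the weighted product gains exactly the factor [C] of the pointwise bound. *)
pose w := r `^ e * b `^ (1 - e).
have w0 : 0 < w by rewrite mulr_gt0// powR_gt0.
have Cw0 : 0 <= C * w by apply: mulr_ge0; rewrite // ltW.
have k1 : 0 <= C * w / r by apply: divr_ge0; rewrite // ltW.
have k2 : 0 <= C * w / b by apply: divr_ge0; rewrite // ltW.
have := @cl_norm_le R d e E F (nabla a u) (fun x => C * w / r * f x) (fun x => C * w / b * g x)
  _ _ en La.1 (bnd_in_scale Tb k1) (bnd_in_scale Gb k2).
move=> /(_ _)/le_trans; apply.
  apply: filterS fg => x /le_trans; apply.
  have inv (y z : R) : 0 < y -> y^-1 `^ z = (y `^ z)^-1.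
    by move=> y0; rewrite -powR_inv1 ?(ltW y0)// -powRrM mulN1r powRN.
  have CwE : (C * w) `^ e * (C * w) `^ (1 - e) = C * w.
    rewrite -powRD; last by rewrite addrCA subrr addr0 oner_eq0.
    by rewrite addrCA subrr addr0 powRr1.
  rewrite !(powRM _ _ (f0 x)) ?(powRM _ _ (g0 x))// !(powRM _ Cw0) ?invr_ge0 ?(ltW rp) ?(ltW bp)//.
  rewrite !inv// le_eqVlt; apply/orP; left; apply/eqP.
  transitivity ((C * w) / w * (f x `^ e * g x `^ (1 - e))); first by rewrite mulfK// gt_eqF.
  rewrite -{1}CwE /w; field.
  by rewrite !gt_eqF ?powR_gt0.
rewrite Bb !poweR_EFin -!EFinM lee_fin -[leRHS]mulrA -/w ge_max mulrDl mul1r; apply/andP; split.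
  rewrite (_ : C * w / r * _ = C * (CE * CS) * w); last by field.
  have : C * (CE * CS) * w <= cc * w.
    by rewrite ler_wpM2r ?(ltW w0)// ler_wpM2l// lerDl.
  by have := ltW w0; rewrite -/cc; lra.
rewrite (_ : C * w / b * _ = C * CF * w); last by field.
have : C * CF * w <= cc * w.
  by rewrite ler_wpM2r ?(ltW w0)// ler_wpM2l// lerDr mulr_ge0.
by have := ltW w0; rewrite -/cc; lra.
Qed.
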